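(* Assume (H1)--(H3) (stated in the context). For any $T>0$, let $\boldsymbol U,\boldsymbol V$ be entropy solutions of the initial-value problem of the context with initial data $\boldsymbol U_0,\boldsymbol V_0$, respectively. Then $$\|\boldsymbol U(T,\cdot)-\boldsymbol V(T,\cdot)\|_{(L^1(\mathbb R))^N}\le\mathcal C\,\|\boldsymbol U_0-\boldsymbol V_0\|_{(L^1(\mathbb R))^N},$$ where $\mathcal C$ is a constant depending only on $\boldsymbol f,\boldsymbol\mu,\boldsymbol\nu,\boldsymbol\sigma,\boldsymbol U,\boldsymbol V$ and $T$. In particular, if $\boldsymbol U_0=\boldsymbol V_0$, then $\boldsymbol U=\boldsymbol V$ a.e. in $\overline Q_T$.
   Context: Problem. Fix $N\ge1$, $T>0$, $Q_T=(0,T)\times\mathbb R$, $\overline Q_T=[0,T]\times\mathbb R$. The initial-value problem (IVP) for $\boldsymbol U=(U^1,\dots,U^N)$ is, for $k=1,\dots,N$, $$\partial_tU^k+\partial_x\big(f^k(\sigma^k(x)U^k)\,\nu^k((\boldsymbol\mu*\boldsymbol U)^k)\big)=0\ \text{ in }Q_T,\qquad U^k(0,x)=U_0^k(x),$$ where $\boldsymbol\mu=(\mu^{k,j})_{k,j=1}^N$, $(\boldsymbol\mu*\boldsymbol U)^k:=(\mu^{k,1}*U^1,\dots,\mu^{k,N}*U^N)$, and $*$ is convolution in space only. Notation: $\boldsymbol f=(f^1,\dots,f^N)$, $\boldsymbol\nu=(\nu^1,\dots,\nu^N)$, $\boldsymbol\sigma=(\sigma^1,\dots,\sigma^N)$;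 $\|\boldsymbol f\|_{(L^1(\mathbb R))^N}=\sum_k\|f^k\|_{L^1(\mathbb R)}$. Standing assumptions, for all $k$: (H1) $f^k:\mathbb R\to\mathbb R$ is Lipschitz, $f^k(0)=0$. (H2) $\nu^k\in(C^2\cap BV\cap W^{2,\infty})(\mathbb R^N,\mathbb R)$, $\nu^k(\boldsymbol 0)=0$, $\boldsymbol\mu\in(C^2\cap BV\cap W^{2,\infty})(\mathbb R,\mathbb R^{N^2})$. (H3) $\sigma^k\in BV(\mathbb R)$ with $\inf_{x\in\mathbb R}\sigma^k(x)>0$. In (H2) and (H3), $BV$ means finite total variation. Entropy solution. Write $\overline U^k(t,x)=\sigma^k(x)U^k(t,x)$. A function $\boldsymbol U\in(C([0,T];L^1(\mathbb R))\cap L^\infty([0,T];BV(\mathbb R)))^N$ is an entropy solution of the IVP with initial data $\boldsymbol U_0$ if for all $k$, all $\alpha\in\mathbb R$ and all non-negative $\phi\in C_c^\infty([0,T)\times\mathbb R)$, $$\int_{Q_T}\Big|U^k-\frac{\alpha}{\sigma^k(x)}\Big|\phi_t\,dx\,dt+\int_{Q_T}\operatorname{sgn}(\overline U^k-\alpha)\,\nu^k((\boldsymbol\mu*\boldsymbol U)^k)(f^k(\overline U^k)-f^k(\alpha))\phi_x\,dx\,dt$$ $$-\int_{Q_T}f^k(\alpha)\operatorname{sgn}(\overline U^k-\alpha)\,\partial_x\nu^k((\boldsymbol\mu*\boldsymbol U)^k)\,\phi\,dx\,dt+\int_{\mathbb R}\Big|U_0^k(x)-\frac{\alpha}{\sigma^k(x)}\Big|\phi(0,x)\,dx\ge0.$$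 *)

(* Defs.v *)
From HB Require Import structures.
From mathcomp Require Import all_boot all_order all_algebra.
From mathcomp Require Import all_classical all_reals all_analysis.

Set Implicit Arguments.
Unset Strict Implicit.
Unset Printing Implicit Defensive.

Import Order.TTheory GRing.Theory Num.Theory.
Import numFieldNormedType.Exports.

Local Open Scope classical_set_scope.
Local Open Scope ring_scope.

Section smoothness.
Context {R : realType} {V : normedModType R}.
Implicit Types (f : V -> R) (vs : seq V) (m : nat).

Definition iterD vs f : V -> R := foldr (fun v g => 'D_v g) f vs.

(* C^m; all directions are allowed, not only those of a basis, which makes
   no difference in finite dimension. *)
Definition class_C m f : Prop := forall vs,
  ((size vs <= m)%N -> continuous (iterD vs f)) /\
  ((size vs < m)%N -> forall x v, derivable (iterD vs f) x v).

Definition smooth f : Prop := forall m, class_C m f.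

(* W^{m,oo} for functions of class C^m: the weak derivatives are the classical
   ones and the essential supremum is the supremum.  The bound may depend on
   the directions vs. *)
Definition bounded_derivs m f : Prop := forall vs, (size vs <= m)%N ->
  exists M : R, forall x, `|iterD vs f x| <= M.

Definition fun_support f : set V := closure [set x | f x != 0].

Definition compactly_supported f : Prop := compact (fun_support f).

End smoothness.

Section bounded_variation.
Context {R : realType}.

Definition variation_line (u : R -> R) : \bar R :=
  ereal_sup [set total_variation ab.1 ab.2 u |
             ab in [set ab : R * R | ab.1 <= ab.2]].

Definition BV_line (u : R -> R) : Prop := (variation_line u < +oo)%E.

(* u, as a class for equality almost everywhere, has variation at most M *)
Definition ess_variation_le (M : R) (u : R -> R) : Prop :=
  exists v : R -> R, {ae (@lebesgue_measure R), forall x, v x = u x} /\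
    (variation_line v <= M%:E)%E.

(* Iterated Lebesgue integral over R^n.  It is only applied to continuous
   compactly supported functions, for which it is the integral with respect
   to the n-dimensional Lebesgue measure. *)
Fixpoint integral_Rn (n : nat) : ('rV[R]_n -> R) -> R :=
  match n with
  | 0 => fun g => g 0
  | n'.+1 => fun g => \int[@lebesgue_measure R]_x
      integral_Rn (fun y : 'rV[R]_n' => g (row_mx (x%:M : 'rV[R]_1) y))
  end.

Definition divergence (n : nat) (phi : 'I_n -> 'rV[R]_n -> R) (x : 'rV[R]_n)
  : R := \sum_(i < n) 'D_(delta_mx 0 i) (phi i) x.

Definition variation_Rn (n : nat) (g : 'rV[R]_n -> R) : \bar R :=
  ereal_sup [set (integral_Rn (fun x => g x * divergence phi x))%:E |
    phi in [set phi : 'I_n -> 'rV[R]_n -> R |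
      [/\ forall i, class_C 1 (phi i),
          forall i, compactly_supported (phi i) &
          forall x, \sum_(i < n) phi i x ^+ 2 <= 1]]].

Definition BV_Rn (n : nat) (g : 'rV[R]_n -> R) : Prop :=
  (variation_Rn g < +oo)%E.

End bounded_variation.

Section hypotheses.
Context {R : realType} {N : nat}.

Definition H1 (f : 'I_N -> R -> R) : Prop := forall k,
  [lipschitz f k x | x in [set: R]] /\ f k 0 = 0.

Definition H2 (nu : 'I_N -> 'rV[R]_N -> R) (mu : 'I_N -> 'I_N -> R -> R)
  : Prop :=
  (forall k, [/\ class_C 2 (nu k), BV_Rn (nu k), bounded_derivs 2 (nu k) &
                 nu k 0 = 0]) /\
  (forall k j, [/\ class_C 2 (mu k j), BV_line (mu k j) &
                   bounded_derivs 2 (mu k j)]).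

(* The infimum in R of a set that is not bounded below is 0, so positivity
   includes boundedness from below. *)
Definition H3 (sigma : 'I_N -> R -> R) : Prop := forall k,
  BV_line (sigma k) /\ 0 < inf (range (sigma k)).

End hypotheses.

Section entropy_solutions.
Context {R : realType} {N : nat}.
Implicit Types (U : 'I_N -> R -> R -> R) (u : 'I_N -> R -> R).

Local Notation leb := (@lebesgue_measure R).
Local Notation leb2 := (leb \x leb)%E.

Definition L1norm (u : R -> R) : \bar R := 'N[leb]_1[EFin \o u].

Definition L1normN u : \bar R := (\sum_(k < N) L1norm (u k))%E.

Definition space_conv (m u : R -> R) (x : R) : R :=
  \int[leb]_y (m (x - y) * u y).

(* the vector (mu * u)^k at x *)
Definition conv_vec (mu : 'I_N -> 'I_N -> R -> R) u (k : 'I_N) (x : R)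
  : 'rV[R]_N := \row_j space_conv (mu k j) (u j) x.

(* A curve in L^1 is given by a representative that is jointly measurable. *)
Definition in_C_L1 (T : R) (U : R -> R -> R) : Prop :=
  [/\ measurable_fun (`[0, T] `*` setT) (fun p : R * R => U p.1 p.2),
      forall t, 0 <= t <= T -> leb.-integrable setT (EFin \o U t) &
      forall s, 0 <= s <= T ->
        L1norm (U t \- U s) @[t --> within `[0, T] (nbhs s)] --> 0%E].

Definition in_Linfty_BV (T : R) (U : R -> R -> R) : Prop :=
  exists M : R, {ae leb, forall t, 0 <= t <= T -> ess_variation_le M (U t)}.

(* Restrictions to [0, T) x R of smooth functions on the plane with compact
   support in (-oo, T) x R; the sign is only prescribed on [0, T) x R. *)
Definition test_function (T : R) (phi : R * R -> R) : Prop :=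
  [/\ smooth phi, compactly_supported phi,
      fun_support phi `<=` [set p | p.1 < T] &
      forall t x, 0 <= t < T -> 0 <= phi (t, x)].

Definition entropy_ineq (f : 'I_N -> R -> R) (nu : 'I_N -> 'rV[R]_N -> R)
    (mu : 'I_N -> 'I_N -> R -> R) (sigma : 'I_N -> R -> R) (T : R)
    (u0 : 'I_N -> R -> R) U (k : 'I_N) (alpha : R) (phi : R * R -> R)
    : Prop :=
  let QT := `]0, T[ `*` [set: R] in
  let Ubar t x := sigma k x * U k t x in
  let nuU t x := nu k (conv_vec mu (U^~ t) k x) in
  0 <= \int[leb2]_(p in QT)
         (`|U k p.1 p.2 - alpha / sigma k p.2| * 'D_(1, 0) phi p)
     + \int[leb2]_(p in QT)
         (Num.sg (Ubar p.1 p.2 - alpha) * nuU p.1 p.2 *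
          (f k (Ubar p.1 p.2) - f k alpha) * 'D_(0, 1) phi p)
     - \int[leb2]_(p in QT)
         (f k alpha * Num.sg (Ubar p.1 p.2 - alpha) *
          derive1 (nuU p.1) p.2 * phi p)
     + \int[leb]_x (`|u0 k x - alpha / sigma k x| * phi (0, x)).

Definition entropy_solution (f : 'I_N -> R -> R)
    (nu : 'I_N -> 'rV[R]_N -> R) (mu : 'I_N -> 'I_N -> R -> R)
    (sigma : 'I_N -> R -> R) (T : R) (u0 : 'I_N -> R -> R) U : Prop :=
  [/\ forall k, in_C_L1 T (U k),
      forall k, in_Linfty_BV T (U k) &
      forall k alpha phi, test_function T phi ->
        entropy_ineq f nu mu sigma T u0 U k alpha phi].

End entropy_solutions.

(* Main.v *)
Require Import Defs.
From HB Require Import structures.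
From mathcomp Require Import all_boot all_order all_algebra.
From mathcomp Require Import all_classical all_reals all_analysis.
From mathcomp Require Import measurable_realfun ring lra.
Import Order.TTheory GRing.Theory Num.Theory.
Import numFieldNormedType.Exports.
Set Implicit Arguments.
Unset Strict Implicit.
Unset Printing Implicit Defensive.
Local Open Scope classical_set_scope.
Local Open Scope ring_scope.

(** The proof doubles the variables in the manner of Kruzkov. For one component k let
    w = sigma U and z = sigma V, so that |U - alpha / sigma| = |w - alpha| / sigma, and
    take in the entropy inequality of U at (t, x) the level z (s, y), in that of V at
    (s, y) the level w (t, x). Both are tested against a product of mollifiers, of
    width e around a time r in t and in s, and of width d in x - y. The sum of the two
    inequalities, integrated over the four variables, contains three kinds of terms:
    time derivatives, fluxes with the difference of the nonlocal velocities, and sources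
    with the difference of their slopes.

    At fixed times t and s, these terms are estimated as d tends to 0
    (doubling_in_space). Bounded variation in space makes the oscillation of w and z over
    the distance d of order d in L^1 (near_diag_osc), which absorbs the derivative of the
    kernel. The velocities being convolutions with smooth kernels, their differences and
    those of their slopes are bounded by |x - y| plus the L^1 distance of the states
    (velocity_estimates). So every flux and source term is at most a constant times the
    total L^1 distance of U at time t and V at time s, plus an error of order d, and the
    time terms tend to the L^1 distance of the component (doubling_in_time). Here t and s
    still differ; the widths d and e are sent to 0 one after the other, in this order.

    Summing over the components, let L (t, s) be the total distance of U at time t and V
    at time s. What is left is a differential inequality m' <= C m for the average m of L
    over a window of width e around (r, r) (averaged_gap_decay). Integrating it and
    sending e to 0, by the continuity of L, gives L (t, t) <= exp (C t) L (0, 0)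
    (gronwall, stability).

    It remains to identify L (0, 0). The data enter the entropy inequality through a test
    function that does not vanish at time 0. With a time kernel of width e centred at 0,
    the terms of order 1 / e say that, for each level alpha, the local averages of
    |U (0) - alpha / sigma| are at most those of |U_0 - alpha / sigma|
    (initial_trace_average). By Lebesgue differentiation, for almost every x this holds
    pointwise for all rational alpha, which forces U (0) = U_0
    (initial_data_recovered). For equal data the distance vanishes at all times, and
    Tonelli's theorem gives equality almost everywhere in time and space. *)

(** * Integration on products *)

(** The open sets of the plane are countable unions of rational boxes. *)
Lemma continuous_measurable_plane {R : realType} (f : R * R -> R) :
  continuous f -> measurable_fun setT f.
Proof.
move=> /continuousP cf.
apply: (measurability _ (RGenOpens.measurableE R)).
move=> _ [_ [a [b ->] <-]]; rewrite setTI.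
set O := _ @^-1` _.
have oO : open O by apply: cf; exact: interval_open.
pose box (q1 q2 : rat) (n : nat) : set (R * R) :=
  ball (ratr q1 : R) (n.+1%:R^-1 : R) `*` ball (ratr q2 : R) (n.+1%:R^-1 : R).
have -> : O = \bigcup_(q1 : rat) \bigcup_(q2 : rat) \bigcup_n
    (if `[< box q1 q2 n `<=` O >] then box q1 q2 n else set0).
  apply/seteqP; split=> p; last first.
    by move=> [q1 _ [q2 _ [n _]]]; case: ifPn => [/asboolP + pb|//]; exact.
  move=> Op; have /nbhs_ballP[e /= e0 eO] : nbhs p O by exact: open_nbhs_nbhs.
  have [n ne] : exists n : nat, n.+1%:R^-1 < e / 2.
    have [n _ /(_ n (leqnn _))] := near_infty_natSinv_lt (PosNum (divr_gt0 e0 (ltr0n _ 2))).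
    by exists n.
  have i0 : 0 < n.+1%:R^-1 :> R by rewrite invr_gt0.
  have dq (x : R) : exists q : rat, ball (ratr q : R) (n.+1%:R^-1 : R) x.
    set i := n.+1%:R^-1 in i0 *.
    have [|q] := @rat_in_itvoo R (x - i) (x + i); first by lra.
    rewrite in_itv/= => /andP[q1 q2]; exists q.
    by rewrite /ball/= ltr_distlC; apply/andP; split; lra.
  have [q1 h1] := dq p.1; have [q2 h2] := dq p.2.
  exists q1 => //; exists q2 => //; exists n => //.
  rewrite asboolT// => r [r1 r2]; apply: eO.
  have E (u v w : R) :
    ball u (n.+1%:R^-1 : R) v -> ball u (n.+1%:R^-1 : R) w -> ball v e w.
    move=> /ball_sym uv uw; have := ball_triangle uv uw.
    by apply: le_ball; move: ne; set i := n.+1%:R^-1 => ne; lra.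
  by split; [exact: (E (ratr q1))|exact: (E (ratr q2))].
do 2 (apply: bigcupT_measurable_rat => ?).
apply: bigcupT_measurable => n; case: ifPn => // _.
by apply: measurableX; exact: measurable_ball.
Qed.

Section tonelli.
Context d1 d2 (T1 : measurableType d1) (T2 : measurableType d2) (R : realType).
Variable m1 : {sigma_finite_measure set T1 -> \bar R}.
Variable m2 : {sigma_finite_measure set T2 -> \bar R}.

(** Tonelli's theorem applies to the positive and negative parts; [fine] turns
    the sections that are not integrable into 0 without harming measurability. *)
Lemma measurable_Rintegral (f : T1 * T2 -> R) : measurable_fun setT f ->
  measurable_fun setT (fun x => \int[m2]_y f (x, y)).
Proof.
move=> mf; apply: (measurableT_comp (fine_measurable measurableT)) => //.
pose g : T1 * T2 -> \bar R := EFin \o f.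
have mg : measurable_fun setT g by exact/measurable_EFinP.
rewrite (_ : (fun _ => _) = (fun x => \int[m2]_y (g^\+ (x, y)))
   \- (fun x => \int[m2]_y (g^\- (x, y))))%E; last first.
  apply/funext => x; rewrite integralE; congr (_ - _)%E.
  - by apply: eq_integral => y _; rewrite !funeposE.
  - by apply: eq_integral => y _; rewrite !funenegE.
by apply: emeasurable_funB; apply: measurable_fun_fubini_tonelli_F => //;
  [exact: measurable_funepos|exact: measurable_funeneg].
Qed.

Lemma Rfubini_F_integrable (f : T1 * T2 -> R) :
  (m1 \x m2)%E.-integrable setT (EFin \o f) ->
  m1.-integrable setT (EFin \o (fun x => \int[m2]_y f (x, y))).
Proof.
move=> intf; have := integrable_fubini_F intf; rewrite /fubini_F => /= iF.
apply: (le_integrable measurableT _ _ iF).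
  apply/measurable_EFinP/measurable_Rintegral/measurable_EFinP.
  exact: measurable_int intf.
move=> x _ /=; rewrite /Rintegral /=.
by case: (\int[m2]_y (f (x, y))%:E)%E => [r| |] //=; rewrite ?normr0 ?leey.
Qed.

Lemma Rfubini (f : T1 * T2 -> R) :
  (m1 \x m2)%E.-integrable setT (EFin \o f) ->
  \int[(m1 \x m2)%E]_p f p = \int[m1]_x \int[m2]_y f (x, y).
Proof.
move=> intf; rewrite /Rintegral; congr fine.
rewrite -(integral12_prod_meas1 intf) /fubini_F.
apply: ae_eq_integral => //.
- exact/(measurable_fubini_F intf).
- have /measurable_int := Rfubini_F_integrable intf; exact.
have := ae_integrable1 intf; rewrite /ae_eq; apply: filterS => x ix _ /=.
by rewrite /Rintegral fineK//; apply: integrable_fin_num.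
Qed.

Lemma Rfubini2 (f : T1 * T2 -> R) :
  (m1 \x m2)%E.-integrable setT (EFin \o f) ->
  \int[(m1 \x m2)%E]_p f p = \int[m2]_y \int[m1]_x f (x, y).
Proof.
move=> intf; rewrite /Rintegral; congr fine.
rewrite -(integral21_prod_meas1 intf) /fubini_G.
apply: ae_eq_integral => //.
- exact/(measurable_fubini_G intf).
- apply/measurable_EFinP; apply: (measurableT_comp (fine_measurable measurableT)).
  exact/(measurable_fubini_G intf).
have := ae_integrable2 intf; rewrite /ae_eq; apply: filterS => x ix _ /=.
by rewrite /Rintegral fineK//; apply: integrable_fin_num.
Qed.
End tonelli.

(** Doubling the variables gives integrals over ((t, x), (s, y)), whereas the
    estimates are made for fixed times, that is over ((t, s), (x, y)). *)
Definition interchange {A B C D : Type} (p : (A * B) * (C * D)) :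
  (A * C) * (B * D) := ((p.1.1, p.2.1), (p.1.2, p.2.2)).

Lemma measurable_interchange d1 d2 d3 d4 (A : measurableType d1)
  (B : measurableType d2) (C : measurableType d3) (D : measurableType d4) :
  measurable_fun setT (@interchange A B C D).
Proof.
by apply: measurable_fun_pair; apply: measurable_fun_pair => //=;
 do 2 (apply: measurableT_comp => //).
Qed.

Section rearrangement.
Context d (T : measurableType d) (R : realType).
Variable m : {sigma_finite_measure set T -> \bar R}.
Variable P : {sigma_finite_measure set (T * T)%type -> \bar R}.
Hypothesis PE : forall f : T * T -> \bar R, measurable_fun setT f ->
  (forall p, 0 <= f p)%E ->
  (\int[P]_p f p = \int[m]_x \int[m]_y f (x, y))%E.
Variable Q : {measure set ((T * T) * (T * T))%type -> \bar R}.
Hypothesis QE : forall f : (T * T) * (T * T) -> \bar R, measurable_fun setT f ->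
  (forall p, 0 <= f p)%E ->
  (\int[Q]_p f p = \int[P]_p \int[P]_q f (p, q))%E.

Let m4 (h : (T * T) * (T * T) -> \bar R) := measurable_fun setT h.

Let mcomp (h : (T * T) * (T * T) -> \bar R) d' (S : measurableType d') (a b c e : S -> T) :
  m4 h -> measurable_fun setT a -> measurable_fun setT b ->
  measurable_fun setT c -> measurable_fun setT e ->
  measurable_fun setT (fun s => h ((a s, b s), (c s, e s))).
Proof.
move=> mh ma mb mc me; apply: measurableT_comp => //.
by apply: measurable_fun_pair; apply: measurable_fun_pair.
Qed.

Let QE4 (h : (T * T) * (T * T) -> \bar R) : m4 h -> (forall p, 0 <= h p)%E ->
  (\int[Q]_p h p = \int[m]_t \int[m]_x \int[m]_s \int[m]_y h ((t, x), (s, y)))%E.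
Proof.
move=> mh h0; rewrite QE// PE; last 2 first.
- exact: (measurable_fun_fubini_tonelli_F _ mh).
- by move=> p; apply: integral_ge0.
apply: eq_integral => t _; apply: eq_integral => x _.
rewrite PE//.
by apply: measurableT_comp => //; exact: pair1_measurable.
Qed.

(** Once written as iterated integrals in the four real variables, the two sides
    differ by the order of the two middle ones. *)
Lemma ge0_integral_interchange (h : (T * T) * (T * T) -> \bar R) :
  measurable_fun setT h -> (forall p, 0 <= h p)%E ->
  (\int[Q]_p h (interchange p) = \int[Q]_p h p)%E.
Proof.
move=> mh h0.
have mhi : m4 (fun p => h (interchange p)).
  by apply: measurableT_comp => //; exact: measurable_interchange.
rewrite (QE4 mhi (fun p => h0 _)) (QE4 mh h0).
apply: eq_integral => t _; rewrite /interchange/=.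
rewrite (fubini_tonelli (fun q => \int[m]_y h (t, q.2, (q.1, y)))%E)//=.
- apply: (measurable_fun_fubini_tonelli_F (fun q => h (t, q.1.2, (q.1.1, q.2)))) => //.
  by apply: mcomp => //; do ?apply: measurableT_comp => //.
- by move=> q; apply: integral_ge0.
Qed.

Lemma integral_interchange (h : (T * T) * (T * T) -> \bar R) :
  measurable_fun setT h ->
  (\int[Q]_p h (interchange p) = \int[Q]_p h p)%E.
Proof.
move=> mh; rewrite integralE [RHS]integralE.
congr (_ - _)%E.
  apply: etrans (ge0_integral_interchange (measurable_funepos mh) (funepos_ge0 h)).
  by apply: eq_integral => p _; rewrite !funeposE.
apply: etrans (ge0_integral_interchange (measurable_funeneg mh) (funeneg_ge0 h)).
by apply: eq_integral => p _; rewrite !funenegE.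
Qed.

End rearrangement.

(** Lebesgue measure is determined by its values on intervals, which translations
    preserve. *)
Lemma ge0_integral_translation {R : realType} (h : R) (f : R -> \bar R) (D : set R) :
  measurable D -> measurable_fun setT f -> (forall x, 0 <= f x)%E ->
  (\int[@lebesgue_measure R]_(x in [set x | D (x + h)%R]) f (x + h)%R =
   \int[@lebesgue_measure R]_(x in D) f x)%E.
Proof.
move=> mD mf f0.
pose phi (x : measurableTypeR R) : measurableTypeR R := x + h.
have mt : measurable_fun setT phi by exact: measurable_funD.
rewrite -[LHS]/(\int[@lebesgue_measure R]_(x in phi @^-1` D) (f \o phi) x)%E.
rewrite -ge0_integral_pushforward//; last exact: measurable_funS mf.
apply: eq_measure_integral => //= A mA _.
apply/esym/lebesgue_measure_unique => //= _ [[a b]] _ <-.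
rewrite /pushforward [X in _ = _ X](_ : _ = `]a - h, b - h]%classic); last first.
  by apply/seteqP; split=> x /=; rewrite !in_itv/= /phi ltrBlDr lerBrDr.
by rewrite !lebesgue_measure_itv/= !lte_fin ltrD2r -!EFinB opprB addrA addrNK.
Qed.

Section lebesgue_plane_sigma_finite.
Context {R : realType}.
Local Notation leb := (@lebesgue_measure R).
Let mR : measurableType _ := measurableTypeR R.

Definition lebesgue_plane : set (mR * mR)%type -> \bar R := (leb \x leb)%E.

HB.instance Definition _ := Measure.on lebesgue_plane.

Let lebesgue_plane_sigma_finite : sigma_finite setT lebesgue_plane.
Proof.
have /sigma_finiteP[F [TF ndF Foo]] := sigma_finiteT leb.
exists (fun n => F n `*` F n).
  rewrite -setXTT TF predeqE => -[x y]; split.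
    move=> [/= [n _ Fnx] [k _ Gky]]; exists (maxn n k) => //; split.
    - by move: x Fnx; exact/subsetPset/ndF/leq_maxl.
    - by move: y Gky; exact/subsetPset/ndF/leq_maxr.
  by move=> [n _ []/= ? ?]; split; exists n.
move=> k; have [? ?] := Foo k; split; first exact: measurableX.
rewrite /lebesgue_plane product_measure1E// lte_mul_pinfty//.
by rewrite ge0_fin_numE.
Qed.

HB.instance Definition _ := Measure_isSigmaFinite.Build _ _ _ lebesgue_plane
  lebesgue_plane_sigma_finite.
End lebesgue_plane_sigma_finite.

Section sealed_products.
Context {R : realType}.
Local Notation leb := (@lebesgue_measure R).
Let mR : measurableType _ := measurableTypeR R.

(** The Lebesgue measures of dimension 2 and 4 are given by an opaque
    specification, so that unification sees atoms and never unfolds a tower of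
    product measures. *)
Lemma plane_spec : {P : {sigma_finite_measure set (mR * mR)%type -> \bar R} |
  forall D (f : R * R -> \bar R),
    (\int[P]_(p in D) f p = \int[(leb \x leb)%E]_(p in D) f p)%E /\
    P.-integrable D f = (leb \x leb)%E.-integrable D f}.
Proof. by exists (@lebesgue_plane R). Qed.

Definition plane := sval plane_spec.

Lemma plane_integral D (f : R * R -> \bar R) :
  (\int[plane]_(p in D) f p = \int[(leb \x leb)%E]_(p in D) f p)%E.
Proof. by have [] := svalP plane_spec D f. Qed.

Lemma plane_Rintegral D (f : R * R -> R) :
  \int[plane]_(p in D) f p = \int[(leb \x leb)%E]_(p in D) f p.
Proof. by rewrite /Rintegral plane_integral. Qed.

Lemma plane_integrable D (f : R * R -> \bar R) :
  plane.-integrable D f = (leb \x leb)%E.-integrable D f.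
Proof. by have [] := svalP plane_spec D f. Qed.

Lemma plane_tonelli (f : R * R -> \bar R) : measurable_fun setT f ->
  (forall p, 0 <= f p)%E ->
  (\int[plane]_p f p = \int[leb]_x \int[leb]_y f (x, y))%E.
Proof. by move=> mf f0; rewrite plane_integral fubini_tonelli1. Qed.

Lemma plane_fubini (f : R * R -> R) : plane.-integrable setT (EFin \o f) ->
  \int[plane]_p f p = \int[leb]_x \int[leb]_y f (x, y).
Proof. by rewrite plane_integrable plane_Rintegral; exact: Rfubini. Qed.

Lemma plane_fubini2 (f : R * R -> R) : plane.-integrable setT (EFin \o f) ->
  \int[plane]_p f p = \int[leb]_y \int[leb]_x f (x, y).
Proof. by rewrite plane_integrable plane_Rintegral; exact: Rfubini2. Qed.

Lemma quad_spec : {Q : {measure set ((mR * mR) * (mR * mR))%type -> \bar R} |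
  forall D (f : (R * R) * (R * R) -> \bar R),
    (\int[Q]_(p in D) f p = \int[(plane \x plane)%E]_(p in D) f p)%E /\
    Q.-integrable D f = (plane \x plane)%E.-integrable D f}.
Proof. by exists (plane \x plane)%E. Qed.

Definition quad := sval quad_spec.

Lemma quad_integral D (f : (R * R) * (R * R) -> \bar R) :
  (\int[quad]_(p in D) f p = \int[(plane \x plane)%E]_(p in D) f p)%E.
Proof. by have [] := svalP quad_spec D f. Qed.

Lemma quad_Rintegral D (f : (R * R) * (R * R) -> R) :
  \int[quad]_(p in D) f p = \int[(plane \x plane)%E]_(p in D) f p.
Proof. by rewrite /Rintegral quad_integral. Qed.

Lemma quad_integrable D (f : (R * R) * (R * R) -> \bar R) :
  quad.-integrable D f = (plane \x plane)%E.-integrable D f.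
Proof. by have [] := svalP quad_spec D f. Qed.

Lemma quad_tonelli (f : (R * R) * (R * R) -> \bar R) : measurable_fun setT f ->
  (forall p, 0 <= f p)%E ->
  (\int[quad]_p f p = \int[plane]_p \int[plane]_q f (p, q))%E.
Proof. by move=> mf f0; rewrite quad_integral fubini_tonelli1. Qed.

Lemma quad_tonelli2 (f : (R * R) * (R * R) -> \bar R) : measurable_fun setT f ->
  (forall p, 0 <= f p)%E ->
  (\int[quad]_p f p = \int[plane]_q \int[plane]_p f (p, q))%E.
Proof. by move=> mf f0; rewrite quad_integral fubini_tonelli2. Qed.

Lemma quad_fubini (f : (R * R) * (R * R) -> R) :
  quad.-integrable setT (EFin \o f) ->
  \int[quad]_p f p = \int[plane]_p \int[plane]_q f (p, q).
Proof. by rewrite quad_integrable quad_Rintegral; exact: Rfubini. Qed.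

Lemma quad_fubini_integrable (f : (R * R) * (R * R) -> R) :
  quad.-integrable setT (EFin \o f) ->
  plane.-integrable setT (EFin \o (fun p => \int[plane]_q f (p, q))).
Proof. by rewrite quad_integrable; exact: Rfubini_F_integrable. Qed.

Lemma quad_fubini2 (f : (R * R) * (R * R) -> R) :
  quad.-integrable setT (EFin \o f) ->
  \int[quad]_p f p = \int[plane]_q \int[plane]_p f (p, q).
Proof. by rewrite quad_integrable quad_Rintegral; exact: Rfubini2. Qed.

Lemma quad_interchange (h : (R * R) * (R * R) -> R) : measurable_fun setT h ->
  \int[quad]_p h (interchange p) = \int[quad]_p h p.
Proof.
move=> mh; rewrite /Rintegral; congr fine.
apply: (@integral_interchange _ _ R leb plane _ quad _ (fun p => (h p)%:E)).
- by move=> f mf f0; exact: plane_tonelli.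
- by move=> f mf f0; exact: quad_tonelli.
- exact/measurable_EFinP.
Qed.

Lemma quad_integrable_interchange (h : (R * R) * (R * R) -> R) :
  quad.-integrable setT (EFin \o h) ->
  quad.-integrable setT (EFin \o (fun p => h (interchange p))).
Proof.
move=> /integrableP[mh fh]; have mh' : measurable_fun setT h by exact/measurable_EFinP.
apply/integrableP; split.
  apply/measurable_EFinP; apply: measurableT_comp => //; exact: measurable_interchange.
apply: le_lt_trans fh => /=.
rewrite (@ge0_integral_interchange _ _ R leb plane _ quad _ (fun p => (`|h p|)%:E))//.
- by move=> f mf f0; exact: plane_tonelli.
- by move=> f mf f0; exact: quad_tonelli.
- by apply/measurable_EFinP; apply: measurableT_comp.
Qed.

End sealed_products.

(** * A smooth bump *)

Lemma is_derive_line {R : numFieldType} {V W : normedModType R} (f : V -> W)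
    (x v : V) (df : W) :
  is_derive (0 : R) 1 (fun h : R => f (h *: v + x)) df <-> is_derive x v f df.
Proof.
have E : 'D_v f x = 'D_1 (fun h : R => f (h *: v + x)) 0.
  rewrite /derive; set g1 := fun h => h^-1 *: _; set g2 := fun h => h^-1 *: _.
  suff -> : g1 = g2 by [].
  by rewrite funeqE /g1 /g2 => h /=; rewrite addr0 scale0r add0r [_%:A]mulr1.
split=> -[d1 d2].
  by split; [exact/derivable1P|rewrite E].
by split; [move/derivable1P: d1|rewrite -E].
Qed.

Lemma is_derive1_continuous {R : realType} (f : R -> R) (x d : R) :
  is_derive x 1 f d -> {for x, continuous f}.
Proof.
by move=> [df _]; apply: differentiable_continuous; exact/derivable1_diffP.
Qed.

Lemma continuous_affine_comp {R : realType} (f : R -> R) (s c : R) :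
  continuous f -> continuous (fun x : R => f (s * x + c)).
Proof.
move=> cf x; apply: (@cvg_comp _ _ _ (fun y : R => s * y + c) f _ (nbhs (s * x + c))).
  by apply: cvgD; [apply: cvgM; [exact: cvg_cst|exact: cvg_id]|exact: cvg_cst].
exact: cf.
Qed.

Section flat_functions.
Context {R : realType}.
Implicit Types (P : {poly R}) (x : R).

(** The factor P (1 / x) makes the family generated by exp (- 1 / x) stable under
    differentiation. *)
Definition flat P x : R := if 0 < x then P.[x^-1] * expR (- x^-1) else 0.

Lemma flat_le0 P x : x <= 0 -> flat P x = 0.
Proof. by move=> x0; rewrite /flat ltNge x0. Qed.

(** The exponential beats every monomial: exp y >= y^(n+1) / (n+1)!. *)
Lemma flat_linear_bound P : exists C, forall x, `|flat P x| <= C * `|x|.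
Proof.
exists (\sum_(i < size P) `|P`_i| * i.+1`!%:R) => x.
have C0 : 0 <= \sum_(i < size P) `|P`_i| * i.+1`!%:R.
  by apply: sumr_ge0 => i _; rewrite mulr_ge0.
rewrite /flat; case: ifPn => [x0|_]; last by rewrite normr0 mulr_ge0.
rewrite normrM (gtr0_norm (expR_gt0 _)) (gtr0_norm x0) horner_coef.
rewrite mulr_suml; apply: (@le_trans _ _
    (\sum_(i < size P) `|P`_i * x^-1 ^+ i| * expR (- x^-1))).
  rewrite -mulr_suml; apply: ler_wpM2r; first exact: expR_ge0.
  exact: ler_norm_sum.
apply: ler_sum => i _; rewrite normrM -!mulrA ler_wpM2l//.
have y0 : 0 < x^-1 by rewrite invr_gt0.
rewrite (ger0_norm (exprn_ge0 _ (ltW y0))) expRN.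
rewrite ler_pdivrMr ?expR_gt0//.
have F0 : 0 < i.+1`!%:R :> R by rewrite ltr0n fact_gt0.
apply: (@le_trans _ _ (i.+1`!%:R * x * (x^-1 ^+ i.+1 / i.+1`!%:R))).
  rewrite exprS -[leLHS]mul1r !mulrA.
  by rewrite -[_ * x * _]mulrA divff ?gt_eqF// mulr1 mulrAC divff ?gt_eqF.
rewrite -!mulrA !ler_pM2l//; apply: (le_trans _ (expR_ge1Dxn i (ltW y0))).
by rewrite lerDr.
Qed.

(** Away from the origin this is the chain rule. At the origin the difference
    quotient of flat P is flat (P * 'X), which is at most linear in size. *)
Lemma is_derive_flat P x : is_derive x 1 (flat P) (flat ('X ^+ 2 * (P - P^`())) x).
Proof.
have [x0|x0|->] := ltgtP x 0.
- rewrite flat_le0 ?ltW//.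
  apply: (@near_eq_is_derive _ _ _ (cst 0)).
  by near=> y; rewrite flat_le0// ltW//; near: y; exact: lt_nbhsl.
- rewrite {2}/flat x0.
  have D : is_derive x 1 (fun y => P.[y^-1] * expR (- y^-1))
      (('X ^+ 2 * (P - P^`())).[x^-1] * expR (- x^-1)).
    have dV : is_derive x 1 (fun y : R => y^-1) (- x ^- 2).
      have := @is_deriveV _ id x 1 1 (lt0r_neq0 x0) (is_derive_id _ _).
      by rewrite [_%:A]mulr1.
    have dP := is_derive1_comp (is_derive_poly P x^-1) dV.
    have dE := @is_derive1_comp _ expR (fun y => - y^-1) x _ _ (is_derive_expR (- x^-1)) (is_deriveN dV).
    apply: is_derive_eq (is_deriveM dP dE) _.
    rewrite /= !hornerE /GRing.scale/= exprVn; ring.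
  apply: near_eq_is_derive D.
  near=> y; rewrite /flat; suff -> : 0 < y by [].
  by near: y; exact: lt_nbhsr.
- rewrite flat_le0//.
  have [C HC] := flat_linear_bound (P * 'X).
  suff cv : h^-1 *: ((flat P \o shift 0) (h *: 1) - flat P 0) @[h --> 0^'] --> (0:R).
    by split; [apply/cvg_ex; exists 0|apply/cvg_lim].
  apply/cvgr0Pnorm_le => e e0; near=> h.
  rewrite /= addr0 [_%:A]mulr1 (flat_le0 P (lexx 0)) subr0.
  have -> : h^-1 *: flat P h = flat (P * 'X) h.
    rewrite /flat; case: ifPn => [h0|_]; last by rewrite scaler0.
    by rewrite /GRing.scale/= hornerM hornerX; ring.
  apply: (le_trans (HC h)).
  apply: (@le_trans _ _ ((`|C| + 1) * `|h|)).
    by apply: ler_wpM2r => //; have := ler_norm C; lra.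
  rewrite mulrC -ler_pdivlMr; last by have := normr_ge0 C; lra.
  near: h; apply: dnbhs0_le; rewrite divr_gt0//; have := normr_ge0 C; lra.
Unshelve. all: by end_near. Qed.

Lemma continuous_flat P : continuous (flat P).
Proof. move=> x; exact: is_derive1_continuous (is_derive_flat P x). Qed.

Lemma flat1_gt0 x : 0 < x -> 0 < flat 1 x.
Proof. by move=> x0; rewrite /flat x0 hornerC mul1r expR_gt0. Qed.

Lemma flat1_ge0 x : 0 <= flat 1 x.
Proof. by case: (ltP 0 x) => [/flat1_gt0/ltW//|/flat_le0->]. Qed.

End flat_functions.

Section smooth_expressions.
Context {R : realType} {V : normedModType R}.

(** Expressions built from flat functions of affine forms; the class is closed
    under differentiation, hence made of smooth functions. *)
Inductive smooth_expr : (V -> R) -> Prop :=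
| smooth_cst c : smooth_expr (fun=> c)
| smooth_add f g : smooth_expr f -> smooth_expr g ->
    smooth_expr (fun x => f x + g x)
| smooth_mul f g : smooth_expr f -> smooth_expr g ->
    smooth_expr (fun x => f x * g x)
| smooth_flat P (l : V -> R) c :
    (forall (h : R) v x, l (h *: v + x) = h * l v + l x) -> continuous l ->
    smooth_expr (fun x => flat P (l x + c)).

Lemma smooth_expr_continuous f : smooth_expr f -> continuous f.
Proof.
elim=> [c|{}f g _ cf _ cg|{}f g _ cf _ cg|P l c ll cl] x.
- exact: cst_continuous.
- by apply: continuousD; [exact: cf|exact: cg].
- by apply: continuousM; [exact: cf|exact: cg].
- apply: (@continuous_comp _ _ _ (fun y => l y + c) (flat P)).
    by apply: continuousD; [exact: cl|exact: cst_continuous].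
  exact: continuous_flat.
Qed.

Lemma smooth_expr_derive f : smooth_expr f -> forall v,
  exists2 g, smooth_expr g & forall x, is_derive x v f (g x).
Proof.
elim=> [c|{}f g _ IHf _ IHg|{}f g sf IHf sg IHg|P l c ll cl] v.
- by exists (fun=> 0); [exact: smooth_cst|move=> x; exact: is_derive_cst].
- have [f' sf' df] := IHf v; have [g' sg' dg] := IHg v.
  exists (fun x => f' x + g' x); first exact: smooth_add.
  by move=> x; apply: is_deriveD.
- have [f' sf' df] := IHf v; have [g' sg' dg] := IHg v.
  exists (fun x => f x * g' x + g x * f' x).
    by apply: smooth_add; exact: smooth_mul.
  by move=> x; apply: is_deriveM.
- exists (fun x => l v * flat ('X ^+ 2 * (P - P^`())) (l x + c)).
    by apply: smooth_mul; [exact: smooth_cst|exact: smooth_flat].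
  move=> x; apply/is_derive_line.
  have -> : (fun h => flat P (l (h *: v + x) + c)) =
            flat P \o (fun h : R => h * l v + (l x + c)).
    by apply/funext => h /=; rewrite ll addrA.
  have dl : is_derive (0 : R) 1 (fun h : R => h * l v + (l x + c)) (l v).
    apply: is_derive_eq (is_deriveD (is_deriveM (is_derive_id _ _) (is_derive_cst _ _ _)) (is_derive_cst _ _ _)) _.
    by rewrite scaler0 add0r addr0 [_%:A]mulr1.
  apply: is_derive_eq (is_derive1_comp (is_derive_flat P _) dl) _.
  by rewrite mul0r add0r mulrC.
Qed.

Lemma smooth_expr_smooth f : smooth_expr f -> smooth f.
Proof.
move=> sf; rewrite /smooth /class_C => m vs; suff : smooth_expr (Defs.iterD vs f).
  move=> si; split=> _; first exact: smooth_expr_continuous.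
  by move=> x v; have [g _ /(_ x)[]] := smooth_expr_derive si v.
elim: vs => [//|v vs IH] /=.
have [g sg dg] := smooth_expr_derive IH v.
suff -> : 'D_v (Defs.iterD vs f) = g by [].
by apply/funext => x; have [] := dg x.
Qed.

End smooth_expressions.

(** The integral over the line reduces to [a, b], where the fundamental theorem of
    calculus applies. *)
Lemma integral_derivative_compact {R : realType} (F f : R -> R) (a b : R) : a < b ->
  (forall x : R, a <= x <= b -> is_derive x 1 F (f x)) -> continuous f ->
  (forall x, ~~ (a <= x <= b) -> f x = 0) ->
  lebesgue_measure.-integrable setT (EFin \o f) /\
  \int[lebesgue_measure]_x f x = F b - F a.
Proof.
move=> ab dF cf f0.
have cfab : {within `[a, b], continuous f} by exact: continuous_subspaceT.
have fE : EFin \o f = (EFin \o f) \_ `[a, b].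
  apply/funext => x; rewrite patchE; case: ifPn => // /negP xab.
  by rewrite /= f0//; apply/negP => h; apply: xab; rewrite inE/= in_itv.
have iab : lebesgue_measure.-integrable `[a, b] (EFin \o f).
  by apply: continuous_compact_integrable => //; exact: segment_compact.
split; first by rewrite fE; apply/(integrable_mkcond _ _).1.
have -> : \int[lebesgue_measure]_x f x = fine (\int[lebesgue_measure]_(x in `[a, b]) (f x)%:E).
  by rewrite [in RHS]integral_mkcond /Rintegral; congr fine; apply: eq_integral => x _;
    rewrite -fE.
rewrite (continuous_FTC2 ab cfab (F := F))//; last first.
  move=> x /[!in_itv]/= /andP[ax xb].
  by rewrite derive1E; have [] := dF x; rewrite // !ltW.
split=> [x /[!in_itv]/= /andP[ax xb]||].
- by have [] := dF x; rewrite // !ltW.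
- apply/cvg_at_right_filter/(is_derive1_continuous (dF a _)).
  by rewrite lexx ltW.
- apply/cvg_at_left_filter/(is_derive1_continuous (dF b _)).
  by rewrite lexx ltW.
Qed.

Section bump.
Context {R : realType}.
Local Notation leb := (@lebesgue_measure R).

Let Q : {poly R} := 'X ^+ 2 * (1 - 1^`()).
Let b0 (x : R) := flat 1 (1 + x) * flat 1 (1 - x).
Let b0' (x : R) := flat Q (1 + x) * flat 1 (1 - x) - flat 1 (1 + x) * flat Q (1 - x).

Let is_derive_b0 (x : R) : is_derive x 1 b0 (b0' x).
Proof.
have d1 : is_derive x 1 (fun y : R => 1 + y) 1.
  by apply: is_derive_eq (is_deriveD (is_derive_cst _ _ _) (is_derive_id _ _)) _; rewrite add0r.
have d2 : is_derive x 1 (fun y : R => 1 - y) (-1).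
  by apply: is_derive_eq (is_deriveB (is_derive_cst _ _ _) (is_derive_id _ _)) _; rewrite sub0r.
have D1 := is_derive1_comp (is_derive_flat 1 (1 + x)) d1.
have D2 := @is_derive1_comp _ (flat 1) (fun y => 1 - y) x _ _ (is_derive_flat 1 (1 - x)) d2.
apply: is_derive_eq (is_deriveM D1 D2) _.
by rewrite /b0' /GRing.scale/= -/Q; ring.
Qed.

Let continuous_b0 : continuous b0.
Proof. move=> x; exact: is_derive1_continuous (is_derive_b0 x). Qed.

Let b0_ge0 x : 0 <= b0 x.
Proof. by rewrite mulr_ge0// flat1_ge0. Qed.

Let flat_out P (x : R) : 1 <= `|x| -> flat P (1 + x) * flat 1 (1 - x) = 0.
Proof.
have [x0|x0] := ler0P x => x1.
  by rewrite (@flat_le0 _ P) ?mul0r//; lra.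
by rewrite (@flat_le0 _ 1 (1 - x)) ?mulr0//; lra.
Qed.

Let b0_out x : 1 <= `|x| -> b0 x = 0.
Proof. exact: flat_out. Qed.

Let b0'_out x : 1 <= `|x| -> b0' x = 0.
Proof.
move=> x1; rewrite /b0' flat_out// sub0r.
have := @flat_out Q (- x); rewrite normrN opprK => /(_ x1).
by rewrite mulrC => ->; rewrite oppr0.
Qed.

Let continuous_b0' : continuous b0'.
Proof.
have c1 P : continuous (fun x : R => flat P (1 + x)).
  have := @continuous_affine_comp R (flat P) 1 1 (@continuous_flat R P).
  by under eq_fun do rewrite mul1r addrC.
have c2 P : continuous (fun x : R => flat P (1 - x)).
  have := @continuous_affine_comp R (flat P) (-1) 1 (@continuous_flat R P).
  by under eq_fun do rewrite mulN1r addrC.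
by move=> x; apply: cvgB; apply: cvgM; (exact: c1 || exact: c2).
Qed.

(* A primitive of b0: any base point on the left of the support would do. *)
Let S0 (x : R) := \int[leb]_(t in `[(-2 : R), x]) b0 t.

Let is_derive_S0 (x : R) : -1 <= x <= 1 -> is_derive x 1 S0 (b0 x).
Proof.
move=> /andP[x1 x2].
have iab : leb.-integrable `[(-2 : R), 2] (EFin \o b0).
  apply: continuous_compact_integrable; first exact: segment_compact.
  exact: continuous_subspaceT.
have [||d1 d2] := @continuous_FTC1_closed _ b0 (-2) x 2 _ iab _ (@continuous_b0 x).
- lra.
- lra.
- by split; [exact: d1|rewrite -d2 derive1E].
Qed.

Let c0 := S0 1 - S0 (-1).

Let S0_mvt (u v : R) : -1 <= u -> u < v -> v <= 1 -> exists2 w, u < w < v & S0 v - S0 u = b0 w * (v - u).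
Proof.
move=> u1 uv v1.
have [||w] := @MVT _ S0 b0 u v uv.
- move=> x; rewrite in_itv/= => /andP[ux xv]; apply: is_derive_S0; lra.
- apply: derivable_within_continuous => x; rewrite in_itv/= => /andP[ux xv].
  by have [] := @is_derive_S0 x; first lra.
by rewrite in_itv/= => wuv ->; exists w.
Qed.

Let c0_gt0 : 0 < c0.
Proof.
have [w1 _ E1] := @S0_mvt (-1) (-(2^-1)) ltac:(lra) ltac:(lra) ltac:(lra).
have [w2 wb E2] := @S0_mvt (-(2^-1)) (2^-1) ltac:(lra) ltac:(lra) ltac:(lra).
have [w3 _ E3] := @S0_mvt (2^-1) 1 ltac:(lra) ltac:(lra) ltac:(lra).
have p1 := b0_ge0 w1; have p3 := b0_ge0 w3.
have p2 : 0 < b0 w2 by rewrite mulr_gt0// flat1_gt0//; lra.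
rewrite /c0; nra.
Qed.

Definition bump (x : R) := b0 x / c0.
Definition bump' (x : R) := b0' x / c0.
Let S (x : R) := S0 x / c0.

Lemma bump_ge0 x : 0 <= bump x.
Proof. by rewrite divr_ge0// ltW. Qed.

Lemma bump0_gt0 : 0 < bump 0.
Proof. by rewrite divr_gt0// mulr_gt0// flat1_gt0// ?subr0 ?addr0. Qed.

Lemma bump_out x : 1 <= `|x| -> bump x = 0.
Proof. by move=> x1; rewrite /bump b0_out// mul0r. Qed.

Lemma bump'_out x : 1 <= `|x| -> bump' x = 0.
Proof. by move=> x1; rewrite /bump' b0'_out// mul0r. Qed.

Lemma bumpN x : bump (- x) = bump x.
Proof. by rewrite /bump /b0 opprK mulrC [in RHS]mulrC; congr (_ * _); rewrite mulrC. Qed.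

Lemma bump'N x : bump' (- x) = - bump' x.
Proof. by rewrite /bump' /b0' opprK; ring. Qed.

Lemma is_derive_bump (x : R) : is_derive x 1 bump (bump' x).
Proof.
apply: is_derive_eq (is_deriveM (is_derive_b0 x) (is_derive_cst c0^-1 _ _)) _.
by rewrite scaler0 add0r /GRing.scale/= mulrC.
Qed.

Lemma continuous_bump' : continuous bump'.
Proof. by move=> x; apply: continuousM; [exact: continuous_b0'|exact: cst_continuous]. Qed.

Lemma bump_bounded : exists2 B, 0 < B & forall x, `|bump x| <= B /\ `|bump' x| <= B.
Proof.
have bnd (g : R -> R) : continuous g -> (forall x, 1 <= `|x| -> g x = 0) ->
    exists B, forall x, `|g x| <= B.
  move=> cg g0.
  have [|M [_ HM]] := @compact_bounded _ _ (g @` `[(-1 : R), 1]).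
    apply: continuous_compact; last exact: segment_compact.
    exact: continuous_subspaceT.
  exists (`|M| + 1) => x; have [x1|x1] := leP 1 `|x|.
    by rewrite g0// normr0 addr_ge0.
  apply: (HM (`|M| + 1)); first by have := ler_norm M; lra.
  by exists x => //=; rewrite in_itv/= -ler_norml ltW.
have [|B1 H1] := bnd bump _ bump_out.
  by move=> x; exact: is_derive1_continuous (is_derive_bump x).
have [B2 H2] := bnd bump' continuous_bump' bump'_out.
exists (`|B1| + `|B2| + 1) => [|x]; first by rewrite ltr_pwDr// addr_ge0.
have := ler_norm B1; have := ler_norm B2.
have := normr_ge0 B1; have := normr_ge0 B2.
by split; [apply: le_trans (H1 x) _|apply: le_trans (H2 x) _]; lra.
Qed.

Definition bump_bound := sval (cid2 bump_bounded).

Lemma bump_bound_gt0 : 0 < bump_bound.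
Proof. by rewrite /bump_bound; case: cid2. Qed.

Lemma le_bump_bound x : `|bump x| <= bump_bound.
Proof. by rewrite /bump_bound; case: cid2 => B ? /= /(_ x)[]. Qed.

Lemma le_bump'_bound x : `|bump' x| <= bump_bound.
Proof. by rewrite /bump_bound; case: cid2 => B ? /= /(_ x)[]. Qed.

(** Scaled so that moll d has integral 1 and moll' d is its derivative. *)
Definition moll (d x : R) := bump (x / d) / d.
Definition moll' (d x : R) := bump' (x / d) / d ^+ 2.

Section moll.
Variable d : R.
Hypothesis d0 : 0 < d.

Lemma moll_ge0 x : 0 <= moll d x.
Proof. by rewrite divr_ge0 ?bump_ge0// ltW. Qed.

Let far x : d <= `|x| -> 1 <= `|x / d|.
Proof. by move=> dx; rewrite normrM normfV (gtr0_norm d0) ler_pdivlMr// mul1r. Qed.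

Lemma moll_out x : d <= `|x| -> moll d x = 0.
Proof. by move=> /far dx; rewrite /moll bump_out// mul0r. Qed.

Lemma moll'_out x : d <= `|x| -> moll' d x = 0.
Proof. by move=> /far dx; rewrite /moll' bump'_out// mul0r. Qed.

Lemma mollN x : moll d (- x) = moll d x.
Proof. by rewrite /moll mulNr bumpN. Qed.

Lemma moll'N x : moll' d (- x) = - moll' d x.
Proof. by rewrite /moll' mulNr bump'N mulNr. Qed.

Lemma le_moll x : `|moll d x| <= bump_bound / d.
Proof.
by rewrite normrM normfV (gtr0_norm d0) ler_wpM2r ?le_bump_bound// invr_ge0 ltW.
Qed.

Lemma le_moll' x : `|moll' d x| <= bump_bound / d ^+ 2.
Proof.
rewrite normrM normfV (gtr0_norm (exprn_gt0 _ d0)).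
by rewrite ler_wpM2r ?le_bump'_bound// invr_ge0 ltW// exprn_gt0.
Qed.

Let is_derive_affine (s c x : R) : is_derive x 1 (fun y : R => (s * y + c) / d) (s / d).
Proof.
have D1 := is_deriveM (is_derive_cst s x 1) (is_derive_id x (1:R)).
have D2 := is_deriveD D1 (is_derive_cst c x 1).
apply: is_derive_eq (is_deriveM D2 (is_derive_cst d^-1 x 1)) _.
by rewrite !scaler0 add0r !addr0 /GRing.scale/= mulr1 mulrC.
Qed.

Lemma is_derive_moll_affine (s c x : R) :
  is_derive x 1 (fun y => moll d (s * y + c)) (s * moll' d (s * x + c)).
Proof.
have D := is_derive1_comp (is_derive_bump _) (is_derive_affine s c x).
apply: is_derive_eq (is_deriveM D (is_derive_cst d^-1 x 1)) _.
by rewrite scaler0 add0r /GRing.scale/= /moll' expr2 invfM; ring.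
Qed.

Lemma is_derive_moll (x : R) : is_derive x 1 (moll d) (moll' d x).
Proof.
have := is_derive_moll_affine 1 0 x; rewrite !mul1r addr0.
by under eq_fun do rewrite mul1r addr0.
Qed.

Lemma continuous_moll : continuous (moll d).
Proof. by move=> x; exact: is_derive1_continuous (is_derive_moll x). Qed.

Lemma continuous_moll' : continuous (moll' d).
Proof.
move=> x; apply: cvgM; last exact: cvg_cst.
have := @continuous_affine_comp R bump' d^-1 0 continuous_bump'.
by under eq_fun do rewrite mulrC addr0; exact.
Qed.

Lemma integral_moll x : \int[leb]_y moll d (x - y) = 1.
Proof.
pose F y := - S ((-1 * y + x) / d).
have [||||_ ->] := @integral_derivative_compact _ F (fun y => moll d (x - y)) (x - d) (x + d).
- by have := d0; lra.
- move=> y /andP[y1 y2].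
  have Sy : is_derive ((-1 * y + x) / d) 1 S0 (b0 ((-1 * y + x) / d)).
    apply: is_derive_S0; rewrite ler_pdivlMr// ler_pdivrMr//; lra.
  have D := @is_derive1_comp _ S0 (fun y => (-1 * y + x) / d) y _ _ Sy (is_derive_affine (-1) x y).
  apply: is_derive_eq (is_deriveN (is_deriveM D (is_derive_cst c0^-1 y 1))) _.
  rewrite scaler0 add0r /GRing.scale/= /moll /bump.
  by rewrite (_ : x - y = -1 * y + x); ring.
- have := @continuous_affine_comp R (moll d) (-1) x continuous_moll.
  by under eq_fun do rewrite mulN1r addrC.
- move=> y yo; apply: moll_out; rewrite leNgt; apply: contra yo.
  by rewrite ltr_norml; lra.
rewrite /F /S opprK addrC -mulrBl.
rewrite (_ : (-1 * (x - d) + x) / d = 1); last by field; rewrite gt_eqF.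
rewrite (_ : (-1 * (x + d) + x) / d = -1); last by field; rewrite gt_eqF.
by rewrite -/c0 divff// gt_eqF.
Qed.

Lemma integral_moll' x : \int[leb]_y moll' d (x - y) = 0.
Proof.
pose F y := - moll d (-1 * y + x).
have [||||_ ->] := @integral_derivative_compact _ F (fun y => moll' d (x - y)) (x - d) (x + d).
- by have := d0; lra.
- move=> y _; apply: is_derive_eq (is_deriveN (is_derive_moll_affine (-1) x y)) _.
  by rewrite (_ : x - y = -1 * y + x); ring.
- have := @continuous_affine_comp R (moll' d) (-1) x continuous_moll'.
  by under eq_fun do rewrite mulN1r addrC.
- move=> y yo; apply: moll'_out; rewrite leNgt; apply: contra yo.
  by rewrite ltr_norml; lra.
rewrite /F !moll_out ?subrr//.
  by rewrite (_ : _ + x = d) ?gtr0_norm//; ring.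
by rewrite (_ : _ + x = - d) ?normrN ?gtr0_norm//; ring.
Qed.

(** The mollifier is a product of two flat functions of affine forms. *)
Lemma smooth_expr_moll (V : normedModType R) (l : V -> R) (c : R) :
  (forall (h : R) v x, l (h *: v + x) = h * l v + l x) -> continuous l ->
  smooth_expr (fun p => moll d (l p - c)).
Proof.
move=> ll cl.
have -> : (fun p => moll d (l p - c)) = (fun p =>
    flat 1 (d^-1 * l p + (1 - c / d)) * flat 1 (- d^-1 * l p + (1 + c / d)) *
    (c0^-1 * d^-1)).
  apply/funext => p; rewrite /moll /bump /b0 -!mulrA; congr (flat 1 _ * (flat 1 _ * _)); ring.
have lin s : smooth_expr (fun p => flat 1 (s * l p + (1 - s * c))).
  apply: (@smooth_flat _ _ _ (fun p => s * l p)).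
    by move=> h v x; rewrite ll; ring.
  by move=> x; apply: cvgM; [exact: cvg_cst|exact: cl].
apply: smooth_mul; last exact: smooth_cst.
have h1 := lin d^-1; have h2 := lin (- d^-1).
apply: smooth_mul; [move: h1|move: h2]; congr smooth_expr; apply/funext => p; congr flat; ring.
Qed.

End moll.
End bump.

(** * Test functions *)

Section test_functions.
Context {R : realType}.
Implicit Types (k g : R -> R) (p : R * R).

Lemma derive_tensor1 k g (k' : R) p : is_derive p.1 1 k k' ->
  'D_((1, 0) : R * R) (fun p => k p.1 * g p.2) p = k' * g p.2.
Proof.
move=> dk; suff : is_derive p ((1, 0) : R * R) (fun p => k p.1 * g p.2) (k' * g p.2).
  by case.
apply/is_derive_line => /=.
have -> : (fun h : R => k (h * 1 + p.1) * g (h * 0 + p.2)) =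
          (fun h : R => k (h *: 1 + p.1)) * cst (g p.2).
  by apply/funext => h /=; rewrite mulr0 add0r.
apply: is_derive_eq (is_deriveM ((is_derive_line _ _ _ _).2 dk) (is_derive_cst _ _ _)) _.
by rewrite scaler0 add0r mulrC.
Qed.

Lemma derive_tensor2 k g (g' : R) p : is_derive p.2 1 g g' ->
  'D_((0, 1) : R * R) (fun p => k p.1 * g p.2) p = k p.1 * g'.
Proof.
move=> dg; suff : is_derive p ((0, 1) : R * R) (fun p => k p.1 * g p.2) (k p.1 * g').
  by case.
apply/is_derive_line => /=.
have -> : (fun h : R => k (h * 0 + p.1) * g (h * 1 + p.2)) =
          cst (k p.1) * (fun h : R => g (h *: 1 + p.2)).
  by apply/funext => h /=; rewrite mulr0 add0r.
apply: is_derive_eq (is_deriveM (is_derive_cst _ _ _) ((is_derive_line _ _ _ _).2 dg)) _.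
by rewrite scaler0 addr0.
Qed.

Definition moll2 (e r d y : R) p := moll e (p.1 - r) * moll d (p.2 - y).

Lemma is_derive_moll_shift (d y x : R) :
  is_derive x 1 (fun x => moll d (x - y)) (moll' d (x - y)).
Proof.
have := is_derive_moll_affine d 1 (- y) x; rewrite !mul1r.
by under eq_fun do rewrite mul1r.
Qed.

Lemma derive1_moll2 (e r d y : R) p :
  'D_((1, 0) : R * R) (moll2 e r d y) p = moll' e (p.1 - r) * moll d (p.2 - y).
Proof. exact: (@derive_tensor1 (fun t => moll e (t - r)) (fun x => moll d (x - y)) _ p (is_derive_moll_shift _ _ _)). Qed.

Lemma derive2_moll2 (e r d y : R) p :
  'D_((0, 1) : R * R) (moll2 e r d y) p = moll e (p.1 - r) * moll' d (p.2 - y).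
Proof. exact: (@derive_tensor2 (fun t => moll e (t - r)) (fun x => moll d (x - y)) _ p (is_derive_moll_shift _ _ _)). Qed.

Lemma test_function_moll2 (T e r d y : R) : 0 < e -> 0 < d -> r + e < T ->
  test_function T (moll2 e r d y).
Proof.
move=> e0 d0 reT.
pose box := `[r - e, r + e] `*` `[y - d, y + d] : set (R * R).
have cbox : compact box by apply: compact_setX; exact: segment_compact.
have sbox : fun_support (moll2 e r d y) `<=` box.
  have clbox : closed box.
    by apply: compact_closed => //; exact: norm_hausdorff.
  rewrite /fun_support [X in _ `<=` X](_ : _ = closure box); last exact/closure_id.
  apply: closure_subset => -[t x] /= n0.
  have far (a b c : R) : 0 < a -> moll a (b - c) != 0 -> c - a <= b <= c + a.
    move=> a0; apply: contra_neqT => abc; apply: moll_out => //.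
    rewrite leNgt; apply: contra abc; rewrite ltr_norml => /andP[? ?].
    by apply/andP; split; lra.
  move: n0; rewrite /moll2 mulf_eq0 negb_or => /andP[/= n1 n2].
  by split; rewrite /= in_itv/=; apply: far.
split.
- apply: smooth_expr_smooth; apply: smooth_mul.
    by apply: smooth_expr_moll => // x; exact: cvg_fst.
  by apply: smooth_expr_moll => // x; exact: cvg_snd.
- apply: subclosed_compact cbox sbox; exact: closed_closure.
- by move=> p /sbox[]; rewrite /= in_itv/= => /andP[_ h] _; exact: le_lt_trans reT.
- by move=> t x _; rewrite mulr_ge0// moll_ge0.
Qed.

End test_functions.

(** * The nonlocal velocity *)

Lemma integrable_dominated d (T : measurableType d) (R : realType)
    (mu : {measure set T -> \bar R}) (f g : T -> R) :
  measurable_fun setT f -> (forall x, `|f x| <= g x) ->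
  mu.-integrable setT (EFin \o g) -> mu.-integrable setT (EFin \o f).
Proof.
move=> mf fg; apply: le_integrable => //; first exact/measurable_EFinP.
move=> x _ /=; rewrite lee_fin; apply: le_trans (fg x) _; exact: ler_norm.
Qed.

Lemma integrable_real_measurable d (T : measurableType d) (R : realType)
    (mu : {measure set T -> \bar R}) (f : T -> R) :
  mu.-integrable setT (EFin \o f) -> measurable_fun setT f.
Proof. by move=> /measurable_int/measurable_EFinP. Qed.

Section real_integrability.
Context d (T : measurableType d) (R : realType) (mu : {measure set T -> \bar R}).
Implicit Types f g : T -> R.
Local Notation intg f := (mu.-integrable setT (EFin \o f)).

Lemma integrable_scale (c : R) f : intg f -> intg (fun x => c * f x).
Proof. by move=> /(integrableZl measurableT c). Qed.

Lemma integrable_add f g : intg f -> intg g -> intg (fun x => f x + g x).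
Proof. by move=> i1 i2; have := integrableD measurableT i1 i2. Qed.

Lemma integrable_sub f g : intg f -> intg g -> intg (fun x => f x - g x).
Proof. by move=> i1 i2; have := integrableB measurableT i1 i2. Qed.

Lemma integrable_abs f : intg f -> intg (fun x => `|f x|).
Proof. exact: integrable_norm. Qed.

Lemma integrable_bounded_mul (B : R) (m f : T -> R) : measurable_fun setT m ->
  (forall x, `|m x| <= B) -> intg f -> intg (fun x => m x * f x).
Proof.
move=> mm mB iu.
apply: (integrable_dominated (g := fun x => B * `|f x|)).
- by apply: measurable_funM => //; exact: integrable_real_measurable iu.
- by move=> x; rewrite normrM ler_wpM2r.
- by apply: integrable_scale; exact: integrable_abs.
Qed.

Lemma norm_Rintegral_le (B : R) (m u : T -> R) : measurable_fun setT m ->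
  (forall x, `|m x| <= B) -> intg u ->
  `|\int[mu]_x (m x * u x)| <= B * \int[mu]_x `|u x|.
Proof.
move=> mm mB iu; have i := integrable_bounded_mul mm mB iu.
apply: (le_trans (le_normr_Rintegral _ _)) => //.
rewrite -RintegralZl//; last exact: integrable_abs.
apply: le_Rintegral => //.
- exact: integrable_abs.
- by apply: integrable_scale; exact: integrable_abs.
- by move=> x _; rewrite normrM ler_wpM2r.
Qed.

End real_integrability.

Section L1.
Context {R : realType}.
Local Notation leb := (@lebesgue_measure R).
Implicit Types u v : R -> R.

Definition L1 u := leb.-integrable setT (EFin \o u).

Definition l1 u : R := \int[leb]_x `|u x|.

Lemma l1_ge0 u : 0 <= l1 u.
Proof. exact: Rintegral_ge0. Qed.

Lemma L1_abs u : L1 u -> L1 (fun x => `|u x|).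
Proof. exact: integrable_abs. Qed.

Lemma L1B u v : L1 u -> L1 v -> L1 (u \- v).
Proof. exact: integrable_sub. Qed.

Lemma l1B_sym u v : l1 (u \- v) = l1 (v \- u).
Proof. by apply: eq_Rintegral => x _ /=; rewrite distrC. Qed.

Lemma l1_triangle u v w : L1 u -> L1 v -> L1 w ->
  l1 (u \- w) <= l1 (u \- v) + l1 (v \- w).
Proof.
move=> iu iv iw; rewrite -RintegralD//; try exact/L1_abs/L1B.
apply: le_Rintegral => //; first exact/L1_abs/L1B.
  by apply: integrable_add; exact/L1_abs/L1B.
by move=> x _ /=; rewrite (le_trans _ (ler_normD _ _))// addrA subrK.
Qed.

End L1.

Section mean_value.
Context {R : realType}.

Lemma mean_value (f f' : R -> R) (a h : R) :
  (forall x : R, is_derive x 1 f (f' x)) ->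
  exists2 c, `|c| <= `|h| & f (a + h) - f a = f' (a + c) * h.
Proof.
move=> df.
have cf : continuous f by move=> x; exact: is_derive1_continuous (df x).
have [h0|h0] := leP 0 h.
  have [||c] := @MVT_segment _ f f' a (a + h).
  - by rewrite lerDl.
  - exact: continuous_subspaceT.
  rewrite in_itv/= => /andP[c1 c2] E; exists (c - a).
    by rewrite !ger0_norm//; lra.
  by rewrite E (_ : a + (c - a) = c); ring.
have [||c] := @MVT_segment _ f f' (a + h) a.
- by rewrite gerDl ltW.
- exact: continuous_subspaceT.
rewrite in_itv/= => /andP[c1 c2] E; exists (c - a).
  by rewrite ler0_norm ?ltr0_norm//; lra.
rewrite -[LHS]opprB E (_ : a + (c - a) = c); ring.
Qed.

Lemma lipschitz_of_derive (f f' : R -> R) (B : R) :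
  (forall x : R, is_derive x 1 f (f' x)) -> (forall x, `|f' x| <= B) ->
  forall x y, `|f x - f y| <= B * `|x - y|.
Proof.
move=> df f'B x y; have [c _] := @mean_value f f' y (x - y) df.
by rewrite (_ : y + (x - y) = x); [move=> ->; rewrite normrM ler_wpM2r|ring].
Qed.

End mean_value.

Section convolution.
Context {R : realType}.
Local Notation leb := (@lebesgue_measure R).
Variables (m m' : R -> R) (B : R).
Hypothesis dm : forall x : R, is_derive x 1 m (m' x).
Hypothesis mB : forall x, `|m x| <= B.
Hypothesis m'B : forall x, `|m' x| <= B.

Let cm : continuous m. Proof. by move=> x; exact: is_derive1_continuous (dm x). Qed.

Let mm (x : R) : measurable_fun setT (fun y : R => m (x - y)).
Proof.
apply: continuous_measurable_fun.
have := @continuous_affine_comp R m (-1) x cm.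
by under eq_fun do rewrite mulN1r addrC.
Qed.

Lemma space_conv_integrable u x : L1 u -> L1 (fun y => m (x - y) * u y).
Proof. by move=> iu; apply: (integrable_bounded_mul (mu := leb)) iu => [|y]; [exact: mm|exact: mB]. Qed.

Lemma space_conv_bound u x : L1 u -> `|space_conv m u x| <= B * l1 u.
Proof. by move=> iu; apply: (norm_Rintegral_le (mu := leb)) iu => [|y]; [exact: mm|exact: mB]. Qed.

(** Changing the density costs the supremum of the kernel times the L^1 distance;
    changing the point costs the Lipschitz constant of the kernel times the mass. *)
Lemma space_conv_dist u v x y : L1 u -> L1 v ->
  `|space_conv m u x - space_conv m v y| <= B * l1 (u \- v) + B * l1 v * `|x - y|.
Proof.
move=> iu iv.
have -> : space_conv m u x - space_conv m v y =
    \int[leb]_z (m (x - z) * (u \- v) z) + \int[leb]_z ((m (x - z) - m (y - z)) * v z).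
  have i1 := space_conv_integrable x iu.
  have i2 := space_conv_integrable x iv.
  have i3 := space_conv_integrable y iv.
  transitivity ((space_conv m u x - space_conv m v x) + (space_conv m v x - space_conv m v y)).
    by rewrite addrA subrK.
  rewrite /space_conv -!RintegralB//; congr (_ + _); apply: eq_Rintegral => z _.
    by rewrite /= mulrBr.
  by rewrite mulrBl.
apply: le_trans (ler_normD _ _) _; apply: lerD.
  by apply: (norm_Rintegral_le (mu := leb)) => [||]; [exact: mm| |exact: L1B].
rewrite -mulrA [l1 v * _]mulrC mulrA; apply: (norm_Rintegral_le (mu := leb)) iv.
  exact: (measurable_funB (mm x) (mm y)).
move=> z; have := lipschitz_of_derive dm m'B (x - z) (y - z).
by rewrite (_ : x - z - (y - z) = x - y); last ring.
Qed.

(** Differentiation under the integral, dominated by B |u|. *)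
Lemma is_derive_space_conv u (x : R) : L1 u ->
  is_derive x 1 (space_conv m u) (space_conv m' u x).
Proof.
move=> iu; pose f x y := m (x - y) * u y.
have mu : measurable_fun setT u := integrable_real_measurable iu.
have df (z y : R) : is_derive z 1 (f^~ y) (m' (z - y) * u y).
  have D1 : is_derive z 1 (fun z => m (z - y)) (m' (z - y)).
    have D := is_deriveB (is_derive_id z (1:R)) (is_derive_cst y z 1).
    apply: is_derive_eq (@is_derive1_comp _ m (fun z => z - y) _ _ _ (dm (z - y)) D) _.
    by rewrite subr0 mulr1.
  apply: is_derive_eq (is_deriveM D1 (is_derive_cst (u y) z 1)) _.
  by rewrite scaler0 add0r /GRing.scale/= mulrC.
have xI : `]x - 1, x + 1[%classic x by rewrite /= in_itv/=; apply/andP; split; lra.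
have i1 z : `]x - 1, x + 1[%classic z -> leb.-integrable setT (EFin \o f z).
  by move=> _; exact: space_conv_integrable.
have i2 z y : `]x - 1, x + 1[%classic z -> [set: R] y -> derivable (f^~ y) z 1.
  by move=> _ _; have [] := df z y.
have G0 y : 0 <= B * `|u y| by rewrite mulr_ge0// (le_trans (normr_ge0 _) (mB 0)).
have iG : leb.-integrable setT (EFin \o (fun y => B * `|u y|)).
  by apply: integrable_scale; exact: L1_abs.
have E z y : partial1of2 f z y = m' (z - y) * u y.
  by rewrite /partial1of2 derive1E; have [] := df z y.
have GB z y : `]x - 1, x + 1[%classic z -> [set: R] y ->
    `|partial1of2 f z y| <= B * `|u y|.
  by move=> _ _; rewrite E normrM ler_wpM2r.
split; first exact: (derivable_under_integral measurableT xI i1 i2 G0 iG GB).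
rewrite -derive1E.
have := differentiation_under_integral measurableT xI i1 i2 G0 iG GB.
rewrite /space_conv /f => ->; apply: eq_Rintegral => y _; exact: E.
Qed.

End convolution.

Lemma class_C_derivative {R : realType} (m : R -> R) :
  class_C 2 m -> bounded_derivs 2 m ->
  exists m' m2 : R -> R, exists B, [/\ forall x : R, is_derive x 1 m (m' x),
    forall x : R, is_derive x 1 m' (m2 x), forall x, `|m x| <= B,
    forall x, `|m' x| <= B & forall x, `|m2 x| <= B].
Proof.
move=> cm bm; exists ('D_1 m), ('D_1 ('D_1 m)).
have [M0 H0] := bm [::] isT; have [M1 H1] := bm [:: (1 : R)] isT.
have [M2 H2] := bm [:: (1 : R); (1 : R)] isT.
exists (`|M0| + `|M1| + `|M2|).
have n0 := normr_ge0 M0; have n1 := normr_ge0 M1; have n2 := normr_ge0 M2.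
have l0 := ler_norm M0; have l1 := ler_norm M1; have l2 := ler_norm M2.
split=> x.
- by apply: derivableP; exact: ((cm [::]).2 isT).
- by apply: derivableP; exact: ((cm [:: (1 : R)]).2 isT).
- by have := H0 x; rewrite /=; lra.
- by have := H1 x; rewrite /=; lra.
- by have := H2 x; rewrite /=; lra.
Qed.

Lemma cvg_finite_sum {R : numFieldType} {V : normedModType R} {T : Type}
    (F : set_system T) {FF : Filter F} (I : finType) (f : I -> T -> V) (l : I -> V) :
  (forall i, f i x @[x --> F] --> l i) ->
  \sum_i f i x @[x --> F] --> \sum_i l i.
Proof.
move=> fl; elim: (index_enum _) => [|i s IH].
  by rewrite big_nil; under eq_fun do rewrite big_nil; exact: cvg_cst.
by rewrite big_cons; under eq_fun do rewrite big_cons; exact: cvgD.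
Qed.

Section several_variables.
Context {R : realType} {N : nat}.
Implicit Types (p q v : 'rV[R]_N) (psi : 'rV[R]_N -> R).

Lemma is_derive_class_C psi v p : class_C 1 psi -> is_derive p v psi ('D_v psi p).
Proof. by move=> cpsi; apply: derivableP; exact: ((cpsi [::]).2 isT). Qed.

Lemma class_C_continuous_derive psi v : class_C 1 psi -> continuous ('D_v psi).
Proof. by move=> cpsi; exact: ((cpsi [:: v]).1 isT). Qed.

Lemma class_C_increment psi q v (h : R) : class_C 1 psi ->
  exists2 c : R, `|c| <= `|h| & psi (h *: v + q) - psi q = 'D_v psi (c *: v + q) * h.
Proof.
move=> cpsi.
have dg (x : R) : is_derive x 1 (fun t : R => psi (t *: v + q)) ('D_v psi (x *: v + q)).
  apply/is_derive_line.
  have /is_derive_line := is_derive_class_C v (x *: v + q) cpsi.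
  congr (is_derive _ _ _ _); apply/funext => t /=.
  by rewrite [_%:A]mulr1 scalerDl addrA.
have [c ch] := mean_value 0 h dg.
rewrite !add0r scale0r add0r => E.
by exists c.
Qed.

(** The increment along u + v is the one along u from p followed by the one along v
    from p + h u; by the mean value theorem the latter is h 'D_v psi at a point that
    tends to p, and 'D_v psi is continuous. *)
Lemma class_C_deriveD psi u v p : class_C 1 psi ->
  'D_(u + v) psi p = 'D_u psi p + 'D_v psi p.
Proof.
move=> cpsi.
suff : is_derive p (u + v) psi ('D_u psi p + 'D_v psi p) by case.
have [du Du] := is_derive_class_C u p cpsi.
suff cv : h^-1 *: ((psi \o shift p) (h *: (u + v)) - psi p) @[h --> 0^'] -->
    'D_u psi p + 'D_v psi p.
  by split; [apply/cvg_ex; eexists; exact: cv|apply/cvg_lim].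
have -> : (fun h : R => h^-1 *: ((psi \o shift p) (h *: (u + v)) - psi p)) =
  (fun h => h^-1 *: ((psi \o shift p) (h *: u) - psi p) +
            h^-1 *: (psi (h *: v + (h *: u + p)) - psi (h *: u + p))).
  apply/funext => h /=; rewrite -scalerDr; congr (_ *: _).
  rewrite scalerDr [h *: u + h *: v]addrC -[h *: v + h *: u + p]addrA.
  by set X := psi _; set Y := psi (_ + p); ring.
apply: cvgD; first exact: du.
have /(_ p)/cvgrPdist_lt cD := @class_C_continuous_derive psi v cpsi.
apply/cvgrPdist_lt => e e0.
have [r /= r0 Hr] := (nbhs_ballP _ _).1 (cD _ e0).
near=> h.
have h0 : h != 0 by near: h; exact: nbhs_dnbhs_neq.
have [c ch ->] := class_C_increment (h *: u + p) v h cpsi.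
rewrite /GRing.scale/= mulrC -mulrA divff// mulr1; apply: Hr.
rewrite -ball_normE; change (is_true (`|p - (c *: v + (h *: u + p))| < r)).
have -> : p - (c *: v + (h *: u + p)) = - (c *: v + h *: u).
  by rewrite addrA opprD addrCA subrr addr0.
rewrite normrN (le_lt_trans (ler_normD _ _))// !normrZ.
have hr : `|h| < r / (`|u| + `|v| + 1).
  by near: h; apply: dnbhs0_lt; rewrite divr_gt0// ltr_wpDl// addr_ge0.
rewrite ltr_pdivlMr in hr; last by rewrite ltr_wpDl// addr_ge0.
apply: le_lt_trans hr; rewrite mulrDr mulrDr mulr1.
have := ler_wpM2r (normr_ge0 v) ch.
have := normr_ge0 h; lra.
Unshelve. all: by end_near. Qed.

Lemma class_C_deriveZ psi (a : R) v p : class_C 1 psi ->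
  'D_(a *: v) psi p = a * 'D_v psi p.
Proof.
move=> cpsi.
suff : is_derive p (a *: v) psi (a * 'D_v psi p) by case.
apply/is_derive_line.
have /is_derive_line D := is_derive_class_C v p cpsi.
have Da : is_derive (0 : R) 1 (fun t : R => t * a) a.
  apply: is_derive_eq (is_deriveM (is_derive_id _ _) (is_derive_cst a _ _)) _.
  by rewrite scaler0 add0r [_%:A]mulr1.
have D' : is_derive ((fun t : R => t * a) 0) 1 (fun h : R => psi (h *: v + p)) ('D_v psi p).
  by rewrite mul0r.
have := @is_derive1_comp _ _ (fun t : R => t * a) 0 _ _ D' Da; rewrite mulrC.
by congr (is_derive _ _ _ _); apply/funext => t /=; rewrite scalerA.
Qed.

Lemma class_C_derive_sum psi v p : class_C 1 psi ->
  'D_v psi p = \sum_j v 0 j * 'D_(delta_mx 0 j) psi p.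
Proof.
move=> cpsi; rewrite {1}(row_sum_delta v).
elim: (index_enum _) => [|j s IH]; first by rewrite !big_nil derive0.
by rewrite !big_cons class_C_deriveD// class_C_deriveZ// IH.
Qed.

Lemma class_C_increment_row psi p q : class_C 1 psi ->
  exists2 c : R, `|c| <= 1 & psi p - psi q =
    \sum_j (p 0 j - q 0 j) * 'D_(delta_mx 0 j) psi (c *: (p - q) + q).
Proof.
move=> cpsi; have [c c1 E] := class_C_increment q (p - q) 1 cpsi.
exists c; first by rewrite normr1 in c1.
move: E; rewrite scale1r subrK mulr1 => ->; rewrite class_C_derive_sum//.
by apply: eq_bigr => j _; rewrite !mxE.
Qed.

Lemma class_C_lipschitz psi (B : R) p q : class_C 1 psi ->
  (forall j x, `|'D_(delta_mx 0 j) psi x| <= B) ->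
  `|psi p - psi q| <= B * \sum_j `|p 0 j - q 0 j|.
Proof.
move=> cpsi bpsi; have [c _ ->] := class_C_increment_row p q cpsi.
apply: le_trans (ler_norm_sum _ _ _) _; rewrite mulr_sumr.
by apply: ler_sum => j _; rewrite normrM mulrC ler_wpM2r.
Qed.

Lemma continuous_row (a : 'I_N -> R -> R) (x : R) :
  (forall j, {for x, continuous (a j)}) ->
  {for x, continuous (fun t => \row_j a j t : 'rV[R]_N)}.
Proof.
move=> ca; have -> : (fun t => \row_j a j t : 'rV[R]_N) =
    (fun t => \sum_j a j t *: (delta_mx 0 j : 'rV[R]_N)).
  by apply/funext => t; rewrite {1}(row_sum_delta (\row_j a j t));
    apply: eq_bigr => j _; rewrite mxE.
apply: cvg_finite_sum => j; apply: cvgZr_tmp; exact: ca.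
Qed.

(** The increment of psi between two points of the curve is a combination of its
    partial derivatives at one intermediate point; dividing by h, both the
    difference quotients and the partial derivatives converge. *)
Lemma is_derive_comp_row psi (a : 'I_N -> R -> R) (a' : 'I_N -> R) (x : R) :
  class_C 1 psi -> (forall j, is_derive x 1 (a j) (a' j)) ->
  is_derive x 1 (fun t => psi (\row_j a j t))
    (\sum_j a' j * 'D_(delta_mx 0 j) psi (\row_j a j x)).
Proof.
move=> cpsi da; pose r t : 'rV[R]_N := \row_j a j t.
have cr : {for x, continuous r}.
  by apply: continuous_row => j; exact: is_derive1_continuous (da j).
pose xi (h : R) := sval (cid2 (class_C_increment_row (r (h + x)) (r x) cpsi)).
have xi1 h : `|xi h| <= 1 by rewrite /xi; case: cid2.
have xiE h : psi (r (h + x)) - psi (r x) = \sum_j (r (h + x) 0 j - r x 0 j) *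
    'D_(delta_mx 0 j) psi (xi h *: (r (h + x) - r x) + r x).
  by rewrite /xi; case: cid2.
suff cv : h^-1 *: (((fun t => psi (r t)) \o shift x) (h *: 1) - psi (r x))
    @[h --> 0^'] --> \sum_j a' j * 'D_(delta_mx 0 j) psi (r x).
  by split; [apply/cvg_ex; eexists; exact: cv|apply/cvg_lim].
have -> : (fun h : R => h^-1 *: (((fun t => psi (r t)) \o shift x) (h *: 1) - psi (r x))) =
  (fun h => \sum_j (h^-1 *: ((a j \o shift x) (h *: 1) - a j x)) *
    'D_(delta_mx 0 j) psi (xi h *: (r (h + x) - r x) + r x)).
  apply/funext => h /=; rewrite [_%:A]mulr1 xiE scaler_sumr.
  by apply: eq_bigr => j _; rewrite !mxE /GRing.scale/= mulrA.
have cs : (h + x) @[h --> 0^'] --> (x : R).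
  have h1 : h + x @[h --> (0:R)] --> (0:R) + x by apply: cvgD; [exact: cvg_id|exact: cvg_cst].
  rewrite add0r in h1; exact: cvg_trans (cvg_app _ (@nbhs_dnbhs _ _)) h1.
have crh : r (h + x) - r x @[h --> 0^'] --> (0 : 'rV[R]_N).
  rewrite -(subrr (r x)); apply: cvgB; last exact: cvg_cst.
  exact: (@cvg_comp _ _ _ (fun h : R => h + x) r _ _ _ cs cr).
have cxi : xi h *: (r (h + x) - r x) + r x @[h --> 0^'] --> r x.
  rewrite -[X in _ --> X]add0r; apply: cvgD; last exact: cvg_cst.
  apply/cvgr0Pnorm_lt => e e0; move/cvgr0Pnorm_lt : crh => /(_ _ e0).
  apply: filterS => h; apply: le_lt_trans; rewrite normrZ -[leRHS]mul1r.
  by rewrite ler_wpM2r.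
apply: cvg_finite_sum => j; apply: cvgM; first by have [daj <-] := da j.
have cD := @class_C_continuous_derive psi (delta_mx 0 j) cpsi.
exact: cvg_comp cxi (cD (r x)).
Qed.

End several_variables.

Section velocity.
Context {R : realType} {N : nat}.
Variables (nu : 'I_N -> 'rV[R]_N -> R) (mu : 'I_N -> 'I_N -> R -> R).
Hypothesis h2 : H2 nu mu.
Implicit Types (u v : 'I_N -> R -> R).

Definition velocity u k (x : R) : R := nu k (conv_vec mu u k x).

Definition l1N u : R := \sum_k l1 (u k).

Definition velocity_derivative u k (x : R) : R := derive1 (velocity u k) x.

Lemma class_C_le (V : normedModType R) (m n : nat) (g : V -> R) :
  (n <= m)%N -> class_C m g -> class_C n g.
Proof.
move=> nm cg vs; have [c1 c2] := cg vs.
by split=> h; [apply: c1; exact: leq_trans h nm|apply: c2; exact: leq_trans h nm].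
Qed.

Lemma class_C_derive (V : normedModType R) (m : nat) (g : V -> R) (v : V) :
  class_C m.+1 g -> class_C m ('D_v g).
Proof.
move=> cg vs; have := cg (rcons vs v); rewrite size_rcons.
by rewrite (_ : Defs.iterD (rcons vs v) g = Defs.iterD vs ('D_v g)) // /Defs.iterD foldr_rcons.
Qed.

Definition kernel_bound (B : R) (m : R -> R) := exists m' : R -> R,
  [/\ forall x : R, is_derive x 1 m (m' x),
    exists2 m2, (forall x : R, is_derive x 1 m' (m2 x)) & forall x, `|m2 x| <= B,
    forall x, `|m x| <= B & forall x, `|m' x| <= B].

Let common_bound (M : R) : exists B, [/\ 0 <= B, M <= B,
    forall k j, kernel_bound B (mu k j) &
    forall k p, [/\ `|nu k p| <= B,
      forall j, `|'D_(delta_mx 0 j) (nu k) p| <= B &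
      forall i j, `|'D_(delta_mx 0 i) ('D_(delta_mx 0 j) (nu k)) p| <= B]].
Proof.
have [hnu hmu] := h2.
have fin (I : finType) (Q : I -> R -> Prop) : (forall i, exists c, Q i c) ->
    (forall i c c', c <= c' -> Q i c -> Q i c') ->
    exists2 c, 0 <= c & forall i, Q i c.
  move=> /choice[c Qc] mono; exists (\sum_i `|c i|) => [|i].
    by apply: sumr_ge0.
  apply: (mono i (c i)) => //; apply: (le_trans (ler_norm _)).
  by rewrite (bigD1 i)//= lerDl sumr_ge0.
have bd k vs : (size vs <= 2)%N -> exists c, forall p, `|Defs.iterD vs (nu k) p| <= c.
  by have [_ _ + _] := hnu k; exact.
have [b1 b10 H1] := fin _ (fun k b => forall p, `|nu k p| <= b)
  (fun k => bd k [::] isT) (fun k c c' cc H p => le_trans (H p) cc).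
have [b2 b20 H2'] := fin _ (fun (kj : 'I_N * 'I_N) b =>
    forall p, `|'D_(delta_mx 0 kj.2) (nu kj.1) p| <= b)
  (fun k => bd k.1 [:: delta_mx 0 k.2] isT) (fun k c c' cc H p => le_trans (H p) cc).
have [b3 b30 H3'] := fin _ (fun (kj : 'I_N * 'I_N * 'I_N) b => forall p,
    `|'D_(delta_mx 0 kj.1.2) ('D_(delta_mx 0 kj.2) (nu kj.1.1)) p| <= b)
  (fun k => bd k.1.1 [:: delta_mx 0 k.1.2; delta_mx 0 k.2] isT)
  (fun k c c' cc H p => le_trans (H p) cc).
have mono c c' m : c <= c' -> kernel_bound c m -> kernel_bound c' m.
  move=> cc [m' [? [m2 ? Hm2] Hm Hm']]; exists m'; split=> //.
  - by exists m2 => // x; exact: le_trans (Hm2 x) cc.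
  - by move=> x; exact: le_trans (Hm x) cc.
  - by move=> x; exact: le_trans (Hm' x) cc.
have [||b4 b40 H4] := fin _ (fun (kj : 'I_N * 'I_N) b => kernel_bound b (mu kj.1 kj.2)).
- move=> [k j]; have [cm _ bm] := hmu k j.
  have [m' [m2 [c [? ? ? ? ?]]]] := class_C_derivative cm bm.
  by exists c, m'; split=> //; exists m2.
- by move=> kj c c' cc; exact: mono.
exists (b1 + b2 + b3 + b4 + `|M|).
have M1 := ler_norm M; have M2 := normr_ge0 M.
split; [lra|lra| |].
  by move=> k j; apply: mono (H4 (k, j)); lra.
move=> k p; split=> [|j|i j].
- by apply: le_trans (H1 k p) _; lra.
- by apply: le_trans (H2' (k, j) p) _; lra.
- by apply: le_trans (H3' (k, i, j) p) _; lra.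
Qed.

Lemma l1N_ge0 u : 0 <= l1N u.
Proof. by apply: sumr_ge0 => k _; exact: l1_ge0. Qed.

Let sum_conv_dist (B M : R) (m m' : 'I_N -> R -> R) u v x y : 0 <= B -> M <= B ->
  (forall j, forall x : R, is_derive x 1 (m j) (m' j x)) ->
  (forall j x, `|m j x| <= B) -> (forall j x, `|m' j x| <= B) ->
  (forall j, L1 (u j)) -> (forall j, L1 (v j)) -> l1N v <= M ->
  \sum_j `|space_conv (m j) (u j) x - space_conv (m j) (v j) y| <=
    (B + B ^+ 2) * (l1N (fun j => u j \- v j) + `|x - y|).
Proof.
move=> B0 MB dm mB m'B iu iv vM.
apply: (@le_trans _ _ (\sum_j (B * l1 (u j \- v j) + B * l1 (v j) * `|x - y|))).
  by apply: ler_sum => j _; exact: (space_conv_dist (dm j) (mB j) (m'B j)).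
rewrite big_split/= -mulr_sumr -mulr_suml -mulr_sumr -/(l1N v).
rewrite -/(l1N (fun j => u j \- v j)).
have l0 := l1N_ge0 (fun j => u j \- v j); have n0 := normr_ge0 (x - y).
have vB : B * l1N v <= B ^+ 2 by rewrite expr2 ler_wpM2l// (le_trans vM).
have := ler_wpM2r n0 vB.
have p1 : 0 <= B * `|x - y| by rewrite mulr_ge0.
have p2 : 0 <= B ^+ 2 * l1N (fun j => u j \- v j) by rewrite mulr_ge0 ?exprn_ge0.
rewrite mulrDl !mulrDr; lra.
Qed.

Definition velocity_control (M K : R) := forall k,
  (forall u x, `|velocity u k x| <= K) /\
  forall u v, (forall j, L1 (u j)) -> (forall j, L1 (v j)) ->
  l1N u <= M -> l1N v <= M ->
  [/\ forall x, `|velocity_derivative u k x| <= K,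
      forall x y, `|velocity u k x - velocity v k y| <=
        K * (l1N (fun j => u j \- v j) + `|x - y|) &
      forall x y, `|velocity_derivative u k x - velocity_derivative v k y| <=
        K * (l1N (fun j => u j \- v j) + `|x - y|)].

(** By the chain rule the slope of the velocity is a sum of products of mu' * u_j and
    of a partial derivative of nu at mu * u. Convolution with a bounded Lipschitz
    kernel turns the L^1 distance of two states into a uniform distance, and nu has
    bounded second derivatives; so each factor is bounded, and Lipschitz in space
    and in the state, on states of mass at most M. *)
Lemma velocity_estimates (M : R) : exists2 K : R, 0 < K & velocity_control M K.
Proof.
have [B [B0 MB muB nuB]] := common_bound M.
pose K : R := 1 + B + B ^+ 3 + B * (B + B ^+ 2) * (1 + B ^+ 2).
have q2 : 0 <= B ^+ 2 by rewrite exprn_ge0.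
have q3 : 0 <= B ^+ 3 by rewrite exprn_ge0.
have q4 : 0 <= B * (B + B ^+ 2) by rewrite mulr_ge0// addr_ge0.
have q5 : 0 <= B * (B + B ^+ 2) * B ^+ 2 by rewrite mulr_ge0.
have K0 : 0 < K by rewrite /K mulrDr mulr1; lra.
exists K => // k; split=> [u x|u v iu iv uM vM].
  have [+ _ _] := nuB k (conv_vec mu u k x); rewrite -/(velocity u k x) => h.
  by apply: (le_trans h); rewrite /K mulrDr mulr1; lra.
have [mp Hmp] := choice (muB k).
have cnu2 : class_C 2 (nu k) by have [/(_ k)[]] := h2.
have cnu : class_C 1 (nu k) by exact: class_C_le cnu2.
have cDnu j : class_C 1 ('D_(delta_mx 0 j) (nu k)) by exact: class_C_derive.
have dm j (x : R) : is_derive x 1 (mu k j) (mp j x) by have [] := Hmp j.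
have mB j x : `|mu k j x| <= B by have [] := Hmp j.
have mpB j x : `|mp j x| <= B by have [] := Hmp j.
have vE w x : (forall j, L1 (w j)) -> velocity_derivative w k x =
    \sum_j space_conv (mp j) (w j) x * 'D_(delta_mx 0 j) (nu k) (conv_vec mu w k x).
  move=> iw; rewrite /velocity_derivative derive1E /velocity /conv_vec.
  have [|_ ->//] := @is_derive_comp_row _ _ (nu k) (fun j => space_conv (mu k j) (w j))
    (fun j => space_conv (mp j) (w j) x) x cnu.
  by move=> j; exact: (is_derive_space_conv (dm j) (mB j) (mpB j)).
have cb w x : (forall j, L1 (w j)) -> l1N w <= M ->
    \sum_j `|space_conv (mp j) (w j) x| <= B ^+ 2.
  move=> iw wM; apply: (@le_trans _ _ (\sum_j B * l1 (w j))).
    apply: ler_sum => j _; have [_ [m2 dmp _] _ _] := Hmp j.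
    exact: (space_conv_bound dmp (mpB j)).
  by rewrite -mulr_sumr expr2 ler_wpM2l// (le_trans wM).
have cdist x y : \sum_j `|conv_vec mu u k x 0 j - conv_vec mu v k y 0 j| <=
    (B + B ^+ 2) * (l1N (fun j => u j \- v j) + `|x - y|).
  under eq_bigr do rewrite !mxE.
  exact: (sum_conv_dist _ _ B0 MB dm mB mpB iu iv vM).
have E0 (x y : R) : 0 <= l1N (fun j => u j \- v j) + `|x - y|.
  by rewrite addr_ge0// l1N_ge0.
have lip psi x y : class_C 1 psi -> (forall j p, `|'D_(delta_mx 0 j) psi p| <= B) ->
    `|psi (conv_vec mu u k x) - psi (conv_vec mu v k y)| <=
    B * (B + B ^+ 2) * (l1N (fun j => u j \- v j) + `|x - y|).
  move=> cpsi psiB; apply: le_trans (class_C_lipschitz _ _ cpsi psiB) _.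
  by rewrite -mulrA ler_wpM2l.
split=> [x|x y|x y].
- rewrite vE//; apply: le_trans (ler_norm_sum _ _ _) _.
  apply: (@le_trans _ _ (\sum_j `|space_conv (mp j) (u j) x| * B)).
    apply: ler_sum => j _; rewrite normrM ler_wpM2l//.
    by have [_ + _] := nuB k (conv_vec mu u k x); exact.
  rewrite -mulr_suml; have := ler_wpM2r B0 (cb u x iu uM).
  by rewrite -exprSr /K mulrDr mulr1; lra.
- apply: le_trans (lip (nu k) x y cnu _) _ => [j p|].
    by have [_ + _] := nuB k p; exact.
  by rewrite ler_wpM2r// /K [leRHS]addrC [_ * (1 + _)]mulrDr mulr1; lra.
- rewrite !vE// -sumrB; apply: le_trans (ler_norm_sum _ _ _) _.
  set E := l1N _ + _.
  apply: (@le_trans _ _ (\sum_j (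
      `|space_conv (mp j) (u j) x - space_conv (mp j) (v j) y| * B +
      `|space_conv (mp j) (v j) y| * (B * (B + B ^+ 2) * E)))).
    apply: ler_sum => j _.
    set a := space_conv _ _ x; set a' := space_conv _ _ y.
    set b := 'D_'e_j _ _; set b' := 'D_'e_j _ _.
    have -> : a * b - a' * b' = (a - a') * b + a' * (b - b') by ring.
    apply: le_trans (ler_normD _ _) _; rewrite !normrM.
    apply: lerD; apply: ler_wpM2l => //.
      by have [_ + _] := nuB k (conv_vec mu u k x); exact.
    apply: (lip ('D_(delta_mx 0 j) (nu k)) x y (cDnu j)) => i p.
    by have [_ _ +] := nuB k p; exact.
  rewrite big_split/= -!mulr_suml.
  have h1 : \sum_j `|space_conv (mp j) (u j) x - space_conv (mp j) (v j) y| <=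
      (B + B ^+ 2) * E.
    have [m2 Hm2] := choice (fun j => let: And4 _ (ex_intro2 m2 a b) _ _ := Hmp j in
      (ex_intro _ m2 (conj a b) : exists m2 : R -> R,
        (forall x : R, is_derive x 1 (mp j) (m2 x)) /\ forall x, `|m2 x| <= B)).
    apply: (sum_conv_dist _ _ B0 MB (fun j => (Hm2 j).1) mpB (fun j => (Hm2 j).2)) => //.
  have h3 := cb v y iv vM.
  have QE : 0 <= B * (B + B ^+ 2) * E := mulr_ge0 q4 (E0 x y).
  have g1 := ler_wpM2r B0 h1; have g2 := ler_wpM2r QE h3.
  apply: le_trans (lerD g1 g2) _.
  rewrite [X in _ <= X](_ : _ = (1 + B + B ^+ 3) * E + ((B + B ^+ 2) * E * B +
    B ^+ 2 * (B * (B + B ^+ 2) * E))); last by rewrite /K; ring.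
  by rewrite lerDr; apply: mulr_ge0; [lra|exact: E0].
Qed.

End velocity.

(** * Functions of bounded variation on the line *)

Section almost_everywhere.
Context d (T : measurableType d) (R : realType) (mu : {measure set T -> \bar R}).
Implicit Types P Q : T -> Prop.

Lemma ae_mono P Q : (forall x, P x -> Q x) ->
  {ae mu, forall x, P x} -> {ae mu, forall x, Q x}.
Proof. by move=> PQ; apply: filterS. Qed.

Lemma ae_and P Q : {ae mu, forall x, P x} -> {ae mu, forall x, Q x} ->
  {ae mu, forall x, P x /\ Q x}.
Proof. exact: filterI. Qed.

Lemma ae_all P : (forall x, P x) -> {ae mu, forall x, P x}.
Proof. by move=> ?; apply: nearW. Qed.

End almost_everywhere.

Lemma ge0_integrable d (T : measurableType d) (R : realType)
    (mu : {measure set T -> \bar R}) (f : T -> R) (C : R) :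
  measurable_fun setT f -> (forall x, 0 <= f x) ->
  (\int[mu]_x (f x)%:E <= C%:E)%E ->
  mu.-integrable setT (EFin \o f) /\ \int[mu]_x f x <= C.
Proof.
move=> mf f0 fC.
have I0 : (0 <= \int[mu]_x (f x)%:E)%E by apply: integral_ge0 => x _; rewrite lee_fin.
split; last first.
  by rewrite -lee_fin /Rintegral fineK// ge0_fin_numE// (le_lt_trans fC)// ltry.
apply/integrableP; split; first exact/measurable_EFinP.
rewrite (le_lt_trans _ (ltry C))//; apply: le_trans fC.
by under eq_integral do rewrite /= ger0_norm//.
Qed.

Section variation_majorant.
Context {R : realType}.
Local Notation leb := (@lebesgue_measure R).
Implicit Types g h G : R -> R.

(** G stands for the variation of g on the half-line that ends at its argument. *)
Definition variation_majorant (B : R) G g := [/\ nondecreasing_fun G,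
  forall x, 0 <= G x <= B & forall x y, x <= y -> `|g y - g x| <= G y - G x].

Lemma variation_majorant_ex (B : R) g : (variation_line g <= B%:E)%E ->
  exists G, variation_majorant B G g.
Proof.
move=> gB.
have TVB a b : a <= b -> (total_variation a b g <= B%:E)%E.
  move=> ab; apply: le_trans gB; apply: ereal_sup_ubound.
  by exists (a, b).
have B0 : 0 <= B.
  by have := TVB 0 0 (lexx _); rewrite total_variationxx.
pose Gs x := ereal_sup [set total_variation a x g | a in [set a | a <= x]].
have Gle x : (Gs x <= B%:E)%E.
  by apply: ge_ereal_sup => _ [a /= ax <-]; exact: TVB.
have G0 x : (0 <= Gs x)%E.
  apply: ereal_sup_ubound; exists x; first by rewrite /=.
  by rewrite total_variationxx.
have Gfin x : Gs x \is a fin_num.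
  by rewrite ge0_fin_numE// (le_lt_trans (Gle x))// ltry.
have TVfin a b : a <= b -> total_variation a b g \is a fin_num.
  move=> ab; rewrite ge0_fin_numE ?total_variation_ge0//.
  by rewrite (le_lt_trans (TVB _ _ ab))// ltry.
have Gadd x y : x <= y -> (Gs x + total_variation x y g <= Gs y)%E.
  move=> xy; rewrite -leeBrDr ?TVfin//.
  apply: ge_ereal_sup => _ [a /= ax <-]; rewrite leeBrDr ?TVfin//.
  rewrite -total_variationD//; apply: ereal_sup_ubound.
  by exists a => //=; exact: le_trans xy.
have GaddR x y : x <= y -> `|g y - g x| <= fine (Gs y) - fine (Gs x).
  move=> xy; rewrite -lee_fin EFinB !fineK// leeBrDl//.
  apply: le_trans (Gadd _ _ xy); rewrite leeD2l//.
  exact: total_variation_ge.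
exists (fine \o Gs); split => [x y xy|x|//].
  by have := GaddR _ _ xy; have := normr_ge0 (g y - g x); rewrite /=; lra.
by rewrite /= fine_ge0//= -lee_fin fineK.
Qed.

(** g is the difference of the monotone functions G and G - g. *)
Lemma variation_majorant_measurable B G g : variation_majorant B G g ->
  measurable_fun setT g.
Proof.
move=> [ndG GB Gg].
rewrite (_ : g = G \- (G \- g)); last by apply/funext => x /=; ring.
apply: measurable_funB; apply: nondecreasing_measurable => //.
move=> x y xy /=; have := Gg _ _ xy; rewrite ler_norml => /andP[]; lra.
Qed.

Lemma variation_majorant_osc B G g x y : variation_majorant B G g -> `|g x - g y| <= B.
Proof.
move=> [ndG GB Gg]; have := GB x; have := GB y.
by case: (leP x y) => [/Gg|/ltW/Gg]; rewrite 1?distrC; lra.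
Qed.

Lemma variation_majorant_mul (B C S T : R) G H g h :
  variation_majorant B G g -> variation_majorant C H h ->
  (forall x, `|g x| <= S) -> (forall x, `|h x| <= T) ->
  variation_majorant (S * C + T * B) (fun x => S * H x + T * G x) (fun x => g x * h x).
Proof.
move=> [ndG GB Gg] [ndH HC Hh] gS hT.
have S0 : 0 <= S := le_trans (normr_ge0 _) (gS 0).
have T0 : 0 <= T := le_trans (normr_ge0 _) (hT 0).
split=> [x y xy|x|x y xy].
- by apply: lerD; apply: ler_wpM2l => //; [exact: ndH|exact: ndG].
- have /andP[? ?] := GB x; have /andP[? ?] := HC x; apply/andP; split.
    by rewrite addr_ge0// mulr_ge0.
  by apply: lerD; apply: ler_wpM2l.
- have -> : g y * h y - g x * h x = g y * (h y - h x) + h x * (g y - g x) by ring.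
  apply: le_trans (ler_normD _ _) _; rewrite !normrM.
  have a1 : `|g y| * `|h y - h x| <= S * (H y - H x) by apply: ler_pM => //; exact: Hh.
  have a2 : `|h x| * `|g y - g x| <= T * (G y - G x) by apply: ler_pM => //; exact: Gg.
  lra.
Qed.

(** On [- n, n] the two translates cancel except on intervals of length 2 d, where
    G is at most B; then n tends to infinity. *)
Lemma integral_translate_monotone (B d : R) G : 0 <= d ->
  nondecreasing_fun G -> (forall x, 0 <= G x <= B) ->
  (\int[leb]_x (G (x + d) - G (x - d))%:E <= (2 * d * B)%:E)%E.
Proof.
move=> d0 ndG GB.
have B0 : 0 <= B by have := GB 0; lra.
have mG : measurable_fun setT G by exact: nondecreasing_measurable.
have mGs (c : R) : measurable_fun setT (fun x : R => (G (x + c))%:E).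
  apply/measurable_EFinP; apply: (measurableT_comp mG); exact: measurable_funD.
have mGE : measurable_fun setT (EFin \o G) by exact/measurable_EFinP.
have G0 x : (0 <= (G x)%:E)%E by rewrite lee_fin; have /andP[] := GB x.
pose f x := (G (x + d) - G (x - d))%:E.
have f0 x : (0 <= f x)%E by rewrite lee_fin subr_ge0 ndG//; lra.
have mf : measurable_fun setT f.
  rewrite /f; under eq_fun do rewrite EFinB.
  by apply: emeasurable_funB => //; exact: mGs.
pose I (n : nat) : set R := `[- n%:R, n%:R]%classic.
have mI n : measurable (I n) by exact: measurable_itv.
have shift n c : (\int[leb]_(x in I n) (G (x + c))%:E =
    \int[leb]_(x in `[(- n%:R + c)%R, (n%:R + c)%R]) (G x)%:E)%E.
  rewrite -(ge0_integral_translation c (measurable_itv _) mGE G0).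
  congr (integral _ _ _); apply/seteqP; split=> x /=; by rewrite !in_itv/= !lerD2r.
have bound n : (\int[leb]_(x in I n) f x <= (2 * d * B)%:E)%E.
  pose A : set R := `[(- n%:R - d)%R, (n%:R - d)%R]%classic.
  pose D : set R := `](n%:R - d)%R, (n%:R + d)%R]%classic.
  have n0 : (0:R) <= n%:R by [].
  have iA : (\int[leb]_(x in A) (G x)%:E)%E \is a fin_num.
    rewrite ge0_fin_numE; last by apply: integral_ge0.
    apply: (@le_lt_trans _ _ (\int[leb]_(x in A) (cst B%:E) x)%E).
      apply: ge0_le_integral => //; first exact: measurable_itv.
      - exact: measurable_funS mGE.
      - by move=> x _; rewrite lee_fin; have /andP[] := GB x.
    rewrite integral_cst//; last exact: measurable_itv.
    rewrite -[X in (_ * X)%E]/(lebesgue_measure A) /A lebesgue_measure_itv/=.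
    by case: ifP; rewrite ?mule0 ?ltry// -EFinM ltry.
  rewrite -(@leeD2rE _ (\int[leb]_(x in A) (G x)%:E)%E)//.
  have -> : (\int[leb]_(x in I n) f x + \int[leb]_(x in A) (G x)%:E =
      \int[leb]_(x in I n) (G (x + d))%:E)%E.
    rewrite /A -shift -ge0_integralD//; last 3 first.
    - exact: mI.
    - exact: measurable_funS mf.
    - by apply: measurable_funS (mGs (- d)).
    apply: eq_integral => x _; rewrite /f -EFinD; congr (_%:E); ring.
  rewrite shift.
  apply: (@le_trans _ _ (\int[leb]_(x in A `|` D) (G x)%:E)%E).
    apply: ge0_subset_integral.
    - exact: measurable_itv.
    - by apply: measurableU; exact: measurable_itv.
    - exact: measurable_funS mGE.
    - by [].
    - have inc (x : R) : n%:R * -1 + d <= x <= n%:R + d ->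
          (- n%:R - d <= x <= n%:R - d) \/ (n%:R - d < x <= n%:R + d).
        move=> /andP[x1 x2]; case: (leP x (n%:R - d)) => h; [left|right].
          by apply/andP; split; lra.
        by apply/andP; split; lra.
      move=> x; rewrite /A /D /setU /= !in_itv/= => x12; apply: inc.
      by rewrite mulrN1.
  rewrite ge0_integral_setU//=; [|exact: measurable_itv|exact: measurable_itv| |]; last 2 first.
  - exact: measurable_funS mGE.
  - apply/disj_setPS => x []; rewrite /A /D /= !in_itv/= => /andP[_ xd] /andP[+ _].
    by rewrite ltNge xd.
  rewrite addeC leeD2r//.
  apply: (@le_trans _ _ (\int[leb]_(x in D) (cst B%:E) x)%E).
    apply: ge0_le_integral => //; first exact: measurable_itv.
    - exact: measurable_funS mGE.
    - by move=> x _; rewrite lee_fin; have /andP[] := GB x.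
  rewrite integral_cst//; last exact: measurable_itv.
  rewrite -[X in (_ * X)%E]/(lebesgue_measure D) /D lebesgue_measure_itv/=.
  case: ifP => _; last by rewrite mule0 lee_fin !mulr_ge0.
  by rewrite -EFinB -EFinM lee_fin; have -> : B * (n%:R + d - (n%:R - d)) = 2 * d * B by ring.
have ndI : nondecreasing_seq I.
  move=> m n mn; apply/subsetPset => x; rewrite /I /= !in_itv/= => /andP[x1 x2].
  have mnR : (m%:R : R) <= n%:R by rewrite ler_nat.
  by rewrite (le_trans _ x1) ?lerN2//= (le_trans x2).
have UI : \bigcup_n I n = setT.
  apply/seteqP; split=> // x _; have [n xn] : exists n : nat, `|x| <= n%:R.
    by exists (Num.bound `|x|); apply: ltW; apply: archi_boundP.
  by exists n => //; rewrite /I /= in_itv/= -ler_norml.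
have := @ge0_nondecreasing_set_cvg_integral _ (measurableTypeR R) R I f leb ndI mI
  (fun i => measurable_funS measurableT (@subsetT _ _) mf) (fun i x _ => f0 x).
rewrite UI => /(@cvg_lim _ _) <-//.
apply: lime_le; last by apply: nearW => n; exact: bound.
apply: ereal_nondecreasing_is_cvgn => m n mn; apply: ge0_subset_integral.
- exact: mI.
- exact: mI.
- exact: measurable_funS mf.
- by [].
- exact/subsetPset/ndI.
Qed.

(** Every kernel of width d in x - y is at most a multiple of this indicator, which
    reduces the estimates to integrals over a strip. *)
Definition near_diag (d : R) (p : R * R) : R := (`|p.1 - p.2| <= d)%R%:R.

Lemma near_diag_ge0 d p : 0 <= near_diag d p.
Proof. by rewrite /near_diag ler0n. Qed.

Lemma near_diag_le1 d p : near_diag d p <= 1.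
Proof. by rewrite /near_diag lern1 leq_b1. Qed.

Lemma near_diag_sym (d x y : R) : near_diag d (x, y) = near_diag d (y, x).
Proof. by rewrite /near_diag/= distrC. Qed.

Lemma measurable_near_diag d : measurable_fun setT (near_diag d).
Proof.
rewrite (_ : near_diag d = \1_[set p : R * R | `|p.1 - p.2| <= d]); last first.
  by apply/funext => p; rewrite indicE /near_diag mem_setE.
apply/measurable_indicP; rewrite -[X in measurable X]setTI.
apply: (@measurable_fun_ler _ _ _ setT (fun p : R * R => `|p.1 - p.2|) (cst d)) => //.
apply: measurableT_comp => //; exact: measurable_funB.
Qed.

Lemma near_diagE (d x y : R) : (near_diag d (x, y))%:E = (\1_(`[x - d, x + d]%classic : set R) y)%:E.
Proof.
by rewrite indicE mem_setE /near_diag/= in_itv/= distrC ler_distl.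
Qed.

Lemma integral_near_diag (d x : R) : 0 <= d ->
  (\int[leb]_y (near_diag d (x, y))%:E = (2 * d)%:E)%E.
Proof.
move=> d0; under eq_integral do rewrite near_diagE.
rewrite integral_indic// setIT -[X in X = _]/(lebesgue_measure _).
rewrite lebesgue_measure_itv/= lte_fin -EFinB.
case: ifPn => [_|]; first by have -> : x + d - (x - d) = 2 * d by ring.
rewrite -leNgt => h; have -> : d = 0 by lra.
by rewrite mulr0.
Qed.

Lemma near_diag_weight d (w : R -> R) : 0 <= d -> L1 w ->
  plane.-integrable setT (EFin \o (fun p : R * R => `|w p.1| * near_diag d p)) /\
  \int[plane]_p (`|w p.1| * near_diag d p) = 2 * d * l1 w.
Proof.
move=> d0 iw.
have mw := integrable_real_measurable iw.
pose f (p : R * R) : R := `|w p.1| * near_diag d p.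
have mf : measurable_fun setT f.
  apply: measurable_funM; last exact: measurable_near_diag.
  by apply: measurableT_comp => //; apply: (measurableT_comp mw).
have f0 p : (0 <= (f p)%:E)%E by rewrite lee_fin mulr_ge0// near_diag_ge0.
have E : (\int[plane]_p (f p)%:E = (2 * d * l1 w)%:E)%E.
  rewrite plane_tonelli//; last exact/measurable_EFinP.
  under eq_integral => x _.
    rewrite /f/=; under eq_integral do rewrite EFinM.
    rewrite ge0_integralZl//; last 2 first.
    - apply/measurable_EFinP; apply: (measurableT_comp (measurable_near_diag d)).
      exact: pair1_measurable.
    - by move=> y _; rewrite lee_fin near_diag_ge0.
    rewrite integral_near_diag// muleC; over.
  rewrite /= ge0_integralZl//; [|by apply/measurable_EFinP; apply: measurableT_comp|by rewrite lee_fin mulr_ge0].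
  rewrite [in RHS]EFinM; congr (_ * _)%E.
  by rewrite /l1 /Rintegral fineK//; apply: integrable_fin_num => //; exact: L1_abs.
have f0' p : 0 <= f p by rewrite -lee_fin.
have E' : (\int[plane]_p (f p)%:E <= (2 * d * l1 w)%:E)%E by rewrite E.
have [i _] := @ge0_integrable _ _ _ plane f (2 * d * l1 w) mf f0' E'.
by split=> //; rewrite /Rintegral E.
Qed.

(** For |x - y| <= d the oscillation |z x - z y| is at most G (x + d) - G (x - d),
    which integrates to 2 d B in x, and y ranges over an interval of length 2 d. *)
Lemma near_diag_osc (d B : R) (z g G : R -> R) : 0 <= d ->
  measurable_fun setT z -> {ae leb, forall x, g x = z x} -> variation_majorant B G g ->
  plane.-integrable setT (EFin \o (fun p : R * R => `|z p.1 - z p.2| * near_diag d p)) /\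
  \int[plane]_p (`|z p.1 - z p.2| * near_diag d p) <= 4 * d ^+ 2 * B.
Proof.
move=> d0 mz zg vg; have [ndG GB Gg] := vg.
have B0 : 0 <= B by have := GB 0; lra.
have mg := variation_majorant_measurable vg.
pose f (h : R -> R) (p : R * R) : R := `|h p.1 - h p.2| * near_diag d p.
have mf h : measurable_fun setT h -> measurable_fun setT (f h).
  move=> mh; apply: measurable_funM; last exact: measurable_near_diag.
  apply: measurableT_comp => //; apply: measurable_funB.
    exact: (measurableT_comp mh).
  exact: (measurableT_comp mh).
have f0 h p : (0 <= (f h p)%:E)%E by rewrite lee_fin mulr_ge0// near_diag_ge0.
have E : (\int[plane]_p (f z p)%:E <= (4 * d ^+ 2 * B)%:E)%E.
  have mfz : measurable_fun setT (fun p => (f z p)%:E).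
    by apply/measurable_EFinP; exact: mf.
  rewrite (plane_tonelli mfz (f0 z)).
  have mF h : measurable_fun setT h ->
      measurable_fun setT (fun x => \int[leb]_y (f h (x, y))%:E)%E.
    move=> mh; have mfh : measurable_fun setT (fun p => (f h p)%:E).
      by apply/measurable_EFinP; exact: mf.
    exact: (@measurable_fun_fubini_tonelli_F _ _ _ _ R leb _ mfh (f0 h)).
  have mS h x : measurable_fun setT h -> measurable_fun setT (fun y => (f h (x, y))%:E).
    move=> mh; apply/measurable_EFinP; apply: (measurableT_comp (mf h mh)).
    exact: pair1_measurable.
  have -> : (\int[leb]_x \int[leb]_y (f z (x, y))%:E =
      \int[leb]_x \int[leb]_y (f g (x, y))%:E)%E.
    apply: ge0_ae_eq_integral => //; [exact: mF|exact: mF| | |].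
    - by move=> x _; apply: integral_ge0.
    - by move=> x _; apply: integral_ge0.
    apply: ae_mono (zg) => x gx _.
    apply: ge0_ae_eq_integral => //; [exact: mS|exact: mS|].
    apply: ae_mono zg => y gy _.
    by rewrite /f/= gx gy.
  apply: (@le_trans _ _ (\int[leb]_x ((2 * d)%:E * (G (x + d) - G (x - d))%:E))%E).
    apply: ge0_le_integral => //; first by move=> x _; apply: integral_ge0.
    - exact: mF.
    - apply: emeasurable_funM => //; apply/measurable_EFinP; apply: measurable_funB.
        by apply: nondecreasing_measurable => // x y xy; apply: ndG; rewrite lerD2r.
      by apply: nondecreasing_measurable => // x y xy; apply: ndG; rewrite lerD2r.
    move=> x _; rewrite -(integral_near_diag x d0) muleC.
    rewrite -ge0_integralZl//; last 3 first.
    - apply/measurable_EFinP; apply: (measurableT_comp (measurable_near_diag d)).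
      exact: pair1_measurable.
    - by move=> y _; rewrite lee_fin near_diag_ge0.
    - by rewrite lee_fin subr_ge0 ndG//; lra.
    apply: ge0_le_integral => //; first exact: mS.
    - apply: emeasurable_funM => //; apply/measurable_EFinP.
      apply: (measurableT_comp (measurable_near_diag d)); exact: pair1_measurable.
    move=> y _; rewrite -EFinM lee_fin /f /near_diag /=.
    case: (leP `|x - y| d) => [xy|_]; last by rewrite !mulr0.
    rewrite !mulr1; move: xy; rewrite ler_distl => /andP[xy1 xy2].
    have := @ndG x (x + d); have := @ndG (x - d) x.
    have := @ndG y (x + d); have := @ndG (x - d) y.
    by case: (leP x y) => [/Gg|/ltW/Gg]; rewrite 1?[`|g x - _|]distrC; lra.
  rewrite ge0_integralZl//; last 3 first.
  - apply/measurable_EFinP; apply: measurable_funB.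
      by apply: nondecreasing_measurable => // x y xy; apply: ndG; rewrite lerD2r.
    by apply: nondecreasing_measurable => // x y xy; apply: ndG; rewrite lerD2r.
  - by move=> x _; rewrite lee_fin subr_ge0 ndG//; lra.
  - by rewrite lee_fin mulr_ge0.
  apply: (@le_trans _ _ ((2 * d)%:E * (2 * d * B)%:E)%E).
    by apply: lee_wpmul2l => //; [rewrite lee_fin mulr_ge0|exact: integral_translate_monotone].
  by rewrite -EFinM lee_fin; have -> : 2 * d * (2 * d * B) = 4 * d ^+ 2 * B by ring.
apply: (@ge0_integrable _ _ _ plane (f z) _ (mf z mz)) => // p.
by rewrite -lee_fin; exact: f0.
Qed.

End variation_majorant.

(** * Doubling in space at fixed times *)

Section kruzkov_flux.
Context {R : realType}.
Variables (f : R -> R) (Lf : R).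
Hypothesis fL : forall x y, `|f x - f y| <= Lf * `|x - y|.

Definition kruzkov (w z : R) := Num.sg (w - z) * (f w - f z).

Lemma kruzkov_le w z : `|kruzkov w z| <= Lf * `|w - z|.
Proof.
rewrite normrM normr_sg; apply: le_trans (fL w z); case: (_ != _).
  by rewrite mul1r.
by rewrite mul0r.
Qed.

(** If z1 and z2 lie on the same side of w this is the Lipschitz bound of f; if w
    separates them, their distances to w add up to |z1 - z2|. *)
Lemma kruzkov_lipschitz w z1 z2 :
  `|kruzkov w z1 - kruzkov w z2| <= Lf * `|z1 - z2|.
Proof.
have opp z z' : w <= z -> z' <= w ->
    `|kruzkov w z - kruzkov w z'| <= Lf * `|z - z'|.
  move=> wz zw; apply: le_trans (ler_normB _ _) _.
  have := kruzkov_le w z; have := kruzkov_le w z'.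
  rewrite (ler0_norm (x := w - z)) ?subr_le0// (ger0_norm (x := w - z')) ?subr_ge0//.
  rewrite (ger0_norm (x := z - z')) ?subr_ge0; last exact: le_trans zw wz.
  lra.
have [->|z1w] := eqVneq z1 w.
  by case: (leP w z2) => h; [rewrite distrC [leRHS]mulrC [leRHS]mulrC [`|w - _|]distrC; exact: opp|exact/opp/ltW].
have [->|z2w] := eqVneq z2 w.
  by case: (leP w z1) => h; [exact: opp|rewrite distrC [`|_ - w|]distrC; apply: opp => //; exact: ltW].
move: z1w z2w; rewrite !neq_lt => /orP[z1w|wz1] /orP[z2w|wz2].
- rewrite /kruzkov !gtr0_sg ?subr_gt0// !mul1r.
  by rewrite (_ : _ - _ = - (f z1 - f z2)); [rewrite normrN; exact: fL|ring].
- by rewrite distrC [`|z1 - _|]distrC; apply: opp; exact: ltW.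
- by apply: opp; exact: ltW.
- rewrite /kruzkov !ltr0_sg ?subr_lt0// !mulN1r.
  by rewrite (_ : _ - _ = f z1 - f z2); [exact: fL|ring].
Qed.

Lemma kruzkovC w z : kruzkov w z = kruzkov z w.
Proof. by rewrite /kruzkov -opprB sgrN mulNr -mulrN opprB. Qed.

Lemma lipschitz_measurable : measurable_fun setT f.
Proof.
apply: continuous_measurable_fun => x.
have L0 : 0 <= Lf.
  by have := le_trans (normr_ge0 _) (fL 1 0); rewrite subr0 normr1 mulr1.
have L1 : 0 < Lf + 1 by lra.
apply/cvgrPdist_le => e e0; have e1 : 0 < e / (Lf + 1) by rewrite divr_gt0.
have xe : \forall y \near x, `|x - y| <= e / (Lf + 1).
  by have /cvgrPdist_le := @cvg_id _ (nbhs x); apply.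
near=> y; apply: le_trans (fL x y) _; apply: (@le_trans _ _ ((Lf + 1) * `|x - y|)).
  by rewrite ler_wpM2r// lerDl.
by rewrite -ler_pdivlMl// mulrC; near: y.
Unshelve. all: by end_near.
Qed.

End kruzkov_flux.

Lemma measurable_sgr {R : realType} : measurable_fun setT (@Num.sg R).
Proof.
apply: nondecreasing_measurable => // x y xy.
by case: (sgrP x) => x0; case: (sgrP y) => y0; lra.
Qed.

Section dominated_sealed.
Context {R : realType}.

Lemma L1_dominated (f g : R -> R) : measurable_fun setT f ->
  (forall p, `|f p| <= g p) -> L1 g -> L1 f.
Proof. exact: (@integrable_dominated _ _ _ lebesgue_measure f g). Qed.

Lemma plane_dominated (f g : R * R -> R) : measurable_fun setT f ->
  (forall p, `|f p| <= g p) ->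
  plane.-integrable setT (EFin \o g) -> plane.-integrable setT (EFin \o f).
Proof. exact: (@integrable_dominated _ _ _ plane f g). Qed.

Lemma quad_dominated (f g : (R * R) * (R * R) -> R) : measurable_fun setT f ->
  (forall p, `|f p| <= g p) ->
  quad.-integrable setT (EFin \o g) -> quad.-integrable setT (EFin \o f).
Proof. exact: (@integrable_dominated _ _ _ quad f g). Qed.

End dominated_sealed.

Section kernels_near_diagonal.
Context {R : realType}.
Local Notation leb := (@lebesgue_measure R).
Variables (d : R) (d0 : 0 < d).

Lemma moll_near x y : `|moll d (x - y)| <= bump_bound / d * near_diag d (x, y).
Proof.
rewrite /near_diag/=; case: (leP `|x - y| d) => [_|h]; first by rewrite mulr1 le_moll.
by rewrite mulr0 moll_out ?normr0// ltW.
Qed.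

Lemma moll'_near x y : `|moll' d (x - y)| <= bump_bound / d ^+ 2 * near_diag d (x, y).
Proof.
rewrite /near_diag/=; case: (leP `|x - y| d) => [_|h]; first by rewrite mulr1 le_moll'.
by rewrite mulr0 moll'_out ?normr0// ltW.
Qed.

Lemma measurable_moll : measurable_fun setT (moll d).
Proof. by apply: continuous_measurable_fun; exact: continuous_moll. Qed.

Lemma measurable_moll' : measurable_fun setT (moll' d).
Proof. by apply: continuous_measurable_fun; exact: continuous_moll'. Qed.

Lemma measurable_near_diag_section x : measurable_fun setT (fun y => near_diag d (x, y)).
Proof.
apply: (measurableT_comp (measurable_near_diag d)); exact: pair1_measurable.
Qed.

Lemma L1_near_diag x : L1 (fun y => near_diag d (x, y)).
Proof.
have E : (\int[leb]_y (near_diag d (x, y))%:E <= (2 * d)%:E)%E.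
  by rewrite integral_near_diag// ltW.
by have [] := @ge0_integrable _ _ _ leb _ (2 * d) (measurable_near_diag_section x)
  (fun y => near_diag_ge0 _ _) E.
Qed.

Lemma L1_moll x : L1 (fun y => moll d (x - y)).
Proof.
apply: (@integrable_dominated _ _ _ leb _ (fun y => bump_bound / d * near_diag d (x, y))).
- by apply: (measurableT_comp measurable_moll); exact: measurable_funB.
- by move=> y; exact: moll_near.
- by apply: integrable_scale; exact: L1_near_diag.
Qed.

Lemma L1_moll' x : L1 (fun y => moll' d (x - y)).
Proof.
apply: (@integrable_dominated _ _ _ leb _ (fun y => bump_bound / d ^+ 2 * near_diag d (x, y))).
- by apply: (measurableT_comp measurable_moll'); exact: measurable_funB.
- by move=> y; exact: moll'_near.
- by apply: integrable_scale; exact: L1_near_diag.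
Qed.

Lemma L1_moll_shift x : L1 (fun y => moll d (y - x)).
Proof. by have := L1_moll x; under eq_fun do rewrite -mollN opprB. Qed.

Lemma L1_moll'_shift x : L1 (fun y => moll' d (y - x)).
Proof.
have := integrable_scale (-1) (L1_moll' x).
by under eq_fun do rewrite -opprB moll'N mulN1r opprK.
Qed.

Lemma integral_moll_shift x : \int[leb]_y moll d (y - x) = 1.
Proof.
by rewrite -[RHS](integral_moll d0 x); apply: eq_Rintegral => y _; rewrite -mollN opprB.
Qed.

Definition width_bound := @bump_bound R / d + bump_bound / d ^+ 2.

Lemma width_bound_ge0 : 0 <= width_bound.
Proof. by have b0 := @bump_bound_gt0 R; rewrite addr_ge0// divr_ge0 ?exprn_ge0// ltW. Qed.

Lemma moll_near_width (x y : R) :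
  `|moll d (x - y)| <= width_bound * near_diag d (x, y) /\
  `|moll' d (x - y)| <= width_bound * near_diag d (x, y).
Proof.
have b0 := @bump_bound_gt0 R.
have n0 := near_diag_ge0 d (x, y).
split; [apply: le_trans (moll_near x y) _|apply: le_trans (moll'_near x y) _];
  by rewrite ler_wpM2r// ?lerDl ?lerDr divr_ge0 ?exprn_ge0// ltW.
Qed.

Definition ess_bv (B : R) z := exists g G,
  {ae leb, forall x, g x = z x} /\ variation_majorant B G g.

(** The common source of all estimates in space. For the kernel moll d the constant C
    is of order 1 / d, so that the oscillation of z contributes a term of order d; for
    moll' d it is of order 1 / d ^ 2, and any further factor d in the integrand
    compensates the loss. *)
Lemma near_diag_dominated (B C c1 c2 : R) (u z : R -> R) (g k : R * R -> R) :
  measurable_fun setT g -> measurable_fun setT k ->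
  L1 u -> measurable_fun setT z -> ess_bv B z ->
  0 <= C -> 0 <= c1 -> 0 <= c2 ->
  (forall p, `|k p| <= C * near_diag d p) ->
  (forall x y, `|x - y| <= d -> `|g (x, y)| <= c1 * `|u x| + c2 * `|z x - z y|) ->
  plane.-integrable setT (EFin \o (fun p => g p * k p)) /\
  `|\int[plane]_p (g p * k p)| <= C * (c1 * (2 * d * l1 u) + c2 * (4 * d ^+ 2 * B)).
Proof.
move=> mg mk iu mz [v [G [zg vg]]] C0 c10 c20 kC gc; have d0' := ltW d0.
have [i1 E1] := near_diag_weight d0' iu.
have [i2 E2] := near_diag_osc d0' mz zg vg.
pose b (p : R * R) := C * (c1 * (`|u p.1| * near_diag d p) +
  c2 * (`|z p.1 - z p.2| * near_diag d p)).
have ib0 : plane.-integrable setT (EFin \o (fun p : R * R =>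
    c1 * (`|u p.1| * near_diag d p) + c2 * (`|z p.1 - z p.2| * near_diag d p))).
  by apply: (@integrable_add _ _ _ plane); exact: integrable_scale.
have ib : plane.-integrable setT (EFin \o b) by exact: integrable_scale.
have hb p : `|g p * k p| <= b p.
  case: p => x y; rewrite normrM /b; have := kC (x, y); rewrite /near_diag /=.
  case: (leP `|x - y| d) => [xy|_]; last first.
    by rewrite !mulr0 addr0 mulr0 normr_le0 => /eqP ->; rewrite normr0 mulr0.
  by rewrite !mulr1 => kxy; rewrite mulrC; apply: ler_pM => //; exact: gc.
have mh : measurable_fun setT (fun p => g p * k p) by exact: measurable_funM.
have ih := plane_dominated mh hb ib.
split=> //; apply: (le_trans (le_normr_Rintegral _ _)) => //.
apply: (@le_trans _ _ (\int[plane]_p b p)).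
  apply: le_Rintegral => //; exact: integrable_abs.
rewrite RintegralZl// ler_wpM2l// RintegralD//; [|exact: integrable_scale|exact: integrable_scale].
rewrite !RintegralZl// E1 lerD2l; exact: ler_wpM2l.
Qed.

End kernels_near_diagonal.

(** Two unknowns w and z at two fixed times, carried by velocities N and M with
    slopes N' and M'; l bounds the distance of the two states and a is the weight
    1 / sigma. *)
Section doubling_in_space.
Context {R : realType}.
Local Notation leb := (@lebesgue_measure R).
Variables (d Lf K A B W l : R) (f a w z N M N' M' : R -> R).
Hypotheses (d0 : 0 < d) (K0 : 0 <= K) (l0 : 0 <= l).
Hypothesis fL : forall x y, `|f x - f y| <= Lf * `|x - y|.
Hypothesis f0 : f 0 = 0.
Hypothesis a_bound : forall x, 0 <= a x <= A.
Hypotheses (ma : measurable_fun setT a) (mN : measurable_fun setT N)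
  (mM : measurable_fun setT M) (mN' : measurable_fun setT N') (mM' : measurable_fun setT M').
Hypotheses (iw : L1 w) (iz : L1 z) (bw : ess_bv B w) (bz : ess_bv B z) (wW : l1 w <= W).
Hypothesis ML : forall x y, `|M x - M y| <= K * `|x - y|.
Hypothesis NM : forall x, `|N x - M x| <= K * l.
Hypothesis N'K : forall x, `|N' x| <= K.
Hypothesis N'M' : forall x y, `|N' x - M' y| <= K * (l + `|x - y|).

Definition doubled_time1 (p : R * R) := a p.1 * `|w p.1 - z p.2| * moll d (p.1 - p.2).
Definition doubled_time2 (p : R * R) := a p.2 * `|w p.1 - z p.2| * moll d (p.1 - p.2).
Definition doubled_flux (p : R * R) :=
  (N p.1 - M p.2) * kruzkov f (w p.1) (z p.2) * moll' d (p.1 - p.2).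
Definition doubled_source (p : R * R) := Num.sg (w p.1 - z p.2) *
  (f (z p.2) * N' p.1 - f (w p.1) * M' p.2) * moll d (p.1 - p.2).
Let bb := @bump_bound R.
Let L := \int[leb]_x (a x * `|w x - z x|).

Let m1 (g : R -> R) : measurable_fun setT g -> measurable_fun setT (fun p : R * R => g p.1).
Proof. by move=> mg; apply: (measurableT_comp mg). Qed.

Let m2 (g : R -> R) : measurable_fun setT g -> measurable_fun setT (fun p : R * R => g p.2).
Proof. by move=> mg; apply: (measurableT_comp mg). Qed.

Let mdiff (g : R -> R) : measurable_fun setT g ->
  measurable_fun setT (fun p : R * R => g (p.1 - p.2)).
Proof. by move=> mg; apply: (measurableT_comp mg); exact: measurable_funB. Qed.

Let mabs (g : R * R -> R) : measurable_fun setT g -> measurable_fun setT (fun p => `|g p|).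
Proof. by move=> mg; apply: measurableT_comp. Qed.

Let mw := integrable_real_measurable iw.
Let mz := integrable_real_measurable iz.
Let mf : measurable_fun setT f := lipschitz_measurable fL.
Let mr : measurable_fun setT (fun p : R * R => moll d (p.1 - p.2)) := mdiff (measurable_moll d).
Let mr' : measurable_fun setT (fun p : R * R => moll' d (p.1 - p.2)) := mdiff (measurable_moll' d).

Let mkr (g h : R * R -> R) : measurable_fun setT g -> measurable_fun setT h ->
  measurable_fun setT (fun p => kruzkov f (g p) (h p)).
Proof.
move=> mg mh; apply: measurable_funM.
  by apply: (measurableT_comp measurable_sgr); exact: measurable_funB.
by apply: measurable_funB; apply: (measurableT_comp mf).
Qed.

Let bb0 : 0 < bb := bump_bound_gt0.
Let A0 : 0 <= A. Proof. by have /andP[] := a_bound 0; lra. Qed.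
Let Lf0 : 0 <= Lf.
Proof. by have := le_trans (normr_ge0 _) (fL 1 0); rewrite subr0 normr1 mulr1. Qed.
Let B0 : 0 <= B.
Proof. by have [g [G [_ [_ /(_ 0) + _]]]] := bw; lra. Qed.

Let kr (p : R * R) : `|moll d (p.1 - p.2)| <= bb / d * near_diag d p.
Proof. by case: p => x y; exact: moll_near. Qed.

Let kr' (p : R * R) : `|moll' d (p.1 - p.2)| <= bb / d ^+ 2 * near_diag d p.
Proof. by case: p => x y; exact: moll'_near. Qed.

Let C0 : 0 <= bb / d. Proof. by rewrite divr_ge0// ltW. Qed.
Let C0' : 0 <= bb / d ^+ 2. Proof. by rewrite divr_ge0 ?exprn_ge0// ltW. Qed.

Let iwz : L1 (w \- z) := L1B iw iz.

(** Replacing z y by z x costs the oscillation of z, of order d; then the kernel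
    integrates to 1 in y. *)
Lemma doubled_time1_estimate : plane.-integrable setT (EFin \o doubled_time1) /\
  `|\int[plane]_p doubled_time1 p - L| <= 4 * A * bb * B * d.
Proof.
pose g (p : R * R) := a p.1 * `|w p.1 - z p.1|.
have mg : measurable_fun setT g.
  apply: measurable_funM; first exact: m1.
  by apply: mabs; apply: measurable_funB; exact: m1.
have gA x y : `|x - y| <= d -> `|g (x, y)| <= A * `|(w \- z) x| + 0 * `|z x - z y|.
  by move=> _; rewrite mul0r addr0 normrM normr_id ler_wpM2r// ger0_norm;
    have /andP[] := a_bound x.
have [ig _] := near_diag_dominated d0 mg mr iwz mz bz C0 A0 (lexx 0) kr gA.
have Eg : \int[plane]_p (g p * moll d (p.1 - p.2)) = L.
  rewrite plane_fubini//; apply: eq_Rintegral => x _.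
  by rewrite /g/= RintegralZl//; [rewrite integral_moll// mulr1|exact: L1_moll].
pose h (p : R * R) := a p.1 * (`|w p.1 - z p.2| - `|w p.1 - z p.1|).
have mh : measurable_fun setT h.
  apply: measurable_funM; first exact: m1.
  by apply: measurable_funB; apply: mabs; apply: measurable_funB => //; do 1?[exact: m1|exact: m2].
have hA x y : `|x - y| <= d -> `|h (x, y)| <= 0 * `|w x| + A * `|z x - z y|.
  move=> _; rewrite mul0r add0r normrM; have /andP[a1 a2] := a_bound x.
  apply: ler_pM => //=; first by rewrite ger0_norm.
  by apply: le_trans (ler_dist_dist _ _) _; rewrite opprB addrC subrKA.
have [ih Eh] := near_diag_dominated d0 mh mr iw mz bz C0 (lexx 0) A0 kr hA.
have E : doubled_time1 = (fun p => g p * moll d (p.1 - p.2) + h p * moll d (p.1 - p.2)).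
  by apply/funext => p; rewrite /doubled_time1 /g /h; ring.
split; first by rewrite E; exact: integrable_add.
rewrite E RintegralD// Eg addrC addKr.
apply: le_trans Eh _; rewrite mul0r add0r.
have -> : bb / d * (A * (4 * d ^+ 2 * B)) = 4 * A * bb * B * d.
  by field; exact: lt0r_neq0.
by [].
Qed.

Let triangle_wz x y : `|w x - z y| <= `|(w \- z) x| + `|z x - z y|.
Proof. by rewrite (le_trans _ (ler_normD _ _))//= subrKA. Qed.

(** Symmetric to the previous estimate: here w x is replaced by w y, because the
    weight is taken at y. *)
Lemma doubled_time2_estimate : plane.-integrable setT (EFin \o doubled_time2) /\
  `|\int[plane]_p doubled_time2 p - L| <= 4 * A * bb * B * d.
Proof.
pose e (p : R * R) := a p.2 * `|w p.1 - z p.2|.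
have me : measurable_fun setT e.
  apply: measurable_funM; first exact: m2.
  by apply: mabs; apply: measurable_funB; [exact: m1|exact: m2].
have eA x y : `|x - y| <= d -> `|e (x, y)| <= A * `|(w \- z) x| + A * `|z x - z y|.
  move=> _; rewrite -mulrDr normrM normr_id; have /andP[a1 a2] := a_bound y.
  by apply: ler_pM => //=; rewrite ger0_norm.
have [ie _] := near_diag_dominated d0 me mr iwz mz bz C0 A0 A0 kr eA.
pose h (p : R * R) := a p.2 * (`|w p.1 - z p.2| - `|w p.2 - z p.2|).
have mh : measurable_fun setT h.
  apply: measurable_funM; first exact: m2.
  by apply: measurable_funB; apply: mabs; apply: measurable_funB => //; do 1?[exact: m1|exact: m2].
have hA x y : `|x - y| <= d -> `|h (x, y)| <= 0 * `|w x| + A * `|w x - w y|.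
  move=> _; rewrite mul0r add0r normrM; have /andP[a1 a2] := a_bound y.
  apply: ler_pM => //=; first by rewrite ger0_norm.
  by apply: le_trans (ler_dist_dist _ _) _; rewrite opprB subrKA.
have [ih Eh] := near_diag_dominated d0 mh mr iw mw bw C0 (lexx 0) A0 kr hA.
have ig : plane.-integrable setT (EFin \o (fun p : R * R =>
    a p.2 * `|w p.2 - z p.2| * moll d (p.1 - p.2))).
  rewrite (_ : (fun p => _) = (fun p => e p * moll d (p.1 - p.2) - h p * moll d (p.1 - p.2))).
    exact: integrable_sub.
  by apply/funext => p; rewrite /e /h; ring.
have Eg : \int[plane]_p (a p.2 * `|w p.2 - z p.2| * moll d (p.1 - p.2)) = L.
  rewrite plane_fubini2//; apply: eq_Rintegral => y _ /=.
  under eq_Rintegral => x _ do rewrite -mollN opprB.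
  by rewrite RintegralZl//; [rewrite integral_moll// mulr1|exact: L1_moll].
have E : doubled_time2 = (fun p => a p.2 * `|w p.2 - z p.2| * moll d (p.1 - p.2) +
    h p * moll d (p.1 - p.2)).
  by apply/funext => p; rewrite /doubled_time2 /h; ring.
split; first exact: ie.
rewrite E RintegralD// Eg addrC addKr.
apply: le_trans Eh _; rewrite mul0r add0r.
have -> : bb / d * (A * (4 * d ^+ 2 * B)) = 4 * A * bb * B * d.
  by field; exact: lt0r_neq0.
by [].
Qed.

(** The kernel is of order 1 / d ^ 2 on a strip of width d, so one factor d has to be
    found. The difference of the velocities is M x - M y plus N x - M x. The former is
    of order d on the strip. In the latter, replacing z y by z x produces the
    oscillation of z, and what is left depends on y through moll' only, whose integral
    vanishes. *)
Lemma doubled_flux_estimate : plane.-integrable setT (EFin \o doubled_flux) /\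
  `|\int[plane]_p doubled_flux p| <=
     bb * Lf * K * (2 * l1 (w \- z) + 4 * B * d + 4 * B * l).
Proof.
have dn0 : d != 0 := lt0r_neq0 d0.
pose h (p : R * R) := (M p.1 - M p.2) * kruzkov f (w p.1) (z p.2).
have mh : measurable_fun setT h.
  apply: measurable_funM; last by apply: mkr; [exact: m1|exact: m2].
  by apply: measurable_funB; [exact: m1|exact: m2].
have c0 : 0 <= K * d * Lf by rewrite mulr_ge0// mulr_ge0// ltW.
have hB x y : `|x - y| <= d -> `|h (x, y)| <=
    K * d * Lf * `|(w \- z) x| + K * d * Lf * `|z x - z y|.
  move=> xy; rewrite -mulrDr normrM -mulrA; apply: ler_pM => //=.
    by apply: le_trans (ML _ _) _; exact: ler_wpM2l.
  by apply: le_trans (kruzkov_le fL _ _) _; apply: ler_wpM2l.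
have [ih Eh] := near_diag_dominated d0 mh mr' iwz mz bz C0' c0 c0 kr' hB.
pose g (p : R * R) := (N p.1 - M p.1) *
  (kruzkov f (w p.1) (z p.2) - kruzkov f (w p.1) (z p.1)).
have mg : measurable_fun setT g.
  apply: measurable_funM; first by apply: measurable_funB; exact: m1.
  by apply: measurable_funB; apply: mkr; do 1?[exact: m1|exact: m2].
have c0' : 0 <= K * l * Lf by rewrite mulr_ge0// mulr_ge0.
have gB x y : `|x - y| <= d -> `|g (x, y)| <=
    0 * `|w x| + K * l * Lf * `|z x - z y|.
  move=> xy; rewrite mul0r add0r normrM -mulrA; apply: ler_pM => //=.
  by rewrite [`|z x - _|]distrC; exact: kruzkov_lipschitz.
have [ig Eg] := near_diag_dominated d0 mg mr' iw mz bz C0' (lexx 0) c0' kr' gB.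
pose e (p : R * R) := (N p.1 - M p.1) * kruzkov f (w p.1) (z p.1).
have me : measurable_fun setT e.
  apply: measurable_funM; first by apply: measurable_funB; exact: m1.
  by apply: mkr; exact: m1.
have eB x y : `|x - y| <= d -> `|e (x, y)| <=
    K * l * Lf * `|(w \- z) x| + 0 * `|z x - z y|.
  move=> _; rewrite mul0r addr0 normrM -mulrA; apply: ler_pM => //=.
  exact: kruzkov_le.
have [ie _] := near_diag_dominated d0 me mr' iwz mz bz C0' c0' (lexx 0) kr' eB.
have Ee : \int[plane]_p (e p * moll' d (p.1 - p.2)) = 0.
  rewrite plane_fubini// (_ : Rintegral _ _ _ = \int[leb]_x ((fun=> 0) x : R)).
    by rewrite /Rintegral integral0.
  apply: eq_Rintegral.
  move=> x _ /=; rewrite /e/=.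
  by rewrite RintegralZl//; [rewrite integral_moll'// mulr0|exact: L1_moll'].
have E : doubled_flux = (fun p => h p * moll' d (p.1 - p.2) + g p * moll' d (p.1 - p.2) +
    e p * moll' d (p.1 - p.2)).
  by apply/funext => p; rewrite /doubled_flux /h /g /e; ring.
have ihg : plane.-integrable setT (EFin \o (fun p : R * R =>
    h p * moll' d (p.1 - p.2) + g p * moll' d (p.1 - p.2))) by exact: integrable_add.
split; first by rewrite E; exact: integrable_add.
rewrite E RintegralD// Ee addr0 RintegralD//.
apply: le_trans (ler_normD _ _) _; apply: le_trans (lerD Eh Eg) _.
rewrite le_eqVlt; apply/orP; left; apply/eqP; field.
by [].
Qed.

(** The source f (z y) N' x - f (w x) M' y is the sum of (f (z y) - f (w x)) N' x,
    which gives a Kruzkov flux, and of f (w x) (N' x - M' y), where f 0 = 0 bounds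
    f (w x) by the integrable |w x|. *)
Lemma doubled_source_estimate : plane.-integrable setT (EFin \o doubled_source) /\
  `|\int[plane]_p doubled_source p| <=
     bb * Lf * K * (2 * l1 (w \- z) + 4 * B * d + 2 * W * (l + d)).
Proof.
have dn0 : d != 0 := lt0r_neq0 d0.
pose h (p : R * R) := - N' p.1 * kruzkov f (w p.1) (z p.2).
have mh : measurable_fun setT h.
  apply: measurable_funM; last by apply: mkr; [exact: m1|exact: m2].
  by apply: measurableT_comp => //; exact: m1.
have c0 : 0 <= K * Lf by rewrite mulr_ge0.
have hB x y : `|x - y| <= d -> `|h (x, y)| <=
    K * Lf * `|(w \- z) x| + K * Lf * `|z x - z y|.
  move=> xy; rewrite -mulrDr normrM normrN -mulrA; apply: ler_pM => //=.
  by apply: le_trans (kruzkov_le fL _ _) _; apply: ler_wpM2l.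
have [ih Eh] := near_diag_dominated d0 mh mr iwz mz bz C0 c0 c0 kr hB.
pose g (p : R * R) := Num.sg (w p.1 - z p.2) * (f (w p.1) * (N' p.1 - M' p.2)).
have mg : measurable_fun setT g.
  apply: measurable_funM.
    by apply: (measurableT_comp measurable_sgr); apply: measurable_funB; [exact: m1|exact: m2].
  apply: measurable_funM; first by apply: (measurableT_comp mf); exact: m1.
  by apply: measurable_funB; [exact: m1|exact: m2].
have c0' : 0 <= K * (l + d) * Lf by rewrite mulr_ge0// mulr_ge0// addr_ge0// ltW.
have gB x y : `|x - y| <= d -> `|g (x, y)| <=
    K * (l + d) * Lf * `|w x| + 0 * `|z x - z y|.
  move=> xy; rewrite mul0r addr0 normrM normr_sg.
  apply: (@le_trans _ _ (`|f (w x) * (N' x - M' y)|)).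
    by rewrite ler_piMl//; case: (_ != _).
  rewrite normrM mulrC -mulrA; apply: ler_pM => //.
    by apply: le_trans (N'M' _ _) _; rewrite ler_wpM2l// lerD2l.
  by have := fL (w x) 0; rewrite f0 !subr0.
have [ig Eg] := near_diag_dominated d0 mg mr iw mz bz C0 c0' (lexx 0) kr gB.
have E : doubled_source = (fun p => h p * moll d (p.1 - p.2) + g p * moll d (p.1 - p.2)).
  by apply/funext => p; rewrite /doubled_source /h /g /kruzkov; ring.
split; first by rewrite E; exact: integrable_add.
rewrite E RintegralD//.
apply: le_trans (ler_normD _ _) _; apply: le_trans (lerD Eh Eg) _.
apply: (@le_trans _ _ (bb * Lf * K * (2 * l1 (w \- z) + 4 * B * d + 2 * l1 w * (l + d)))).
  by rewrite le_eqVlt; apply/orP; left; apply/eqP; field.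
apply: ler_wpM2l; first by rewrite mulr_ge0// mulr_ge0// ltW.
by rewrite lerD2l ler_wpM2r ?addr_ge0// ?ler_wpM2l// ltW.
Qed.

(** The width d enters the bound through terms proportional to d only, so that it can
    tend to 0 while the time kernels, which provide c1, c2 and b, stay fixed. *)
Lemma doubling_in_space (c1 c2 b : R) : 0 <= b ->
  plane.-integrable setT (EFin \o (fun p => c1 * doubled_time1 p + c2 * doubled_time2 p +
     b * (doubled_flux p - doubled_source p))) /\
  \int[plane]_p (c1 * doubled_time1 p + c2 * doubled_time2 p +
     b * (doubled_flux p - doubled_source p)) <=
  (c1 + c2) * L + 4 * A * bb * B * d * (`|c1| + `|c2|) +
  b * (bb * Lf * K * (4 + 8 * B + 2 * W) * (l1 (w \- z) + l + d)).
Proof.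
move=> b0.
have [i1 E1] := doubled_time1_estimate; have [i2 E2] := doubled_time2_estimate.
have [i3 E3] := doubled_flux_estimate; have [i4 E4] := doubled_source_estimate.
have i34 : plane.-integrable setT (EFin \o (fun p => doubled_flux p - doubled_source p)).
  exact: integrable_sub.
have j1 : plane.-integrable setT (EFin \o (fun p => c1 * doubled_time1 p)).
  exact: integrable_scale.
have j2 : plane.-integrable setT (EFin \o (fun p => c2 * doubled_time2 p)).
  exact: integrable_scale.
have j3 : plane.-integrable setT (EFin \o (fun p => b * (doubled_flux p - doubled_source p))).
  exact: integrable_scale.
have j12 : plane.-integrable setT (EFin \o (fun p => c1 * doubled_time1 p + c2 * doubled_time2 p)).
  exact: integrable_add.
split; first exact: integrable_add.
rewrite RintegralD// RintegralD// !RintegralZl// RintegralB//.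
set I1 := \int[plane]_p doubled_time1 p in E1 *; set I2 := \int[plane]_p doubled_time2 p in E2 *.
set I3 := \int[plane]_p doubled_flux p in E3 *; set I4 := \int[plane]_p doubled_source p in E4 *.
have t c I : `|I - L| <= 4 * A * bb * B * d -> c * I <= c * L + 4 * A * bb * B * d * `|c|.
  move=> IL; rewrite -lerBlDl -mulrBr (le_trans (ler_norm _))// normrM mulrC.
  exact: ler_wpM2r.
have h1 := t c1 _ E1; have h2 := t c2 _ E2.
have W0 : 0 <= W := le_trans (l1_ge0 _) wW.
have nn : 0 <= bb * Lf * K by rewrite mulr_ge0// mulr_ge0// ltW.
have h3 : I3 - I4 <= bb * Lf * K * (4 + 8 * B + 2 * W) * (l1 (w \- z) + l + d).
  have h : I3 - I4 <= `|I3| + `|I4|.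
    by have := ler_norm I3; have := ler_norm (- I4); rewrite normrN; lra.
  apply: (le_trans h); apply: (le_trans (lerD E3 E4)).
  rewrite -mulrDr -[leRHS]mulrA; apply: ler_wpM2l => //.
  set x := l1 _; have x0 : 0 <= x := l1_ge0 _; rewrite -subr_ge0.
  have -> : (4 + 8 * B + 2 * W) * (x + l + d) - (2 * x + 4 * B * d + 4 * B * l +
      (2 * x + 4 * B * d + 2 * W * (l + d))) =
    (8 * B + 2 * W) * x + (4 + 4 * B) * l + 4 * d by ring.
  by rewrite !addr_ge0// mulr_ge0// ?addr_ge0// ?mulr_ge0// ltW.
have h3' := ler_wpM2l b0 h3; lra.
Qed.

End doubling_in_space.

(** * Doubling in time *)

Lemma ae_le_Rintegral d (T : measurableType d) (R : realType)
    (mu : {measure set T -> \bar R}) (f g : T -> R) :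
  mu.-integrable setT (EFin \o f) -> mu.-integrable setT (EFin \o g) ->
  {ae mu, forall x, f x <= g x} -> \int[mu]_x f x <= \int[mu]_x g x.
Proof.
move=> if_ ig fg; rewrite -subr_ge0 -RintegralB//.
rewrite (_ : Rintegral _ _ _ = \int[mu]_x `|g x - f x|).
  by apply: Rintegral_ge0 => x _.
rewrite /Rintegral; congr fine.
have ib := integrable_sub ig if_.
apply: ae_eq_integral => //; first by have /measurable_int := ib.
  by have /measurable_int := integrable_abs ib.
by move: fg; rewrite /ae_eq; apply: filterS => x fgx _; rewrite ger0_norm// subr_ge0.
Qed.

Section almost_everywhere_plane.
Context {R : realType}.
Local Notation leb := (@lebesgue_measure R).

Let plane_measure0 (A B : set R) : measurable A -> measurable B ->
  (leb A * leb B = 0)%E -> plane (A `*` B) = 0%E.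
Proof.
move=> mA mB AB; have mAB : measurable (A `*` B) by exact: measurableX.
rewrite -[LHS]mul1e -(integral_cst plane mAB 1%E) plane_integral.
have -> : (\int[(leb \x leb)%E]_(x in A `*` B) 1 = 1 * (leb \x leb) (A `*` B))%E.
  exact: (integral_cst (leb \x leb)%E mAB 1%E).
by rewrite mul1e product_measure1E.
Qed.

Lemma plane_ae1 (P : R -> Prop) :
  {ae leb, forall t, P t} -> {ae plane, forall p, P p.1}.
Proof.
move=> [A [mA A0 PA]]; exists (A `*` setT); split.
- exact: measurableX.
- by apply: plane_measure0 => //; rewrite A0 mul0e.
- by move=> p Pp; split; [exact: PA|].
Qed.

Lemma plane_ae2 (P : R -> Prop) :
  {ae leb, forall t, P t} -> {ae plane, forall p, P p.2}.
Proof.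
move=> [A [mA A0 PA]]; exists (setT `*` A); split.
- exact: measurableX.
- by apply: plane_measure0 => //; rewrite A0 mule0.
- by move=> p Pp; split; [|exact: PA].
Qed.

End almost_everywhere_plane.

Section time_windows.
Context {R : realType}.
Local Notation leb := (@lebesgue_measure R).

Lemma plane_integrable_tensor (g h : R -> R) : L1 g -> L1 h ->
  plane.-integrable setT (EFin \o (fun p : R * R => g p.1 * h p.2)).
Proof.
move=> ig ih.
have mg := integrable_real_measurable ig; have mh := integrable_real_measurable ih.
pose f (p : R * R) : R := `|g p.1| * `|h p.2|.
have mf : measurable_fun setT f.
  apply: measurable_funM.
    by apply: measurableT_comp => //; apply: (measurableT_comp mg).
  by apply: measurableT_comp => //; apply: (measurableT_comp mh).
have f0 p : 0 <= f p by exact: mulr_ge0.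
have mfE : measurable_fun setT (fun p => (f p)%:E) by exact/measurable_EFinP.
have E : (\int[plane]_p (f p)%:E <= (l1 g * l1 h)%:E)%E.
  rewrite (plane_tonelli mfE); last by move=> p; rewrite lee_fin.
  have lE (u : R -> R) : L1 u -> (\int[leb]_x `|u x|%:E = (l1 u)%:E)%E.
    by move=> iu; rewrite /l1 /Rintegral fineK//; apply: integrable_fin_num => //; exact: L1_abs.
  under eq_integral => x _.
    rewrite /f/=; under eq_integral do rewrite EFinM.
    rewrite ge0_integralZl//; last by apply/measurable_EFinP; apply: measurableT_comp.
    rewrite lE// muleC; over.
  rewrite /= ge0_integralZl ?lee_fin ?l1_ge0//; last first.
    by apply/measurable_EFinP; apply: measurableT_comp.
  by rewrite lE// -EFinM mulrC.
have [i _] := @ge0_integrable _ _ _ plane f _ mf f0 E.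
apply: plane_dominated i; last by move=> p; rewrite normrM.
by apply: measurable_funM; [apply: (measurableT_comp mg)|apply: (measurableT_comp mh)].
Qed.

Variables (W : R) (w : R -> R -> R).
Hypothesis mw : measurable_fun setT (fun p : R * R => w p.1 p.2).
Hypothesis iw : forall t, L1 (w t).
Hypothesis wW : forall t, l1 (w t) <= W.

Let W0 : 0 <= W := le_trans (l1_ge0 _) (wW 0).

Lemma integral_time_window (e r : R) : 0 < e ->
  (\int[plane]_p (`|w p.1 p.2| * near_diag e (p.1, r))%:E <= (W * (2 * e))%:E)%E.
Proof.
move=> e0; have mn := measurable_near_diag_section e r.
have mf : measurable_fun setT (fun p : R * R => (`|w p.1 p.2| * near_diag e (p.1, r))%:E).
  apply/measurable_EFinP; apply: measurable_funM; first exact: measurableT_comp.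
  by under eq_fun do rewrite near_diag_sym; apply: (measurableT_comp mn).
rewrite (plane_tonelli mf); last by move=> p; rewrite lee_fin mulr_ge0// near_diag_ge0.
apply: (@le_trans _ _ (\int[leb]_t (W%:E * (near_diag e (r, t))%:E))%E).
  apply: ge0_le_integral => //.
  - by move=> t _; apply: integral_ge0 => x _; rewrite lee_fin mulr_ge0// near_diag_ge0.
  - apply: (@measurable_fun_fubini_tonelli_F _ _ _ _ R leb _ mf).
    by move=> p; rewrite lee_fin mulr_ge0// near_diag_ge0.
  - by apply: emeasurable_funM => //; apply/measurable_EFinP.
  move=> t _ /=; under eq_integral do rewrite mulrC EFinM.
  rewrite ge0_integralZl//; last 2 first.
  - apply/measurable_EFinP; apply: measurableT_comp => //.
    exact: integrable_real_measurable (iw t).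
  - by rewrite lee_fin near_diag_ge0.
  rewrite near_diag_sym muleC; apply: lee_wpmul2r; first by rewrite lee_fin near_diag_ge0.
  apply: (@le_trans _ _ (l1 (w t))%:E); last by rewrite lee_fin.
  by rewrite /l1 /Rintegral fineK//; apply: integrable_fin_num => //; exact: L1_abs.
rewrite ge0_integralZl//.
- by rewrite (integral_near_diag r (ltW e0)) -EFinM.
- by apply/measurable_EFinP.
- by move=> t _; rewrite lee_fin near_diag_ge0.
Qed.

Lemma integrable_time_window (e r : R) : 0 < e ->
  plane.-integrable setT (EFin \o (fun p : R * R => `|w p.1 p.2| * near_diag e (p.1, r))).
Proof.
move=> e0.
have [] // := @ge0_integrable _ _ _ plane (fun p : R * R => `|w p.1 p.2| * near_diag e (p.1, r))
  _ _ _ (integral_time_window r e0).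
- apply: measurable_funM; first exact: measurableT_comp.
  by under eq_fun do rewrite near_diag_sym; apply: (measurableT_comp (measurable_near_diag_section e r)).
- by move=> p; rewrite mulr_ge0// near_diag_ge0.
Qed.

(** Both times within e of r, and the two points within d of each other: the domain
    to which the kernels confine the doubled integrals. *)
Definition quad_window (e d r : R) (p : (R * R) * (R * R)) : R :=
  near_diag e (p.1.1, r) * near_diag e (p.2.1, r) * near_diag d (p.1.2, p.2.2).

Lemma quad_window_ge0 e d r p : 0 <= quad_window e d r p.
Proof. by rewrite !mulr_ge0// near_diag_ge0. Qed.

Lemma measurable_quad_window e d r : measurable_fun setT (quad_window e d r).
Proof.
have mn := measurable_near_diag_section e r.
apply: measurable_funM; last first.
  apply: (measurableT_comp (measurable_near_diag d)).
  by apply: measurable_fun_pair; do 1?apply: measurableT_comp => //.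
apply: measurable_funM; under eq_fun do rewrite near_diag_sym;
 by apply: (measurableT_comp mn); apply: measurableT_comp.
Qed.

Let mw1 : measurable_fun setT (fun p : (R * R) * (R * R) => w p.1.1 p.1.2).
Proof. by apply: (measurableT_comp mw). Qed.

Lemma quad_integrable_window (e d r : R) : 0 < e -> 0 < d ->
  quad.-integrable setT (EFin \o (fun p => `|w p.1.1 p.1.2| * quad_window e d r p)).
Proof.
move=> e0 d0.
have mn := measurable_near_diag_section e r.
pose f p := `|w p.1.1 p.1.2| * quad_window e d r p.
have mf : measurable_fun setT f.
  apply: measurable_funM; last exact: measurable_quad_window.
  exact: measurableT_comp.
have f0 p : 0 <= f p by rewrite mulr_ge0// quad_window_ge0.
have f0E p : (0 <= (f p)%:E)%E by rewrite lee_fin.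
have mfE : measurable_fun setT (fun p => (f p)%:E) by exact/measurable_EFinP.
have E : (\int[quad]_p (f p)%:E <= (4 * e * d * (W * (2 * e)))%:E)%E.
  rewrite (quad_tonelli mfE f0E).
  have inner (p : R * R) : (\int[plane]_q (f (p, q))%:E =
      (4 * e * d)%:E * (`|w p.1 p.2| * near_diag e (p.1, r))%:E)%E.
    pose g (q : R * R) := near_diag e (r, q.1) * near_diag d (p.2, q.2).
    have mg : measurable_fun setT (fun q => (g q)%:E).
      apply/measurable_EFinP; apply: measurable_funM; first by apply: (measurableT_comp mn).
      by apply: (measurableT_comp (measurable_near_diag_section d p.2)).
    have g0 q : (0 <= (g q)%:E)%E by rewrite lee_fin mulr_ge0// near_diag_ge0.
    rewrite (_ : (fun q => (f (p, q))%:E) =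
        (fun q => (`|w p.1 p.2| * near_diag e (p.1, r))%:E * (g q)%:E)%E); last first.
      apply/funext => q; rewrite -EFinM /f /quad_window /g/=; congr (_%:E).
      by rewrite [near_diag e (r, _)]near_diag_sym !mulrA.
    rewrite ge0_integralZl//; last by rewrite lee_fin mulr_ge0// near_diag_ge0.
    rewrite muleC; congr (_ * _)%E.
    rewrite (plane_tonelli mg g0).
    under eq_integral => s _.
      rewrite /g/=; under eq_integral do rewrite EFinM.
      rewrite ge0_integralZl//; last 3 first.
      - by apply/measurable_EFinP; exact: measurable_near_diag_section.
      - by move=> y _; rewrite lee_fin near_diag_ge0.
      - by rewrite lee_fin near_diag_ge0.
      rewrite (integral_near_diag p.2 (ltW d0)) muleC; over.
    rewrite /= ge0_integralZl//; last 3 first.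
    - by apply/measurable_EFinP.
    - by move=> s _; rewrite lee_fin near_diag_ge0.
    - by rewrite lee_fin mulr_ge0// ltW.
    by rewrite (integral_near_diag r (ltW e0)) -EFinM; congr (_%:E); ring.
  under eq_integral do rewrite inner.
  rewrite ge0_integralZl//.
  - rewrite [leRHS]EFinM; apply: lee_wpmul2l; last exact: integral_time_window.
    by rewrite lee_fin !mulr_ge0// ltW.
  - by have /measurable_int := integrable_time_window r e0.
  - by move=> p _; rewrite lee_fin mulr_ge0// near_diag_ge0.
  - by rewrite lee_fin !mulr_ge0// ltW.
by have [] := @ge0_integrable _ _ _ quad f _ mf f0 E.
Qed.

End time_windows.

Section swap.
Context {R : realType}.

Lemma quad_integrable_swap (h : (R * R) * (R * R) -> R) :
  quad.-integrable setT (EFin \o h) ->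
  quad.-integrable setT (EFin \o (fun p => h (p.2, p.1))).
Proof.
move=> /integrableP[mh fh]; have mh' : measurable_fun setT h by exact/measurable_EFinP.
have ms : measurable_fun setT (fun p : (R * R) * (R * R) => `|h (p.2, p.1)|%:E).
  apply/measurable_EFinP; apply: measurableT_comp => //.
  by apply: (measurableT_comp mh'); exact: measurable_fun_pair.
have mhE : measurable_fun setT (fun p : (R * R) * (R * R) => `|h p|%:E).
  by apply/measurable_EFinP; apply: measurableT_comp.
apply/integrableP; split.
  by apply/measurable_EFinP; apply: (measurableT_comp mh'); exact: measurable_fun_pair.
apply: le_lt_trans fh => /=.
by rewrite (quad_tonelli ms)// (quad_tonelli2 mhE).
Qed.

End swap.

Section plane_measurable.
Context {R : realType}.

Definition plane_measurable (g : R -> R -> R) :=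
  measurable_fun setT (fun p : R * R => g p.1 p.2).

Lemma plane_measurable_comp d (X : measurableType d) (h : R -> R -> R) (t x : X -> R) :
  plane_measurable h -> measurable_fun setT t -> measurable_fun setT x ->
  measurable_fun setT (fun i => h (t i) (x i)).
Proof. by move=> mh mt mx; exact: (measurableT_comp mh (measurable_fun_pair mt mx)). Qed.

Lemma plane_measurable_section (h : R -> R -> R) (t : R) : plane_measurable h ->
  measurable_fun setT (h t).
Proof.
move=> mh; apply: (@plane_measurable_comp _ _ h (fun=> t) (fun x : R => x) mh) => //.
Qed.

End plane_measurable.

Section doubling_in_time.
Context {R : realType}.
Local Notation leb := (@lebesgue_measure R).
Local Notation bb := (@bump_bound R).
Variables (T A Lf K B W S Wl : R) (a f : R -> R).
Variables (w z N M N' M' l Lam : R -> R -> R).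
Hypotheses (K0 : 0 <= K) (B0 : 0 <= B).
Hypothesis fL : forall x y, `|f x - f y| <= Lf * `|x - y|.
Hypothesis f0 : f 0 = 0.
Hypothesis a_bound : forall x, 0 <= a x <= A.
Hypothesis ma : measurable_fun setT a.

Hypotheses (mw : plane_measurable w) (mz : plane_measurable z)
  (mN : plane_measurable N) (mM : plane_measurable M)
  (mN' : plane_measurable N') (mM' : plane_measurable M')
  (ml : plane_measurable l) (mLam : plane_measurable Lam).
Hypotheses (iw : forall t, L1 (w t)) (iz : forall t, L1 (z t))
  (wW : forall t, l1 (w t) <= W) (zW : forall t, l1 (z t) <= W).
Hypotheses (bw : {ae leb, forall t, 0 <= t <= T -> ess_bv B (w t)})
  (bz : {ae leb, forall t, 0 <= t <= T -> ess_bv B (z t)}).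
Hypotheses (NK : forall t x, `|N t x| <= K) (MK : forall t x, `|M t x| <= K)
  (N'K : forall t x, `|N' t x| <= K) (M'K : forall t x, `|M' t x| <= K).
Hypothesis ML : forall s x y, `|M s x - M s y| <= K * `|x - y|.
Hypothesis NM : forall t s x, `|N t x - M s x| <= K * l t s.
Hypothesis N'M' : forall t s x y, `|N' t x - M' s y| <= K * (l t s + `|x - y|).
Hypothesis l_bound : forall t s, 0 <= l t s <= Wl.
Hypothesis Lam_bound : forall t s, `|Lam t s| <= Wl.
Hypothesis LamE : forall t s, Lam t s = \int[leb]_x (a x * `|w t x - z s x|).
Hypothesis wz_l : forall t s, l1 (w t \- z s) <= S * l t s.

(** The integrand of the entropy inequality at the level alpha for the weighted
    unknown w, tested against a product: k, k' are the time factor and its derivative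
    and g, g' the space factor and its derivative. *)
Definition entropy_integrand (w N N' : R -> R -> R) (alpha k k' g g' t x : R) :=
  a x * `|w t x - alpha| * (k' * g) + kruzkov f (w t x) alpha * N t x * (k * g')
  - f alpha * Num.sg (w t x - alpha) * N' t x * (k * g).

Definition entropy_moll (w N N' : R -> R -> R) := forall alpha e r d y c,
  0 < e -> e < r -> r + e < T -> 0 < d -> 0 <= c ->
  0 <= \int[plane]_p (c * entropy_integrand w N N' alpha
    (moll e (p.1 - r)) (moll' e (p.1 - r)) (moll d (p.2 - y)) (moll' d (p.2 - y)) p.1 p.2).

Hypothesis entropy_w : entropy_moll w N N'.
Hypothesis entropy_z : entropy_moll z M M'.

Section fixed_widths.
Variables (e r d : R).
Hypotheses (e0 : 0 < e) (er : e < r) (rT : r + e < T) (d0 : 0 < d).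

(* G1 is the inequality for w at (t, x) with level z (s, y), G2 the inequality for z
   at (s, y) with level w (t, x); G is their sum, with the times grouped. *)
Let G1 (p : (R * R) * (R * R)) := moll e (p.2.1 - r) *
  entropy_integrand w N N' (z p.2.1 p.2.2) (moll e (p.1.1 - r)) (moll' e (p.1.1 - r))
    (moll d (p.1.2 - p.2.2)) (moll' d (p.1.2 - p.2.2)) p.1.1 p.1.2.

Let G2 (p : (R * R) * (R * R)) := moll e (p.1.1 - r) *
  entropy_integrand z M M' (w p.1.1 p.1.2) (moll e (p.2.1 - r)) (moll' e (p.2.1 - r))
    (moll d (p.2.2 - p.1.2)) (moll' d (p.2.2 - p.1.2)) p.2.1 p.2.2.

Let G (p : (R * R) * (R * R)) :=
  let t := p.1.1 in let s := p.1.2 in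
  let c1 := moll' e (t - r) * moll e (s - r) in
  let c2 := moll e (t - r) * moll' e (s - r) in
  let b := moll e (t - r) * moll e (s - r) in
  c1 * doubled_time1 d a (w t) (z s) p.2 + c2 * doubled_time2 d a (w t) (z s) p.2 +
  b * (doubled_flux d f (w t) (z s) (N t) (M s) p.2 -
       doubled_source d f (w t) (z s) (N' t) (M' s) p.2).

(* The space kernel is even, so its two derivatives are opposite and the fluxes
   combine into the difference of the velocities. *)
Let G12 p : G1 p + G2 p = G (interchange p).
Proof.
rewrite /G1 /G2 /G /interchange /entropy_integrand /doubled_time1 /doubled_time2
  /doubled_flux /doubled_source /=.
have -> : p.2.2 - p.1.2 = - (p.1.2 - p.2.2) by rewrite opprB.
rewrite mollN moll'N [kruzkov f (z _ _) _]kruzkovC [`|z _ _ - _|]distrC.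
rewrite -[z _ _ - w _ _]opprB sgrN; ring.
Qed.

Let GI p : G p = G1 (interchange p) + G2 (interchange p).
Proof. by rewrite G12; case: p => [[? ?] [? ?]]. Qed.

Let Lf0 : 0 <= Lf.
Proof. by have := le_trans (normr_ge0 _) (fL 1 0); rewrite subr0 normr1 mulr1. Qed.

Let f_le x : `|f x| <= Lf * `|x|.
Proof. by have := fL x 0; rewrite f0 !subr0. Qed.

Let integrand_le (v u : R) (P P' : R -> R -> R) (ww : R -> R -> R) k k' g g' t x (c1 c2 : R) :
  (forall t x, `|P t x| <= K) -> (forall t x, `|P' t x| <= K) ->
  ww t x = u -> `|k| <= c1 -> `|k'| <= c1 -> `|g| <= c2 -> `|g'| <= c2 ->
  `|entropy_integrand ww P P' v k k' g g' t x| <= (A + 2 * (Lf * K)) * (`|u| + `|v|) * (c1 * c2).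
Proof.
move=> PK P'K wu k1 k'1 g1 g'1.
have Q0 : 0 <= `|u| + `|v| by rewrite addr_ge0.
have uv : `|u - v| <= `|u| + `|v| by exact: ler_normB.
have pr k0 g0 : `|k0| <= c1 -> `|g0| <= c2 -> `|k0 * g0| <= c1 * c2.
  by move=> ? ?; rewrite normrM; apply: ler_pM.
rewrite /entropy_integrand wu.
have h1 : `|a x * `|u - v| * (k' * g)| <= A * (`|u| + `|v|) * (c1 * c2).
  rewrite normrM; apply: ler_pM => //; last exact: pr.
  rewrite normrM normr_id; apply: ler_pM => //.
  by have /andP[a1 a2] := a_bound x; rewrite ger0_norm.
have h2 : `|kruzkov f u v * P t x * (k * g')| <= (Lf * K) * (`|u| + `|v|) * (c1 * c2).
  rewrite normrM; apply: ler_pM => //; last exact: pr.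
  rewrite normrM -mulrA [K * _]mulrC mulrA; apply: ler_pM => //.
  by apply: le_trans (kruzkov_le fL _ _) _; exact: ler_wpM2l.
have h3 : `|f v * Num.sg (u - v) * P' t x * (k * g)| <= (Lf * K) * (`|u| + `|v|) * (c1 * c2).
  rewrite normrM; apply: ler_pM => //; last exact: pr.
  rewrite normrM -mulrA [K * _]mulrC mulrA; apply: ler_pM => //.
  rewrite normrM normr_sg; apply: (@le_trans _ _ `|f v|).
    by rewrite ler_piMr//; case: (_ != _).
  by apply: le_trans (f_le _) _; apply: ler_wpM2l => //; rewrite lerDr.
apply: le_trans (ler_normB _ _) _.
have := ler_normD (a x * `|u - v| * (k' * g)) (kruzkov f u v * P t x * (k * g')).
set D := c1 * c2 in h1 h2 h3 *; set Q := `|u| + `|v| in h1 h2 h3 *.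
have -> : (A + 2 * (Lf * K)) * Q * D = A * Q * D + Lf * K * Q * D + Lf * K * Q * D by ring.
lra.
Qed.

Let Q := (A + 2 * (Lf * K)) * (width_bound e ^+ 2 * width_bound d).

Let bound p := Q * ((`|w p.1.1 p.1.2| + `|z p.2.1 p.2.2|) * quad_window e d r p).

Let G1_le p : `|G1 p| <= bound p.
Proof.
rewrite normrM; have [k1 k2] := moll_near_width e0 p.1.1 r; have [k3 _] := moll_near_width e0 p.2.1 r.
have [g1 g2] := moll_near_width d0 p.1.2 p.2.2.
have h := integrand_le (z p.2.1 p.2.2) NK N'K (erefl (w p.1.1 p.1.2)) k1 k2 g1 g2.
apply: le_trans (ler_pM _ _ k3 h) _ => //.
rewrite /bound /quad_window /Q le_eqVlt; apply/orP; left; apply/eqP.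
set n1 := near_diag _ _; set n2 := near_diag _ _; set n3 := near_diag _ _; ring.
Qed.

Let G2_le p : `|G2 p| <= bound p.
Proof.
rewrite normrM; have [k1 k2] := moll_near_width e0 p.2.1 r; have [k3 _] := moll_near_width e0 p.1.1 r.
have [g1 g2] := moll_near_width d0 p.2.2 p.1.2.
have h := integrand_le (w p.1.1 p.1.2) MK M'K (erefl (z p.2.1 p.2.2)) k1 k2 g1 g2.
apply: le_trans (ler_pM _ _ k3 h) _ => //.
rewrite /bound /quad_window /Q le_eqVlt; apply/orP; left; apply/eqP.
rewrite [near_diag d (p.2.2, _)]near_diag_sym.
set n1 := near_diag _ _; set n2 := near_diag _ _; set n3 := near_diag _ _; ring.
Qed.

Let bound_integrable : quad.-integrable setT (EFin \o bound).
Proof.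
apply: integrable_scale.
rewrite (_ : (fun p => _) = (fun p => `|w p.1.1 p.1.2| * quad_window e d r p +
    `|z p.2.1 p.2.2| * quad_window e d r p)); last by apply/funext => p; ring.
apply: (@integrable_add _ _ _ quad); first exact: (quad_integrable_window mw iw wW).
have := quad_integrable_swap (quad_integrable_window mz iz zW r e0 d0).
congr (quad.-integrable setT (EFin \o _)); apply/funext => p /=.
rewrite /quad_window/= [near_diag d _]near_diag_sym; congr (_ * _); ring.
Qed.

Let integrand_measurable d' (X : measurableType d') (ww P P' : R -> R -> R)
    (al k k' g g' t x : X -> R) :
  plane_measurable ww -> plane_measurable P -> plane_measurable P' ->
  measurable_fun setT al -> measurable_fun setT k -> measurable_fun setT k' ->
  measurable_fun setT g -> measurable_fun setT g' -> measurable_fun setT t ->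
  measurable_fun setT x ->
  measurable_fun setT (fun i => entropy_integrand ww P P' (al i) (k i) (k' i) (g i) (g' i)
     (t i) (x i)).
Proof.
move=> mww mP mP' mal mk mk' mg mg' mt mx.
have mf : measurable_fun setT f := lipschitz_measurable fL.
have c2 (h : R -> R -> R) : plane_measurable h -> measurable_fun setT (fun i => h (t i) (x i)).
  by move=> mh; exact: plane_measurable_comp.
have msg (u v : X -> R) : measurable_fun setT u -> measurable_fun setT v ->
    measurable_fun setT (fun i => Num.sg (u i - v i)).
  by move=> mu mv; apply: (measurableT_comp measurable_sgr); exact: measurable_funB.
have mfc (u : X -> R) : measurable_fun setT u -> measurable_fun setT (fun i => f (u i)).
  by move=> mu; exact: (measurableT_comp mf).
have mw' := c2 _ mww; have mP1 := c2 _ mP; have mP'1 := c2 _ mP'.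
apply: measurable_funB.
  apply: measurable_funD; apply: measurable_funM.
  - apply: measurable_funM; first exact: (measurableT_comp ma).
    by apply: measurableT_comp => //; exact: measurable_funB.
  - exact: measurable_funM.
  - apply: measurable_funM => //; apply: measurable_funM; first exact: msg.
    by apply: measurable_funB; exact: mfc.
  - exact: measurable_funM.
apply: measurable_funM; last exact: measurable_funM.
apply: measurable_funM => //; apply: measurable_funM; first exact: mfc.
exact: msg.
Qed.

Let mmoll d' (X : measurableType d') (c : R) (u v : X -> R) :
  measurable_fun setT u -> measurable_fun setT v ->
  measurable_fun setT (fun i => moll c (u i - v i)).
Proof. by move=> mu mv; apply: (measurableT_comp (measurable_moll c)); exact: measurable_funB. Qed.

Let mmoll' d' (X : measurableType d') (c : R) (u v : X -> R) :
  measurable_fun setT u -> measurable_fun setT v ->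
  measurable_fun setT (fun i => moll' c (u i - v i)).
Proof. by move=> mu mv; apply: (measurableT_comp (measurable_moll' c)); exact: measurable_funB. Qed.

Let m11 : measurable_fun setT (fun p : (R * R) * (R * R) => p.1.1).
Proof. by apply: measurableT_comp. Qed.
Let m12 : measurable_fun setT (fun p : (R * R) * (R * R) => p.1.2).
Proof. by apply: measurableT_comp. Qed.
Let m21 : measurable_fun setT (fun p : (R * R) * (R * R) => p.2.1).
Proof. by apply: measurableT_comp. Qed.
Let m22 : measurable_fun setT (fun p : (R * R) * (R * R) => p.2.2).
Proof. by apply: measurableT_comp. Qed.

Let G1_measurable : measurable_fun setT G1.
Proof.
have mr : measurable_fun setT (fun _ : (R * R) * (R * R) => r) by exact: measurable_cst.
apply: measurable_funM; first exact: mmoll.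
apply: integrand_measurable => //; try exact: mmoll; try exact: mmoll'.
exact: plane_measurable_comp.
Qed.

Let G2_measurable : measurable_fun setT G2.
Proof.
have mr : measurable_fun setT (fun _ : (R * R) * (R * R) => r) by exact: measurable_cst.
apply: measurable_funM; first exact: mmoll.
apply: integrand_measurable => //; try exact: mmoll; try exact: mmoll'.
exact: plane_measurable_comp.
Qed.

Let iG1 : quad.-integrable setT (EFin \o G1) :=
  quad_dominated G1_measurable G1_le bound_integrable.
Let iG2 : quad.-integrable setT (EFin \o G2) :=
  quad_dominated G2_measurable G2_le bound_integrable.

Let G1_ge0 : 0 <= \int[quad]_p G1 p.
Proof.
rewrite (quad_fubini2 iG1); apply: Rintegral_ge0 => q _.
exact: (entropy_w (z q.1 q.2) q.2 e0 er rT d0 (moll_ge0 e0 (q.1 - r))).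
Qed.

Let G2_ge0 : 0 <= \int[quad]_p G2 p.
Proof.
rewrite (quad_fubini iG2); apply: Rintegral_ge0 => p _.
exact: (entropy_z (w p.1 p.2) p.2 e0 er rT d0 (moll_ge0 e0 (p.1 - r))).
Qed.

Let iG : quad.-integrable setT (EFin \o G).
Proof.
rewrite (_ : G = (fun p => G1 (interchange p) + G2 (interchange p))).
  by apply: (@integrable_add _ _ _ quad); exact: quad_integrable_interchange.
by apply/funext => p; exact: GI.
Qed.

Let G_ge0 : 0 <= \int[plane]_p \int[plane]_q G (p, q).
Proof.
rewrite -(quad_fubini iG) (_ : G = (fun p => G1 (interchange p) + G2 (interchange p))).
  rewrite RintegralD//; try exact: quad_integrable_interchange.
  by rewrite (quad_interchange G1_measurable) (quad_interchange G2_measurable) addr_ge0.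
by apply/funext => p; exact: GI.
Qed.

Let C0 := bb * Lf * K * (4 + 8 * B + 2 * W).

Let majorant (p : R * R) :=
  (moll' e (p.1 - r) * moll e (p.2 - r) + moll e (p.1 - r) * moll' e (p.2 - r)) * Lam p.1 p.2 +
  C0 * (S + 1) * (l p.1 p.2 * (moll e (p.1 - r) * moll e (p.2 - r))) +
  d * (4 * A * bb * B * (`|moll' e (p.1 - r) * moll e (p.2 - r)| +
         `|moll e (p.1 - r) * moll' e (p.2 - r)|) +
       C0 * (moll e (p.1 - r) * moll e (p.2 - r))).

(* Outside of the window both sides vanish; inside it the times lie in [0, T], where
   almost every slice has bounded variation. *)
Let inner_le : {ae plane, forall p, \int[plane]_q G (p, q) <= majorant p}.
Proof.
have h := ae_and (plane_ae1 bw) (plane_ae2 bz); apply: ae_mono h => p [bwp bzp].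
have C00 : 0 <= C0.
  have W0 : 0 <= W := le_trans (l1_ge0 _) (wW 0).
  have b0 := @bump_bound_gt0 R.
  by rewrite /C0 mulr_ge0// ?addr_ge0// ?mulr_ge0// ltW.
have out : e <= `|p.1 - r| \/ e <= `|p.2 - r| -> \int[plane]_q G (p, q) <= majorant p.
  move=> eo; have [k [k1 k2]] : moll e (p.1 - r) * moll e (p.2 - r) = 0 /\
      moll' e (p.1 - r) * moll e (p.2 - r) = 0 /\ moll e (p.1 - r) * moll' e (p.2 - r) = 0.
    by case: eo => eo; rewrite (moll_out e0 eo) (moll'_out e0 eo) ?mul0r ?mulr0.
  rewrite (_ : Rintegral _ _ _ = \int[plane]_q ((fun=> 0) q : R)).
    by rewrite /Rintegral integral0 /majorant k k1 k2 normr0 !(addr0, mul0r, mulr0).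
  by apply: eq_Rintegral => q _; rewrite /G/= k k1 k2 !mul0r !addr0.
case: (leP e `|p.1 - r|) => [?|pr1]; first by apply: out; left.
case: (leP e `|p.2 - r|) => [?|pr2]; first by apply: out; right.
have inT (t : R) : `|t - r| < e -> 0 <= t <= T.
  rewrite ltr_distl => /andP[tr rt]; rewrite (le_trans _ (ltW tr)) ?subr_ge0 ?(ltW er)//=.
  exact: le_trans (ltW rt) (ltW rT).
have bwt : ess_bv B (w p.1) := bwp (inT _ pr1).
have bzs : ess_bv B (z p.2) := bzp (inT _ pr2).
have ms := @plane_measurable_section R.
have /andP[l0 lW] := l_bound p.1 p.2.
have b0 : 0 <= moll e (p.1 - r) * moll e (p.2 - r) by rewrite mulr_ge0 ?moll_ge0.
have [_] := doubling_in_space d0 K0 l0 fL f0 a_bound ma (ms _ p.1 mN) (ms _ p.2 mM)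
  (ms _ p.1 mN') (ms _ p.2 mM') (iw p.1) (iz p.2) bwt bzs (wW p.1) (ML p.2)
  (NM p.1 p.2) (N'K p.1) (N'M' p.1 p.2)
  (moll' e (p.1 - r) * moll e (p.2 - r)) (moll e (p.1 - r) * moll' e (p.2 - r)) b0.
rewrite -LamE => h; apply: le_trans h _; rewrite -/C0 /majorant.
have h2 := wz_l p.1 p.2.
have h3 : C0 * (l1 (w p.1 \- z p.2) + l p.1 p.2 + d) <= C0 * ((S + 1) * l p.1 p.2 + d).
  by apply: ler_wpM2l => //; rewrite lerD2r mulrDl mul1r lerD2r.
have h4 := ler_wpM2l b0 h3; lra.
Qed.

Let ik : plane.-integrable setT (EFin \o (fun p : R * R => moll e (p.1 - r) * moll e (p.2 - r))).
Proof. exact: (plane_integrable_tensor (L1_moll_shift e0 r) (L1_moll_shift e0 r)). Qed.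
Let ik1 : plane.-integrable setT (EFin \o (fun p : R * R => moll' e (p.1 - r) * moll e (p.2 - r))).
Proof. exact: (plane_integrable_tensor (L1_moll'_shift e0 r) (L1_moll_shift e0 r)). Qed.
Let ik2 : plane.-integrable setT (EFin \o (fun p : R * R => moll e (p.1 - r) * moll' e (p.2 - r))).
Proof. exact: (plane_integrable_tensor (L1_moll_shift e0 r) (L1_moll'_shift e0 r)). Qed.

Lemma doubling_at_width : 0 <=
  \int[plane]_p ((moll' e (p.1 - r) * moll e (p.2 - r) + moll e (p.1 - r) * moll' e (p.2 - r))
     * Lam p.1 p.2) +
  C0 * (S + 1) * \int[plane]_p (l p.1 p.2 * (moll e (p.1 - r) * moll e (p.2 - r))) +
  d * \int[plane]_p (4 * A * bb * B * (`|moll' e (p.1 - r) * moll e (p.2 - r)| +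
         `|moll e (p.1 - r) * moll' e (p.2 - r)|) +
       C0 * (moll e (p.1 - r) * moll e (p.2 - r))).
Proof.
pose g1 (p : R * R) := (moll' e (p.1 - r) * moll e (p.2 - r) +
  moll e (p.1 - r) * moll' e (p.2 - r)) * Lam p.1 p.2.
pose g2 (p : R * R) := l p.1 p.2 * (moll e (p.1 - r) * moll e (p.2 - r)).
pose g3 (p : R * R) := 4 * A * bb * B * (`|moll' e (p.1 - r) * moll e (p.2 - r)| +
  `|moll e (p.1 - r) * moll' e (p.2 - r)|) + C0 * (moll e (p.1 - r) * moll e (p.2 - r)).
have i1 : plane.-integrable setT (EFin \o g1).
  rewrite (_ : g1 = (fun p => Lam p.1 p.2 * (moll' e (p.1 - r) * moll e (p.2 - r) +
    moll e (p.1 - r) * moll' e (p.2 - r)))); last by apply/funext => p; rewrite mulrC.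
  apply: (@integrable_bounded_mul _ _ _ plane Wl (fun p => Lam p.1 p.2)) => //.
  exact: integrable_add.
have i2 : plane.-integrable setT (EFin \o g2).
  apply: (@integrable_bounded_mul _ _ _ plane Wl (fun p => l p.1 p.2)) => //.
  by move=> p; have /andP[l0 lW] := l_bound p.1 p.2; rewrite ger0_norm.
have i3 : plane.-integrable setT (EFin \o g3).
  apply: (@integrable_add _ _ _ plane); apply: (@integrable_scale _ _ _ plane) => //.
  by apply: (@integrable_add _ _ _ plane); exact: integrable_abs.
have i2' := integrable_scale (C0 * (S + 1)) i2; have i3' := integrable_scale d i3.
have i12 := integrable_add i1 i2'; have im := integrable_add i12 i3'.
have := le_trans G_ge0 (ae_le_Rintegral (quad_fubini_integrable iG) im inner_le).
by rewrite RintegralD// RintegralD// !RintegralZl.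
Qed.

End fixed_widths.

(** The remainder of doubling_at_width is proportional to the width d in space, and
    the two other terms do not depend on d. *)
Lemma doubling_in_time e r : 0 < e -> e < r -> r + e < T -> 0 <=
  \int[plane]_p ((moll' e (p.1 - r) * moll e (p.2 - r) + moll e (p.1 - r) * moll' e (p.2 - r))
     * Lam p.1 p.2) +
  bb * Lf * K * (4 + 8 * B + 2 * W) * (S + 1) *
    \int[plane]_p (l p.1 p.2 * (moll e (p.1 - r) * moll e (p.2 - r))).
Proof.
move=> e0 er rT; set P := _ + _; rewrite leNgt; apply/negP => P0.
have h d : 0 < d -> _ := fun d0 => doubling_at_width e0 er rT d0.
move: h; rewrite -/P; set Q := \int[plane]_p (_ + _) => h.
have Q1 : 0 < `|Q| + 1 by rewrite ltr_wpDl.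
have /h : 0 < - P / (2 * (`|Q| + 1)) by rewrite divr_gt0 ?oppr_gt0 ?mulr_gt0.
set d := _ / _ => dP.
have dQ : d * Q <= - P / 2.
  apply: (@le_trans _ _ (d * (`|Q| + 1))).
    rewrite ler_wpM2l ?divr_ge0 ?oppr_ge0 ?mulr_ge0 ?ltW//.
    by rewrite (le_lt_trans (ler_norm _))// ltrDl.
  rewrite /d le_eqVlt; apply/orP; left; apply/eqP; field; exact: lt0r_neq0.
lra.
Qed.

End doubling_in_time.

(** * From the doubled inequality to a Gronwall estimate *)

(** L t s is the distance between one solution at time t and the other at time s. *)
Section gronwall.
Context {R : realType}.
Local Notation leb := (@lebesgue_measure R).
Local Notation bb := (@bump_bound R).
Variables (T C W : R) (L : R -> R -> R).
Hypotheses (C0 : 0 <= C) (mL : plane_measurable L).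
Hypothesis LW : forall t s, `|L t s| <= W.
Hypothesis L_ge0 : forall t s, 0 <= L t s.
Hypothesis L_cont : forall r eta, 0 < eta -> exists2 del, 0 < del &
  forall t s, `|t - r| <= del -> `|s - r| <= del -> `|L t s - L r r| <= eta.
Hypothesis L_ineq : forall e r, 0 < e -> e < r -> r + e < T -> 0 <=
  \int[plane]_p ((moll' e (p.1 - r) * moll e (p.2 - r) + moll e (p.1 - r) * moll' e (p.2 - r))
     * L p.1 p.2) +
  C * \int[plane]_p (L p.1 p.2 * (moll e (p.1 - r) * moll e (p.2 - r))).

Section width.
Variables (e : R) (e0 : 0 < e).

(** L is merely continuous, but its average over a window around (r, r) is
    differentiable in r, and the doubled inequality is a differential inequality for
    this average. *)
Definition averaged_gap (r : R) :=
  \int[plane]_p (L p.1 p.2 * (moll e (p.1 - r) * moll e (p.2 - r))).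

Let ik r : plane.-integrable setT (EFin \o (fun p : R * R => moll e (p.1 - r) * moll e (p.2 - r))).
Proof. exact: (plane_integrable_tensor (L1_moll_shift e0 r) (L1_moll_shift e0 r)). Qed.

Let iLk r : plane.-integrable setT
  (EFin \o (fun p : R * R => L p.1 p.2 * (moll e (p.1 - r) * moll e (p.2 - r)))).
Proof.
by apply: (@integrable_bounded_mul _ _ _ plane W (fun p => L p.1 p.2)).
Qed.

Let slope (r : R) (p : R * R) :=
  (moll' e (p.1 - r) * moll e (p.2 - r) + moll e (p.1 - r) * moll' e (p.2 - r)) * L p.1 p.2.

Let islope r : plane.-integrable setT (EFin \o slope r).
Proof.
rewrite (_ : slope r = (fun p => L p.1 p.2 * (moll' e (p.1 - r) * moll e (p.2 - r) +
    moll e (p.1 - r) * moll' e (p.2 - r)))); last by apply/funext => p; rewrite mulrC.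
apply: (@integrable_bounded_mul _ _ _ plane W (fun p => L p.1 p.2)) => //.
apply: (@integrable_add _ _ _ plane).
  exact: (plane_integrable_tensor (L1_moll'_shift e0 r) (L1_moll_shift e0 r)).
exact: (plane_integrable_tensor (L1_moll_shift e0 r) (L1_moll'_shift e0 r)).
Qed.

Let dmoll (t r : R) : is_derive r 1 (fun r => moll e (t - r)) (- moll' e (t - r)).
Proof.
have := is_derive_moll_affine e (-1) t r; rewrite mulN1r (_ : -1 * r + t = t - r); last by ring.
by under eq_fun do rewrite mulN1r addrC.
Qed.

Let dgap (p : R * R) (r : R) : is_derive r 1
  (fun r => L p.1 p.2 * (moll e (p.1 - r) * moll e (p.2 - r))) (- slope r p).
Proof.
apply: is_derive_eq (is_deriveM (is_derive_cst (L p.1 p.2) r 1)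
  (is_deriveM (dmoll p.1 r) (dmoll p.2 r))) _.
by rewrite scaler0 addr0 /GRing.scale/= /slope; ring.
Qed.

Let far_window (r z t : R) : r - 1 < z < r + 1 -> e + 1 < `|r - t| -> e <= `|t - z|.
Proof.
move=> /andP[z1 z2] rt; have := ler_distD z r t; rewrite [`|z - t|]distrC.
have : `|r - z| <= 1 by rewrite ler_distl; apply/andP; split; lra.
lra.
Qed.

(** Only the kernels depend on r; for r in an interval of length 2 they are bounded and
    supported in a common box. *)
Lemma is_derive_averaged_gap (r : R) :
  is_derive r 1 averaged_gap (- \int[plane]_p slope r p).
Proof.
pose f (r : R) (p : R * R) := L p.1 p.2 * (moll e (p.1 - r) * moll e (p.2 - r)).
have rI : `]r - 1, r + 1[%classic r by rewrite /= in_itv/=; apply/andP; split; lra.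
have i1 z : `]r - 1, r + 1[%classic z -> plane.-integrable setT (EFin \o f z).
  by move=> _; exact: iLk.
have i2 z p : `]r - 1, r + 1[%classic z -> [set: R * R] p -> derivable (f^~ p) z 1.
  by move=> _ _; have [] := dgap p z.
pose Q := W * (2 * (bb / e ^+ 2 * (bb / e))).
have W0 : 0 <= W := le_trans (normr_ge0 _) (LW 0 0).
have b0 := @bump_bound_gt0 R.
have q0 : 0 <= bb / e ^+ 2 * (bb / e) by rewrite mulr_ge0// divr_ge0 ?exprn_ge0// ltW.
have Q0 : 0 <= Q by rewrite mulr_ge0// mulr_ge0.
pose g (p : R * R) := Q * (near_diag (e + 1) (r, p.1) * near_diag (e + 1) (r, p.2)).
have e1 : 0 < e + 1 by rewrite addr_gt0.
have g0 p : 0 <= g p.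
  by apply: mulr_ge0 => //; apply: mulr_ge0; exact: near_diag_ge0.
have ig : plane.-integrable setT (EFin \o g).
  apply: (@integrable_scale _ _ _ plane).
  exact: (@plane_integrable_tensor _ (fun t => near_diag (e + 1) (r, t))
    (fun t => near_diag (e + 1) (r, t)) (L1_near_diag e1 r) (L1_near_diag e1 r)).
have E z p : partial1of2 f z p = - slope z p.
  by rewrite /partial1of2 derive1E; have [] := dgap p z.
have gB z p : `]r - 1, r + 1[%classic z -> [set: R * R] p -> `|partial1of2 f z p| <= g p.
  rewrite /= in_itv/= => zr _; rewrite E normrN /slope /g normrM.
  have far t : near_diag (e + 1) (r, t) = 0 -> moll e (t - z) = 0 /\ moll' e (t - z) = 0.
    rewrite /near_diag/=; case: (leP `|r - t|) => [_ /eqP|rt _]; first by rewrite oner_eq0.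
    have et := far_window zr rt.
    by rewrite (moll_out e0 et) (moll'_out e0 et).
  have n01 t : near_diag (e + 1) (r, t) = 0 \/ near_diag (e + 1) (r, t) = 1.
    by rewrite /near_diag; case: (_ <= _); [right|left].
  case: (n01 p.1) => [n1|n1].
    by have [-> ->] := far _ n1; rewrite !mul0r addr0 normr0 mul0r -/(g p) g0.
  case: (n01 p.2) => [n2|n2].
    by have [-> ->] := far _ n2; rewrite !mulr0 addr0 normr0 mul0r -/(g p) g0.
  rewrite n1 n2 !mulr1 /Q mulrC; apply: ler_pM => //.
  apply: le_trans (ler_normD _ _) _; rewrite [X in X + _]normrM [X in _ + X]normrM (_ : 2 * _ = bb / e ^+ 2 * (bb / e) +
    bb / e * (bb / e ^+ 2)); last by ring.
  by apply: lerD; apply: ler_pM => //; do 1?[exact: le_moll|exact: le_moll'].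
split; first exact: (derivable_under_integral measurableT rI i1 i2 g0 ig gB).
rewrite -derive1E.
have := differentiation_under_integral measurableT rI i1 i2 g0 ig gB.
rewrite /averaged_gap => ->.
rewrite (_ : - _ = \int[plane]_p (-1 * slope r p)); last first.
  by rewrite RintegralZl ?mulN1r//; exact: islope.
by apply: eq_Rintegral => p _; rewrite E mulN1r.
Qed.

Lemma integral_moll_moll r : \int[plane]_p (moll e (p.1 - r) * moll e (p.2 - r)) = 1.
Proof.
rewrite plane_fubini// -[RHS](integral_moll_shift e0 r); apply: eq_Rintegral => t _ /=.
by rewrite RintegralZl//; [rewrite integral_moll_shift// mulr1|exact: L1_moll_shift].
Qed.

Lemma averaged_gap_close r eta :
  (forall t s, `|t - r| <= e -> `|s - r| <= e -> `|L t s - L r r| <= eta) ->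
  `|averaged_gap r - L r r| <= eta.
Proof.
move=> h; pose k (p : R * R) := moll e (p.1 - r) * moll e (p.2 - r).
have k0 p : 0 <= k p by rewrite mulr_ge0// moll_ge0.
have iLr : plane.-integrable setT (EFin \o (fun p => L r r * k p)) by exact: (integrable_scale (L r r) (ik r)).
have iLd : plane.-integrable setT (EFin \o (fun p => L p.1 p.2 * k p - L r r * k p)).
  exact: (integrable_sub (iLk r) iLr).
have E : averaged_gap r - L r r = \int[plane]_p (L p.1 p.2 * k p - L r r * k p).
  rewrite RintegralB//; last exact: iLk.
  by rewrite RintegralZl ?integral_moll_moll ?mulr1//; exact: ik.
rewrite E; apply: (le_trans (le_normr_Rintegral _ _)) => //.
have -> : eta = \int[plane]_p (eta * k p).
  by rewrite RintegralZl ?integral_moll_moll ?mulr1//; exact: ik.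
apply: le_Rintegral => //.
- exact: integrable_abs.
- by apply: (@integrable_scale _ _ _ plane); exact: ik.
move=> p _; rewrite -mulrBl normrM (ger0_norm (k0 p)).
have out : e < `|p.1 - r| \/ e < `|p.2 - r| -> k p = 0.
  by rewrite /k; case=> /ltW eo; rewrite (moll_out e0 eo) ?mul0r ?mulr0.
case: (leP `|p.1 - r| e) => p1; last by rewrite out ?mulr0//; left.
case: (leP `|p.2 - r| e) => p2; last by rewrite out ?mulr0//; right.
by apply: ler_wpM2r => //; exact: h.
Qed.

(** The derivative of averaged_gap is at most C times averaged_gap, so
    exp (- C r) averaged_gap r does not increase. *)
Lemma averaged_gap_decay r1 r2 : e < r1 -> r1 <= r2 -> r2 + e < T ->
  averaged_gap r2 <= expR (C * (r2 - r1)) * averaged_gap r1.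
Proof.
move=> er1 r12 r2T.
pose g (r : R) := expR (- C * r) * averaged_gap r.
pose g' (r : R) := expR (- C * r) * (- C * averaged_gap r - \int[plane]_p slope r p).
have dg (r : R) : is_derive r 1 g (g' r).
  have dl : is_derive r 1 (fun r => - C * r) (- C).
    apply: is_derive_eq (is_deriveM (is_derive_cst (- C) r 1) (is_derive_id r 1)) _.
    by rewrite scaler0 addr0 /GRing.scale/= mulr1.
  have de := is_derive1_comp (is_derive_expR (- C * r)) dl.
  apply: is_derive_eq (is_deriveM de (is_derive_averaged_gap r)) _.
  by rewrite /GRing.scale/= /g'; ring.
have cg : {within `[r1, r2], continuous g}.
  by apply: continuous_subspaceT => x; exact: is_derive1_continuous (dg x).
have [c c12 gE] := @MVT_segment _ g g' r1 r2 r12 (fun x _ => dg x) cg.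
have : g r2 <= g r1.
  rewrite -subr_le0 gE mulr_le0_ge0 ?subr_ge0//.
  move: c12; rewrite in_itv/= => /andP[c1 c2].
  rewrite /g' mulr_ge0_le0 ?expR_ge0// subr_le0.
  have := L_ineq e0 (lt_le_trans er1 c1) (le_lt_trans (lerD c2 (lexx e)) r2T).
  by rewrite -/(averaged_gap c) -/(slope c) mulNr -subr_ge0 opprK.
rewrite /g; move: (averaged_gap r2) (averaged_gap r1) => u2 u1 h.
have := ler_wpM2l (expR_ge0 (C * r2)) h; clear g g' dg cg gE h.
have E1 : expR (C * r2) * expR (- C * r2) = 1 by rewrite mulNr expRN divff// gt_eqF// expR_gt0.
have E2 : expR (C * r2) * expR (- C * r1) = expR (C * (r2 - r1)).
  by rewrite -expRD; congr expR; ring.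
by rewrite mulrA E1 mul1r mulrA E2.
Qed.

End width.

Let window_arithmetic (t q e : R) : 0 < t -> t <= T -> 0 < q -> q <= t / 3 -> 0 < e ->
  e <= q / 2 -> [/\ e < q, q <= t - q & t - q + e < T].
Proof. by move=> *; split; lra. Qed.

Let twice (x y z eta : R) : x <= y + eta -> y <= z + eta -> x <= z + 2 * eta.
Proof. by move=> *; lra. Qed.

(* The window has to stay inside (0, T): the decay is used from q to t - q, and the
   continuity of L accounts for both ends. *)
Let decay_up_to (t eta : R) : 0 < t -> t <= T -> 0 < eta ->
  L t t <= expR (C * t) * (L 0 0 + 2 * eta) + 2 * eta.
Proof.
move=> t0 tT eta0.
have [d0 d00 h0] := L_cont 0 eta0.
have [dt dt0 ht] := L_cont t eta0.
have [q [q0 qd0 qdt qt]] : exists q, [/\ 0 < q, q <= d0, q <= dt & q <= t / 3].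
  exists (Num.min (Num.min d0 dt) (t / 3)).
  by rewrite !lt_min d00 dt0/= divr_gt0// !ge_min !lexx !orbT.
have [e1 e10 h1] := L_cont q eta0; have [e2 e20 h2] := L_cont (t - q) eta0.
have [e [e0 ee1 ee2 eq]] : exists e, [/\ 0 < e, e <= e1, e <= e2 & e <= q / 2].
  exists (Num.min (Num.min e1 e2) (q / 2)).
  by rewrite !lt_min e10 e20/= divr_gt0// !ge_min !lexx !orbT.
have [er1 r12 r2T] := window_arithmetic t0 tT q0 qt e0 eq.
have D := averaged_gap_decay e0 er1 r12 r2T.
have c1 : `|averaged_gap e q - L q q| <= eta.
  by apply: averaged_gap_close => // u v ue ve; apply: h1; exact: le_trans ee1.
have c2 : `|averaged_gap e (t - q) - L (t - q) (t - q)| <= eta.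
  by apply: averaged_gap_close => // u v ue ve; apply: h2; exact: le_trans ee2.
have l1 : `|L q q - L 0 0| <= eta.
  by apply: h0; rewrite subr0 gtr0_norm.
have l2 : `|L (t - q) (t - q) - L t t| <= eta.
  by apply: ht; rewrite addrAC subrr add0r normrN gtr0_norm.
have E1 : expR (C * (t - q - q)) <= expR (C * t).
  by rewrite ler_expR ler_wpM2l// -addrA gerDl -opprD oppr_le0 addr_ge0// ltW.
move: c1 c2 l1 l2; rewrite !ler_distl => /andP[c1 c1'] /andP[c2 c2'] /andP[l1 l1'] /andP[l2 l2'].
have a1 := twice c1' l1'.
have a2 := ler_wpM2l (expR_ge0 (C * (t - q - q))) a1.
have p0 : 0 <= L 0 0 + 2 * eta by rewrite addr_ge0// mulr_ge0// ltW.
have a3 := ler_wpM2r p0 E1.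
apply: (le_trans (twice _ _)); [rewrite -lerBlDr; exact: l2|rewrite -lerBlDr; exact: c2|].
by rewrite lerD2r (le_trans D)// (le_trans a2).
Qed.

Lemma gronwall t : 0 <= t <= T -> L t t <= expR (C * t) * L 0 0.
Proof.
move=> /andP[]; rewrite le_eqVlt => /orP[/eqP <- _|t0 tT].
  by rewrite mulr0 expR0 mul1r.
apply/ler_addgt0Pl => eta eta0.
have E0 : 0 < 2 * (expR (C * t) + 1) by rewrite mulr_gt0// addr_gt0// expR_gt0.
have := decay_up_to t0 tT (divr_gt0 eta0 E0).
set x := eta / _ => h; have Ex : 2 * (expR (C * t) + 1) * x = eta.
  by rewrite /x mulrC divfK// lt0r_neq0.
by apply: (le_trans h); rewrite -Ex; set E := expR _; rewrite le_eqVlt; apply/orP; left; apply/eqP; ring.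
Qed.

End gronwall.

(** * Curves in L1 frozen outside the time interval *)

Section hypotheses_made_explicit.
Context {R : realType}.
Local Notation leb := (@lebesgue_measure R).

Lemma lipschitz_bound (g : R -> R) : [lipschitz g x | x in [set: R]] ->
  exists2 L, 0 < L & forall x y, `|g x - g y| <= L * `|x - y|.
Proof.
move=> [M [_ HM]]; exists (Num.max 1 (M + 1)); first by rewrite lt_max ltr01.
move=> x y; have := HM (Num.max 1 (M + 1)); rewrite lt_max ltrDl ltr01 orbT.
by move=> /(_ isT (x, y)); apply.
Qed.

Lemma BV_line_majorant (g : R -> R) : BV_line g ->
  exists B G, variation_majorant B G g.
Proof.
move=> bg; have g0 : (0 <= variation_line g)%E.
  apply: ereal_sup_ubound; exists (0, 0); first by rewrite /=.
  by rewrite total_variationxx.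
exists (fine (variation_line g)); apply: variation_majorant_ex.
by rewrite fineK// ge0_fin_numE.
Qed.

Lemma positive_inf_bound (g : R -> R) : 0 < inf (range g) -> forall x, inf (range g) <= g x.
Proof.
move=> i0 x; apply: ge_inf; last by exists x.
apply: contrapT => ni; move: i0; rewrite inf_out ?ltxx// => -[_ h]; exact: ni.
Qed.

Lemma L1norm_l1 (u : R -> R) : L1 u -> L1norm u = (l1 u)%:E.
Proof.
move=> iu; rewrite /L1norm Lnorm1 /l1 /Rintegral fineK//.
by apply: integrable_fin_num => //; exact: L1_abs.
Qed.

(** An integrable function cannot stay away from 0, and its values differ by at most
    its variation. *)
Lemma variation_majorant_bound B G (g : R -> R) : variation_majorant B G g -> L1 g ->
  forall x, `|g x| <= B.
Proof.
move=> vg ig x; rewrite leNgt; apply/negP => Bx.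
have low y : `|g x| - B <= `|g y|.
  rewrite lerBlDr -lerBlDl; apply: le_trans (variation_majorant_osc x y vg).
  exact: lerB_dist.
have c0 : 0 < `|g x| - B by rewrite subr_gt0.
have mg := integrable_real_measurable ig.
have : (\int[leb]_y (cst (`|g x| - B)%:E y) <= \int[leb]_y `|g y|%:E)%E.
  apply: ge0_le_integral => //.
  - by move=> y _; rewrite lee_fin ltW.
  - by apply/measurable_EFinP; apply: measurableT_comp.
  - by move=> y _; rewrite lee_fin.
rewrite integral_cst// [X in (_ * X)%E](_ : _ = +oo%E); last first.
  by rewrite -set_itvNyy -[LHS]/(lebesgue_measure _) lebesgue_measure_itv.
rewrite gt0_muley ?lte_fin// leye_eq => /eqP E.
by have := integrable_fin_num measurableT (L1_abs ig); rewrite /= E.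
Qed.

Lemma ess_bv_of_ess_variation (M S V : R) (u sig Sg : R -> R) :
  L1 u -> ess_variation_le M u -> variation_majorant V Sg sig ->
  (forall x, `|sig x| <= S) -> ess_bv (S * M + M * V) (fun x => sig x * u x).
Proof.
move=> iu [v [vu vM]] vsig sS.
have [G vG] := variation_majorant_ex vM.
have mv := variation_majorant_measurable vG.
have iv : L1 v.
  apply/integrableP; split; first exact/measurable_EFinP.
  have /integrableP[_] := iu; congr (_ < _)%E.
  apply: ge0_ae_eq_integral => //.
  - by apply/measurable_EFinP; apply: measurableT_comp => //; exact: integrable_real_measurable iu.
  - by apply/measurable_EFinP; apply: measurableT_comp.
  by apply: ae_mono vu => x /= -> _.
have vB := variation_majorant_bound vG iv.
exists (fun x => sig x * v x), (fun x => S * G x + M * Sg x); split.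
  by apply: ae_mono vu => x ->.
exact: (variation_majorant_mul vsig vG sS vB).
Qed.

End hypotheses_made_explicit.

Section clamp.
Context {R : realType}.
Variables (T : R) (T0 : 0 < T).

(** Composing with clamp extends curves on [0, T] to the whole line: the integrals in
    time then have no boundary, and the kernels alone select the interval. *)
Definition clamp (t : R) := Num.max 0 (Num.min t T).

Lemma clamp_in t : 0 <= clamp t <= T.
Proof. by rewrite /clamp le_max lexx/= ge_max ltW//= ge_min lexx orbT. Qed.

Lemma clamp_id t : 0 <= t <= T -> clamp t = t.
Proof. by move=> /andP[t0 tT]; rewrite /clamp (min_idPl tT) (max_idPr t0). Qed.

Lemma clamp_dist t s : `|clamp t - clamp s| <= `|t - s|.
Proof.
have cP x : [\/ x <= 0 /\ clamp x = 0, T <= x /\ clamp x = T | clamp x = x /\ 0 <= x <= T].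
  case: (leP x 0) => x0; last case: (leP T x) => Tx.
  - apply: Or31; split => //; rewrite /clamp (min_idPl _) ?(max_idPl _)//.
    by rewrite (le_trans x0) ?ltW.
  - by apply: Or32; split => //; rewrite /clamp (min_idPr _) ?(max_idPr _)// ltW.
  - by apply: Or33; rewrite clamp_id ?(ltW x0) ?(ltW Tx).
have h (x y : R) : x <= y -> `|clamp x - clamp y| <= `|x - y|.
  move=> xy; have Txx := T0; rewrite [leRHS]distrC (ger0_norm (x := y - x)) ?subr_ge0//.
  by case: (cP x) => -[x1 x2]; case: (cP y) => -[y1 y2]; rewrite ?x1 ?x2 ?y1 ?y2;
    rewrite ler_norml; apply/andP; split; lra.
by case: (leP t s) => [/h//|/ltW/h]; rewrite [`|clamp s - _|]distrC [`|s - _|]distrC.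
Qed.

Lemma measurable_clamp : measurable_fun setT clamp.
Proof.
by apply: (@lipschitz_measurable _ _ 1) => t s; rewrite mul1r; exact: clamp_dist.
Qed.

Lemma clamp_plane_measurable (U : R -> R -> R) :
  measurable_fun (`[0, T] `*` setT) (fun p : R * R => U p.1 p.2) ->
  plane_measurable (fun t => U (clamp t)).
Proof.
move=> mU; rewrite /plane_measurable.
rewrite (_ : (fun p : R * R => _) = (fun q : R * R => U q.1 q.2) \o
  (fun p : R * R => (clamp p.1, p.2)))//.
apply: (@measurable_comp _ _ _ _ _ _ (`[0, T] `*` setT)).
- by apply: measurableX => //; exact: measurable_itv.
- by move=> _ [p _ <-]; split=> //=; rewrite in_itv/= clamp_in.
- exact: mU.
- apply: measurable_fun_pair => //.
  by apply: (measurableT_comp measurable_clamp).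
Qed.

End clamp.

Section continuity_of_gaps.
Context {R : realType}.
Local Notation leb := (@lebesgue_measure R).

Lemma plane_continuous_of_modulus (g om1 om2 : R -> R -> R) (K : R) :
  (forall t s x y, `|g t x - g s y| <= K * (om1 t s + om2 x y)) ->
  (forall s, om1 t s @[t --> s] --> 0) -> (forall y, om2 x y @[x --> y] --> 0) ->
  continuous (fun p : R * R => g p.1 p.2).
Proof.
move=> gK c1 c2 [s y].
have cb : K * (om1 p.1 s + om2 p.2 y) @[p --> (s, y)] --> 0.
  rewrite -(mulr0 K) -[X in K * X]addr0; apply: cvgM; first exact: cvg_cst.
  apply: cvgD.
    by apply: (@cvg_comp _ _ _ fst (fun t => om1 t s) _ (nbhs s)); [exact: cvg_fst|exact: c1].
  by apply: (@cvg_comp _ _ _ snd (fun x => om2 x y) _ (nbhs y)); [exact: cvg_snd|exact: c2].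
apply/cvgrPdist_le => /= e e0.
move/cvgrPdist_le : cb => /(_ e e0); apply: filterS => p; rewrite sub0r normrN => pe.
rewrite distrC; apply: (le_trans (gK _ _ _ _)); exact: le_trans (ler_norm _) pe.
Qed.

Lemma cvg_dist_self (y : R) : `|x - y| @[x --> y] --> 0.
Proof.
rewrite -[X in _ --> X](normr0 R^o) -(subrr y); apply: cvg_norm.
by apply: cvgB; [exact: cvg_id|exact: cvg_cst].
Qed.

Lemma l1_0 : l1 (fun _ : R => (0 : R)) = 0.
Proof. by rewrite /l1 /Rintegral; under eq_integral do rewrite normr0; rewrite integral0. Qed.

Lemma l1_gap_modulus (u1 v1 u2 v2 : R -> R) : L1 u1 -> L1 v1 -> L1 u2 -> L1 v2 ->
  `|l1 (u1 \- v1) - l1 (u2 \- v2)| <= l1 (u1 \- u2) + l1 (v1 \- v2).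
Proof.
move=> i1 j1 i2 j2.
have h (a b a' b' : R -> R) : L1 a -> L1 b -> L1 a' -> L1 b' ->
    l1 (a \- b) <= l1 (a' \- b') + (l1 (a \- a') + l1 (b \- b')).
  move=> ia ib ia' ib'.
  have := l1_triangle ia ia' ib; have := l1_triangle ia' ib' ib.
  by rewrite [l1 (b' \- b)]l1B_sym; lra.
have h1 := h _ _ _ _ i1 j1 i2 j2; have := h _ _ _ _ i2 j2 i1 j1.
rewrite [l1 (u2 \- u1)]l1B_sym [l1 (v2 \- v1)]l1B_sym => h2'.
by rewrite ler_distl; apply/andP; split; lra.
Qed.

End continuity_of_gaps.

Section frozen_trajectory.
Context {R : realType} {N : nat}.
Local Notation leb := (@lebesgue_measure R).
Variables (T : R) (T0 : 0 < T).

Definition frozen (U : 'I_N -> R -> R -> R) (k : 'I_N) (t : R) := U k (clamp T t).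

Variable U : 'I_N -> R -> R -> R.
Hypothesis cU : forall k, in_C_L1 T (U k).

Lemma frozen_measurable k : plane_measurable (frozen U k).
Proof. by apply: clamp_plane_measurable => //; have [] := cU k. Qed.

Lemma frozen_L1 k t : L1 (frozen U k t).
Proof. by have [_ + _] := cU k; apply; exact: clamp_in. Qed.

Lemma frozen_cvg k s : l1 (frozen U k t \- frozen U k s) @[t --> s] --> 0.
Proof.
have [_ _ /(_ (clamp T s) (clamp_in T0 s)) c] := cU k.
have cl : clamp T t @[t --> s] --> within `[0, T] (nbhs (clamp T s)).
  have cc : clamp T t @[t --> s] --> clamp T s.
    apply/cvgrPdist_le => e e0; have /cvgrPdist_le/(_ e e0) := @cvg_id _ (nbhs s).
    by apply: filterS => t; apply: le_trans; exact: clamp_dist.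
  move=> A wA; change (\forall t \near s, A (clamp T t)).
  have h : \forall t \near s, `[0, T]%classic (clamp T t) -> A (clamp T t) := cc _ wA.
  by move: h; apply: filterS => t; apply; rewrite /= in_itv/= clamp_in.
have : (l1 (frozen U k t \- frozen U k s))%:E @[t --> s] --> (0 : R)%:E.
  rewrite (_ : (fun t => _) = (fun t => L1norm (U k (clamp T t) \- U k (clamp T s)))).
    exact: (@cvg_comp _ _ _ (clamp T) (fun t => L1norm (U k t \- U k (clamp T s))) _ _ _ cl c).
  apply/funext => t /=; rewrite L1norm_l1//.
  by apply: L1B; exact: frozen_L1.
exact: fine_cvg.
Qed.

Lemma frozen_l1N_cvg s :
  l1N (fun k => frozen U k t \- frozen U k s) @[t --> s] --> 0.
Proof.
have := @cvg_finite_sum R R^o R (nbhs s) (nbhs_filter s) _ _ _ (fun k => frozen_cvg k s).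
by rewrite big1.
Qed.

(** The mass is a continuous function of time on the compact interval [0, T]. *)
Lemma frozen_l1N_bound : exists M, forall t, l1N (fun k => frozen U k t) <= M.
Proof.
pose F t := l1N (fun k => frozen U k t).
have cF : continuous F.
  move=> s; apply/cvgrPdist_le => e e0.
  have /cvgrPdist_le/(_ e e0) := frozen_l1N_cvg s.
  apply: filterS => t; rewrite sub0r normrN ger0_norm ?l1N_ge0// => h.
  apply: le_trans h; rewrite /F /l1N -sumrB; apply: le_trans (ler_norm_sum _ _ _) _.
  apply: ler_sum => k _.
  have z0 : L1 (fun _ : R => (0 : R)) by exact: integrable0.
  have e' u : u \- (fun=> 0) = u :> (R -> R) by apply/funext => x /=; rewrite subr0.
  have := l1_gap_modulus (frozen_L1 k s) z0 (frozen_L1 k t) z0.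
  by rewrite !e' l1_0 addr0 l1B_sym.
have [c _ cM] := EVT_max (ltW T0) (continuous_subspaceT cF).
exists (F c) => t; have := cM (clamp T t); rewrite in_itv/= clamp_in// => /(_ isT).
rewrite {1}/F /frozen; under [X in l1N X]eq_fun do rewrite clamp_id ?clamp_in//.
exact.
Qed.

End frozen_trajectory.

(** * The entropy inequality tested against products *)

Section product_tests.
Context {R : realType}.
Local Notation leb := (@lebesgue_measure R).
Local Notation bb := (@bump_bound R).
Variables (T A Lf K W : R) (a f : R -> R) (w P P' : R -> R -> R).
Hypothesis fL : forall x y, `|f x - f y| <= Lf * `|x - y|.
Hypothesis K0 : 0 <= K.
Hypothesis a_bound : forall x, 0 <= a x <= A.
Hypothesis ma : measurable_fun setT a.
Hypotheses (mw : plane_measurable w) (mP : plane_measurable P) (mP' : plane_measurable P').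
Hypotheses (iw : forall t, L1 (w t)) (wW : forall t, l1 (w t) <= W).
Hypotheses (PK : forall t x, `|P t x| <= K) (P'K : forall t x, `|P' t x| <= K).

Definition box_window (e r d y : R) (p : R * R) := near_diag e (p.1, r) * near_diag d (p.2, y).

Lemma L1_near_diag_l (e r : R) : 0 < e -> L1 (fun t => near_diag e (t, r)).
Proof. by move=> e0; under eq_fun do rewrite near_diag_sym; exact: L1_near_diag. Qed.

Lemma integrable_box_window e r d y : 0 < e -> 0 < d ->
  plane.-integrable setT (EFin \o box_window e r d y).
Proof.
move=> e0 d0; exact: (plane_integrable_tensor (L1_near_diag_l r e0) (L1_near_diag_l y d0)).
Qed.

(** Kernels supported in a box make integrable whatever is at most affine in w. *)
Lemma box_integrable (e r d y c1 c2 c3 : R) (g k : R * R -> R) : 0 < e -> 0 < d ->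
  0 <= c1 -> 0 <= c2 -> 0 <= c3 ->
  measurable_fun setT g -> measurable_fun setT k ->
  (forall p, `|g p| <= c1 * `|w p.1 p.2| + c2) ->
  (forall p, `|k p| <= c3 * box_window e r d y p) ->
  plane.-integrable setT (EFin \o (fun p => g p * k p)) /\
  `|\int[plane]_p (g p * k p)| <= c3 * (c1 * (W * (2 * e)) + c2 * (2 * e * (2 * d))).
Proof.
move=> e0 d0 c10 c20 c30 mg mk gc kc.
have i1 := integrable_time_window mw iw wW r e0.
have i2 := integrable_box_window r y e0 d0.
pose b (p : R * R) := c3 * (c1 * (`|w p.1 p.2| * near_diag e (p.1, r)) + c2 * box_window e r d y p).
have j1 := integrable_scale c1 i1; have j2 := integrable_scale c2 i2.
have j3 := integrable_add j1 j2.
have ib : plane.-integrable setT (EFin \o b) by exact: (integrable_scale c3 j3).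
have hb p : `|g p * k p| <= b p.
  rewrite normrM mulrC; apply: (le_trans (ler_pM _ _ (kc p) (gc p))) => //.
  rewrite /b -mulrA; apply: ler_wpM2l => //; rewrite mulrDr lerD//; last by rewrite mulrC.
  rewrite mulrCA; apply: ler_wpM2l => //; rewrite mulrC; apply: ler_wpM2l => //.
  by rewrite /box_window -[leRHS]mulr1; apply: ler_wpM2l; [exact: near_diag_ge0|exact: near_diag_le1].
have ih : plane.-integrable setT (EFin \o (fun p => g p * k p)).
  by apply: (plane_dominated (measurable_funM mg mk) hb ib).
split=> //; apply: (le_trans (le_normr_Rintegral _ _)) => //.
apply: (@le_trans _ _ (\int[plane]_p b p)).
  by apply: le_Rintegral => //; exact: integrable_abs.
rewrite RintegralZl//; apply: ler_wpM2l => //.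
rewrite RintegralD// RintegralZl// RintegralZl//; apply: lerD; apply: ler_wpM2l => //.
  have F0 p : 0 <= `|w p.1 p.2| * near_diag e (p.1, r) by rewrite mulr_ge0// near_diag_ge0.
  have mF := integrable_real_measurable i1.
  by have [] := @ge0_integrable _ _ _ plane _ _ mF F0 (integral_time_window mw iw wW r e0).
have nd c x : 0 < c -> \int[leb]_t near_diag c (t, x) = 2 * c.
  move=> c0; rewrite /Rintegral; under eq_integral do rewrite near_diag_sym.
  by rewrite integral_near_diag ?ltW.
rewrite plane_fubini// (_ : Rintegral _ _ _ = \int[leb]_t ((2 * d) * near_diag e (t, r))).
  rewrite RintegralZl//; last exact: L1_near_diag_l.
  by rewrite nd// [2 * d * _]mulrC lexx.
apply: eq_Rintegral => t _; rewrite /box_window/= RintegralZl//; last exact: L1_near_diag_l.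
by rewrite nd// mulrC.
Qed.

Let Lf0 : 0 <= Lf.
Proof. by have := le_trans (normr_ge0 _) (fL 1 0); rewrite subr0 normr1 mulr1. Qed.

Let A0 : 0 <= A. Proof. by have /andP[+ +] := a_bound 0; exact: le_trans. Qed.

Let wa alpha p : `|w p.1 p.2 - alpha| <= `|w p.1 p.2| + `|alpha| := ler_normB _ _.

Let mwa alpha : measurable_fun setT (fun p : R * R => w p.1 p.2 - alpha).
Proof. by apply: measurable_funB => //; exact: mw. Qed.

Section boxed_kernels.
Variables (alpha e r d y c3 : R) (k : R * R -> R).
Hypotheses (e0 : 0 < e) (d0 : 0 < d) (c30 : 0 <= c3).
Hypothesis mk : measurable_fun setT k.
Hypothesis kc : forall p, `|k p| <= c3 * box_window e r d y p.

Lemma entropy_term1_box :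
  plane.-integrable setT (EFin \o (fun p => a p.2 * `|w p.1 p.2 - alpha| * k p)).
Proof.
have mg : measurable_fun setT (fun p : R * R => a p.2 * `|w p.1 p.2 - alpha|).
  apply: measurable_funM; first by apply: (measurableT_comp ma).
  by apply: measurableT_comp.
have ge p : `|a p.2 * `|w p.1 p.2 - alpha| | <= A * `|w p.1 p.2| + A * `|alpha|.
  rewrite -mulrDr normrM normr_id; apply: ler_pM => //.
  by have /andP[a1 a2] := a_bound p.2; rewrite ger0_norm.
by have [] := box_integrable e0 d0 A0 (mulr_ge0 A0 (normr_ge0 alpha)) c30 mg mk ge kc.
Qed.

Lemma entropy_term2_box :
  plane.-integrable setT (EFin \o (fun p => kruzkov f (w p.1 p.2) alpha * P p.1 p.2 * k p)) /\
  `|\int[plane]_p (kruzkov f (w p.1 p.2) alpha * P p.1 p.2 * k p)| <=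
    c3 * (Lf * K * (W * (2 * e)) + Lf * K * `|alpha| * (2 * e * (2 * d))).
Proof.
have LK : 0 <= Lf * K by exact: mulr_ge0.
apply: box_integrable => //; first exact: mulr_ge0.
- apply: measurable_funM => //; apply: measurable_funM.
    by apply: (measurableT_comp measurable_sgr).
  apply: measurable_funB => //; apply: (measurableT_comp (lipschitz_measurable fL)).
  exact: mw.
- move=> p; rewrite -mulrDr normrM -mulrA mulrC [K * _]mulrC mulrA [leRHS]mulrC; apply: ler_pM => //.
  by apply: le_trans (kruzkov_le fL _ _) _; apply: ler_wpM2l.
Qed.

Lemma entropy_term3_box :
  plane.-integrable setT (EFin \o (fun p =>
    f alpha * Num.sg (w p.1 p.2 - alpha) * P' p.1 p.2 * k p)) /\
  `|\int[plane]_p (f alpha * Num.sg (w p.1 p.2 - alpha) * P' p.1 p.2 * k p)| <=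
    c3 * (0 * (W * (2 * e)) + `|f alpha| * K * (2 * e * (2 * d))).
Proof.
apply: box_integrable => //; first exact: mulr_ge0.
- apply: measurable_funM => //; apply: measurable_funM => //.
  by apply: (measurableT_comp measurable_sgr).
- move=> p; rewrite mul0r add0r normrM; apply: ler_pM => //.
  by rewrite normrM normr_sg ler_piMr//; case: (_ != _).
Qed.

End boxed_kernels.

End product_tests.

Section solution_tests.
Context {R : realType} {N : nat}.
Local Notation leb := (@lebesgue_measure R).
Local Notation leb2 := (leb \x leb)%E.
Local Notation bb := (@bump_bound R).
Variables (f : 'I_N -> R -> R) (nu : 'I_N -> 'rV[R]_N -> R) (mu : 'I_N -> 'I_N -> R -> R)
  (sigma : 'I_N -> R -> R) (T : R).

Lemma strip_integral (g h : R * R -> R) : (forall p, 0 < p.1 < T -> g p = h p) ->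
  \int[leb2]_(p in `]0, T[ `*` [set: R]) g p = \int[plane]_p (h p * (0 < p.1 < T)%R%:R).
Proof.
move=> gh; rewrite -plane_Rintegral Rintegral_mkcond; apply: eq_Rintegral => p _.
rewrite patchE; case: ifPn => [/set_mem [/= + _]|].
  by rewrite in_itv/= => pT; rewrite pT mulr1 gh.
case: (boolP (0 < p.1 < T)) => pT; last by rewrite mulr0.
by move=> /negP[]; rewrite inE; split => //=; rewrite in_itv.
Qed.

Definition weighted (U : 'I_N -> R -> R -> R) k t x := sigma k x * frozen T U k t x.
Definition frozen_velocity U k t x := velocity nu mu (fun j => frozen T U j t) k x.
Definition frozen_velocity_derivative U k t x :=
  velocity_derivative nu mu (fun j => frozen T U j t) k x.

(** Freezing changes nothing inside the strip, and there |U - alpha / sigma| equals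
    |sigma U - alpha| / sigma. *)
Lemma entropy_strip (u0 : 'I_N -> R -> R) U k alpha (e r d y : R) : 0 < T ->
  (forall x, 0 < sigma k x) ->
  test_function T (moll2 e r d y) ->
  entropy_ineq f nu mu sigma T u0 U k alpha (moll2 e r d y) ->
  0 <= \int[plane]_p ((sigma k p.2)^-1 * `|weighted U k p.1 p.2 - alpha| *
         (moll' e (p.1 - r) * moll d (p.2 - y)) * (0 < p.1 < T)%R%:R)
     + \int[plane]_p (kruzkov (f k) (weighted U k p.1 p.2) alpha * frozen_velocity U k p.1 p.2 *
         (moll e (p.1 - r) * moll' d (p.2 - y)) * (0 < p.1 < T)%R%:R)
     - \int[plane]_p (f k alpha * Num.sg (weighted U k p.1 p.2 - alpha) *
         frozen_velocity_derivative U k p.1 p.2 *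
         (moll e (p.1 - r) * moll d (p.2 - y)) * (0 < p.1 < T)%R%:R)
     + \int[leb]_x (`|u0 k x - alpha / sigma k x| * moll2 e r d y (0, x)).
Proof.
move=> T0 s0 tf; rewrite /entropy_ineq/=.
have id1 (p : R * R) : 0 < p.1 < T -> clamp T p.1 = p.1.
  by move=> /andP[p1 p2]; rewrite clamp_id// (ltW p1) (ltW p2).
have fr (p : R * R) j : 0 < p.1 < T -> frozen T U j p.1 = U j p.1.
  by move=> pT; rewrite /frozen id1.
have frv (p : R * R) : 0 < p.1 < T -> (fun j => frozen T U j p.1) = U^~ p.1.
  by move=> pT; apply/funext => j; exact: fr.
move=> h; apply: (le_trans h); rewrite le_eqVlt; apply/orP; left; apply/eqP.
congr (_ + _ - _ + _); apply: strip_integral => p pT.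
- rewrite derive1_moll2; congr (_ * _); have sp := s0 p.2.
  have i0 : 0 <= (sigma k p.2)^-1 by rewrite invr_ge0 ltW.
  rewrite [RHS](_ : _ = `|(sigma k p.2)^-1 * (weighted U k p.1 p.2 - alpha)|); last first.
    by rewrite normrM (ger0_norm i0).
  by rewrite mulrBr /weighted fr// mulKf ?gt_eqF// [_^-1 * alpha]mulrC.
- rewrite derive2_moll2 /kruzkov /weighted /frozen_velocity /velocity fr// frv//.
  by congr (_ * _); exact: mulrAC.
- rewrite /weighted (fr p k pT) /frozen_velocity_derivative (frv p pT); exact: erefl.
Qed.

End solution_tests.

(** The primitive moll e vanishes at T, beyond its support. *)
Lemma integral_moll'_strip {R : realType} (e T : R) : 0 < e -> e < T ->
  \int[@lebesgue_measure R]_t (moll' e t * (0 < t < T)%R%:R) = - moll e 0.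
Proof.
move=> e0 eT; have T0 := lt_trans e0 eT.
have mE : measurable_fun `]0, T[ (EFin \o moll' e : R -> \bar R).
  by apply/measurable_EFinP; apply: measurable_funS (measurable_moll' e).
have -> : \int[@lebesgue_measure R]_t (moll' e t * (0 < t < T)%R%:R) =
    fine (\int[@lebesgue_measure R]_(t in `[0%R, T]) (moll' e t)%:E)%E.
  have E : (\int[@lebesgue_measure R]_(t in `[0%R, T]) (moll' e t)%:E =
      \int[@lebesgue_measure R]_(t in `]0%R, T[) (moll' e t)%:E)%E.
    rewrite -integral_itv_bndo_bndc; last first.
      by apply/measurable_EFinP; apply: measurable_funS (measurable_moll' e).
    by rewrite -integral_itv_obnd_cbnd.
  rewrite E [in RHS]integral_mkcond /Rintegral; congr fine; apply: eq_integral => t _.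
  rewrite patchE; case: ifPn => [/set_mem|].
    by rewrite /= in_itv/= => ->; rewrite mulr1.
  case: (boolP (0 < t < T)) => tT; last by rewrite mulr0.
  by move=> /negP[]; rewrite inE /= in_itv.
have dm (x : R) : is_derive x 1 (moll e) (moll' e x) := is_derive_moll e x.
rewrite (continuous_FTC2 T0 (F := moll e)).
- by rewrite -EFinB /= (moll_out (x := T) e0) ?sub0r// gtr0_norm// ltW.
- apply: continuous_subspaceT => x; exact: continuous_moll'.
- split=> [x _||]; first by have [] := dm x.
  + exact/cvg_at_right_filter/(is_derive1_continuous (dm 0)).
  + exact/cvg_at_left_filter/(is_derive1_continuous (dm T)).
- by move=> x _; rewrite derive1E; have [] := dm x.
Qed.

Section kernel_products.
Context {R : realType}.
Local Notation bb := (@bump_bound R).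
Variables (e d : R) (e0 : 0 < e) (d0 : 0 < d).

Let prod_le (x y u v p q : R) : `|x| <= u * p -> `|y| <= v * q -> `|x * y| <= u * v * (p * q).
Proof. by move=> xu yv; rewrite normrM mulrACA; exact: ler_pM. Qed.

Lemma kernel_products_box (r y : R) (p : R * R) :
  [/\ `|moll e (p.1 - r) * moll d (p.2 - y)| <= bb / e * width_bound d * box_window e r d y p,
      `|moll' e (p.1 - r) * moll d (p.2 - y)| <= bb / e ^+ 2 * width_bound d * box_window e r d y p &
      `|moll e (p.1 - r) * moll' d (p.2 - y)| <= bb / e * width_bound d * box_window e r d y p].
Proof.
have k1 := moll_near e0 p.1 r; have k2 := moll'_near e0 p.1 r.
have [g1 g2] := moll_near_width d0 p.2 y.
by split; exact: prod_le.
Qed.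

Lemma measurable_kernel_product (g h : R -> R) (r y : R) :
  measurable_fun setT g -> measurable_fun setT h ->
  measurable_fun setT (fun p : R * R => g (p.1 - r) * h (p.2 - y)).
Proof.
by move=> mg mh; apply: measurable_funM; [apply: (measurableT_comp mg)|apply: (measurableT_comp mh)];
  apply: measurable_funB.
Qed.

End kernel_products.

Section one_component.
Context {R : realType} {N : nat}.
Local Notation leb := (@lebesgue_measure R).
Local Notation bb := (@bump_bound R).
Variables (f : 'I_N -> R -> R) (nu : 'I_N -> 'rV[R]_N -> R) (mu : 'I_N -> 'I_N -> R -> R)
  (sigma : 'I_N -> R -> R) (T : R) (T0 : 0 < T) (U : 'I_N -> R -> R -> R) (k : 'I_N).
Variables (Lf s0 W K : R).
Hypothesis fL : forall x y, `|f k x - f k y| <= Lf * `|x - y|.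
Hypotheses (s0_gt0 : 0 < s0) (sigma_ge : forall x, s0 <= sigma k x).
Hypothesis msigma : measurable_fun setT (sigma k).
Local Notation w := (weighted sigma T U k).
Local Notation P := (frozen_velocity nu mu T U k).
Local Notation P' := (frozen_velocity_derivative nu mu T U k).
Local Notation a := (fun x => (sigma k x)^-1).
Hypotheses (mw : plane_measurable w) (mP : plane_measurable P) (mP' : plane_measurable P').
Hypotheses (iw : forall t, L1 (w t)) (wW : forall t, l1 (w t) <= W).
Hypotheses (PK : forall t x, `|P t x| <= K) (P'K : forall t x, `|P' t x| <= K).

Lemma sigma_gt0 x : 0 < sigma k x.
Proof. exact: lt_le_trans (sigma_ge x). Qed.

Lemma recip_bound x : 0 <= (sigma k x)^-1 <= s0^-1.
Proof. by rewrite invr_ge0 ltW ?sigma_gt0//= lef_pV2 ?posrE ?sigma_gt0. Qed.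

Lemma measurable_recip : measurable_fun setT a.
Proof.
pose h x := (Num.max x s0)^-1.
have -> : a = h \o sigma k by apply/funext => x /=; rewrite /h (max_idPl (sigma_ge x)).
have hL x y : `|h x - h y| <= s0^-1 ^+ 2 * `|x - y|.
  have m z : s0 <= Num.max z s0 by rewrite le_max lexx orbT.
  have m0 z : 0 < Num.max z s0 := lt_le_trans s0_gt0 (m z).
  have -> : h x - h y = (h x * h y) * (Num.max y s0 - Num.max x s0).
    by rewrite /h; field; rewrite !gt_eqF.
  have hb z : 0 <= h z <= s0^-1 by rewrite invr_ge0 ltW//= lef_pV2 ?posrE.
  have /andP[hx0 hx] := hb x; have /andP[hy0 hy] := hb y.
  rewrite normrM; apply: ler_pM => //.
    by rewrite ger0_norm ?mulr_ge0// expr2; exact: ler_pM.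
  have n1 := ler_norm (x - y); have n2 := ler_norm (y - x); have n3 := normr_ge0 (x - y).
  rewrite distrC in n2; set n := `|x - y| in n1 n2 n3 *.
  by case: (leP x s0) => xs; case: (leP y s0) => ys; rewrite ler_norml; apply/andP; split; lra.
apply: (measurableT_comp _ msigma); exact: (lipschitz_measurable hL).
Qed.

Let K0 : 0 <= K := le_trans (normr_ge0 _) (PK 0 0).

Section fixed_test.
Variables (alpha e r d y : R) (ind : R -> R).
Hypotheses (e0 : 0 < e) (d0 : 0 < d) (mind : measurable_fun setT ind).
Hypothesis ind1 : forall t, `|ind t| <= 1.

Let mi : measurable_fun setT (fun p : R * R => ind p.1).
Proof. by apply: (measurableT_comp mind). Qed.

Let cut (x b : R) t : `|x| <= b -> `|x * ind t| <= b.
Proof.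
move=> xb; rewrite normrM; apply: le_trans xb; rewrite ler_piMr//.
Qed.

Lemma cut_terms_integrable :
  [/\ plane.-integrable setT (EFin \o (fun p => (sigma k p.2)^-1 * `|w p.1 p.2 - alpha| *
         (moll' e (p.1 - r) * moll d (p.2 - y)) * ind p.1)),
      plane.-integrable setT (EFin \o (fun p => kruzkov (f k) (w p.1 p.2) alpha * P p.1 p.2 *
         (moll e (p.1 - r) * moll' d (p.2 - y)) * ind p.1)) &
      plane.-integrable setT (EFin \o (fun p => f k alpha * Num.sg (w p.1 p.2 - alpha) *
         P' p.1 p.2 * (moll e (p.1 - r) * moll d (p.2 - y)) * ind p.1))].
Proof.
have mm := measurable_moll; have mm' := measurable_moll'.
have be : 0 <= bb / e * width_bound d.
  by rewrite mulr_ge0 ?width_bound_ge0// divr_ge0 ?ltW ?bump_bound_gt0.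
have be' : 0 <= bb / e ^+ 2 * width_bound d.
  by rewrite mulr_ge0 ?width_bound_ge0// divr_ge0 ?exprn_ge0 ?ltW ?bump_bound_gt0.
have kc := fun p => kernel_products_box e0 d0 r y p.
have m1 : measurable_fun setT (fun p : R * R => (moll' e (p.1 - r) * moll d (p.2 - y)) * ind p.1).
  by apply: measurable_funM => //; exact: measurable_kernel_product.
have m2 : measurable_fun setT (fun p : R * R => (moll e (p.1 - r) * moll' d (p.2 - y)) * ind p.1).
  by apply: measurable_funM => //; exact: measurable_kernel_product.
have m3 : measurable_fun setT (fun p : R * R => (moll e (p.1 - r) * moll d (p.2 - y)) * ind p.1).
  by apply: measurable_funM => //; exact: measurable_kernel_product.
have c1 (p : R * R) : `|(moll' e (p.1 - r) * moll d (p.2 - y)) * ind p.1| <=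
    bb / e ^+ 2 * width_bound d * box_window e r d y p by apply: cut; have [] := kc p.
have c2 (p : R * R) : `|(moll e (p.1 - r) * moll' d (p.2 - y)) * ind p.1| <=
    bb / e * width_bound d * box_window e r d y p by apply: cut; have [] := kc p.
have c3 (p : R * R) : `|(moll e (p.1 - r) * moll d (p.2 - y)) * ind p.1| <=
    bb / e * width_bound d * box_window e r d y p by apply: cut; have [] := kc p.
split.
- have := entropy_term1_box recip_bound measurable_recip mw iw wW alpha e0 d0 be' m1 c1.
  by congr (plane.-integrable setT (EFin \o _)); apply/funext => p; rewrite !mulrA.
- have [+ _] := entropy_term2_box fL K0 mw mP iw wW PK alpha e0 d0 be m2 c2.
  by congr (plane.-integrable setT (EFin \o _)); apply/funext => p; rewrite !mulrA.
- have [+ _] := entropy_term3_box (f k) K0 mw mP' iw wW P'K alpha e0 d0 be m3 c3.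
  by congr (plane.-integrable setT (EFin \o _)); apply/funext => p; rewrite !mulrA.
Qed.

(** The bound does not depend on e: the height 1 / e of the time kernel is
    compensated by the length of its support. *)
Lemma cut_flux_bound :
  `|\int[plane]_p (kruzkov (f k) (w p.1 p.2) alpha * P p.1 p.2 *
         (moll e (p.1 - r) * moll' d (p.2 - y)) * ind p.1)| +
  `|\int[plane]_p (f k alpha * Num.sg (w p.1 p.2 - alpha) *
         P' p.1 p.2 * (moll e (p.1 - r) * moll d (p.2 - y)) * ind p.1)| <=
  2 * bb * width_bound d * K * (Lf * W + (Lf * `|alpha| + `|f k alpha|) * (2 * d)).
Proof.
have mm := measurable_moll; have mm' := measurable_moll'.
have be : 0 <= bb / e * width_bound d.
  by rewrite mulr_ge0 ?width_bound_ge0// divr_ge0 ?ltW ?bump_bound_gt0.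
have kc := fun p => kernel_products_box e0 d0 r y p.
have m1 : measurable_fun setT (fun p : R * R => (moll e (p.1 - r) * moll' d (p.2 - y)) * ind p.1).
  by apply: measurable_funM => //; exact: measurable_kernel_product.
have m2 : measurable_fun setT (fun p : R * R => (moll e (p.1 - r) * moll d (p.2 - y)) * ind p.1).
  by apply: measurable_funM => //; exact: measurable_kernel_product.
have c1 (p : R * R) : `|(moll e (p.1 - r) * moll' d (p.2 - y)) * ind p.1| <=
    bb / e * width_bound d * box_window e r d y p by apply: cut; have [] := kc p.
have c2 (p : R * R) : `|(moll e (p.1 - r) * moll d (p.2 - y)) * ind p.1| <=
    bb / e * width_bound d * box_window e r d y p by apply: cut; have [] := kc p.
have [_ E2] := entropy_term2_box fL K0 mw mP iw wW PK alpha e0 d0 be m1 c1.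
have [_ E3] := entropy_term3_box (f k) K0 mw mP' iw wW P'K alpha e0 d0 be m2 c2.
under eq_Rintegral do rewrite -mulrA; under [X in _ + `|X|]eq_Rintegral do rewrite -mulrA.
apply: (le_trans (lerD E2 E3)); rewrite le_eqVlt; apply/orP; left; apply/eqP.
by field; exact: lt0r_neq0.
Qed.

End fixed_test.

Let ind (t : R) : R := (0 < t < T)%R%:R.

Let mind : measurable_fun setT ind.
Proof.
rewrite (_ : ind = \1_(`]0, T[%classic : set R)); first exact: measurable_indic.
by apply/funext => t; rewrite indicE mem_setE in_itv.
Qed.

Let ind1 t : `|ind t| <= 1.
Proof. by rewrite /ind; case: (_ < _ < _) => /=; rewrite ?normr1 ?normr0. Qed.

Variable u0 : 'I_N -> R -> R.
Hypothesis entropy : forall alpha phi, test_function T phi ->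
  entropy_ineq f nu mu sigma T u0 U k alpha phi.

(** When the window lies inside (0, T) the kernel vanishes at time 0 and wherever the
    strip is cut off. *)
Lemma entropy_moll_of_solution : entropy_moll T a (f k) w P P'.
Proof.
move=> alpha e r d y c e0 er rT d0 c0.
have tf := test_function_moll2 y e0 d0 rT.
have := entropy_strip T0 sigma_gt0 tf (entropy alpha tf).
have inside t : moll e (t - r) * ind t = moll e (t - r) /\
    moll' e (t - r) * ind t = moll' e (t - r).
  rewrite /ind; case: (boolP (0 < t < T)) => [_|tT]; first by rewrite !mulr1.
  have et : e <= `|t - r|.
    rewrite leNgt; apply: contra tT; rewrite ltr_distl => /andP[t1 t2].
    by rewrite (lt_trans _ t1) ?subr_gt0//= (lt_trans t2).
  by rewrite (moll_out e0 et) (moll'_out e0 et) !mul0r.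
rewrite (_ : \int[leb]_x _ = 0) ?addr0; last first.
  rewrite (_ : Rintegral _ _ _ = \int[leb]_x ((fun=> 0) x : R)).
    by rewrite /Rintegral integral0.
  apply: eq_Rintegral => x _; rewrite /moll2/= moll_out ?mul0r ?mulr0//.
  by rewrite sub0r normrN gtr0_norm ?ltW// (lt_trans e0).
have [i1 i2 i3] := cut_terms_integrable alpha r y e0 d0 mind ind1.
have i12 := integrable_add i1 i2; have i123 := integrable_sub i12 i3.
rewrite -RintegralD// -RintegralB// => h.
rewrite (_ : Rintegral _ _ _ = c * \int[plane]_p
  ((sigma k p.2)^-1 * `|w p.1 p.2 - alpha| * (moll' e (p.1 - r) * moll d (p.2 - y)) * ind p.1
   + kruzkov (f k) (w p.1 p.2) alpha * P p.1 p.2 * (moll e (p.1 - r) * moll' d (p.2 - y)) * ind p.1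
   - f k alpha * Num.sg (w p.1 p.2 - alpha) * P' p.1 p.2 *
     (moll e (p.1 - r) * moll d (p.2 - y)) * ind p.1)); first exact: mulr_ge0.
rewrite -RintegralZl//; apply: eq_Rintegral => p _; congr (c * _).
rewrite /entropy_integrand; have [h1 h2] := inside p.1.
by rewrite -[in LHS]h1 -[in LHS]h2; ring.
Qed.

Section initial_trace.
Local Notation u := (frozen T U k).
Hypotheses (mu_ : plane_measurable u) (iu : forall t, L1 (u t)).
Hypothesis ucont : forall eta, 0 < eta -> exists2 del, 0 < del &
  forall t, `|t| <= del -> l1 (u t \- u 0) <= eta.
Hypothesis iu0 : forall alpha d y, 0 < d ->
  L1 (fun x => `|u0 k x - alpha / sigma k x| * moll d (x - y)).
Variables (alpha d y : R) (d0 : 0 < d).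

(* The distance to the level alpha / sigma, averaged around y. *)
Let J v := \int[leb]_x (`|v x - alpha / sigma k x| * moll d (x - y)).

Let recip_gap t x : (sigma k x)^-1 * `|w t x - alpha| = `|u t x - alpha / sigma k x|.
Proof.
have sp := sigma_gt0 x; have i0 : 0 <= (sigma k x)^-1 by rewrite invr_ge0 ltW.
rewrite [LHS](_ : _ = `|(sigma k x)^-1 * (w t x - alpha)|); last by rewrite normrM (ger0_norm i0).
by rewrite mulrBr /weighted mulKf ?gt_eqF// [_^-1 * alpha]mulrC.
Qed.

Let mrecip2 : measurable_fun setT (fun p : R * R => alpha / sigma k p.2).
Proof.
apply: measurable_funM => //; apply: (measurableT_comp measurable_recip).
exact: measurable_snd.
Qed.

Let ij : L1 (fun x => `|u 0 x - alpha / sigma k x| * moll d (x - y)).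
Proof.
have mr : measurable_fun setT (fun x => alpha / sigma k x).
  by apply: measurable_funM => //; exact: measurable_recip.
have mg : measurable_fun setT (fun x => `|u 0 x - alpha / sigma k x| * moll d (x - y)).
  apply: measurable_funM; last first.
    by apply: (measurableT_comp (measurable_moll d)); exact: measurable_funB.
  apply: measurableT_comp => //; apply: measurable_funB => //.
  exact: integrable_real_measurable (iu 0).
have bd : 0 <= bb / d by rewrite divr_ge0 ?ltW ?bump_bound_gt0.
apply: (@L1_dominated _ _ (fun x => bb / d * (`|u 0 x| + `|alpha| * s0^-1 * near_diag d (x, y))) mg).
  move=> x; rewrite normrM normr_id mulrC.
  have k1 := moll_near d0 x y.
  have k2 : `|u 0 x - alpha / sigma k x| <= `|u 0 x| + `|alpha| * s0^-1.
    apply: le_trans (ler_normB _ _) _; rewrite lerD2l normrM ler_wpM2l//.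
    by have /andP[r1 r2] := recip_bound x; rewrite ger0_norm.
  apply: (le_trans (ler_pM (normr_ge0 _) (normr_ge0 _) k1 k2)).
  rewrite -[leLHS]mulrA; apply: ler_wpM2l => //; rewrite mulrDr.
  rewrite [leLHS]addrC [leRHS]addrC [near_diag _ _ * (_ * _)]mulrC lerD2l.
  by rewrite ler_piMl// near_diag_le1.
apply: integrable_scale; apply: (@integrable_add _ _ _ leb); first exact: L1_abs.
by apply: (@integrable_scale _ _ _ leb); exact: L1_near_diag_l.
Qed.

Let flux_constant := 2 * bb * width_bound d * K * (Lf * W + (Lf * `|alpha| + `|f k alpha|) * (2 * d)).

(** With a time kernel centred at 0, the time derivative integrates to - moll e 0 over
    (0, T). So moll e 0, of order 1 / e, multiplies the difference between the
    averages of u 0 and of the data, while the flux and source terms stay bounded. *)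
Lemma initial_layer (e eta : R) : 0 < e -> e < T -> 0 < eta ->
  (forall t, `|t| <= e -> l1 (u t \- u 0) <= eta) ->
  bump 0 * (J (u 0) - J (u0 k)) <= 2 * bb * width_bound d * eta + flux_constant * e.
Proof.
move=> e0 eT eta0 ue.
have tf : test_function T (moll2 e 0 d y) by apply: test_function_moll2 => //; rewrite add0r.
have := entropy_strip T0 sigma_gt0 tf (entropy alpha tf).
have [i1 i2 i3] := cut_terms_integrable alpha 0 y e0 d0 mind ind1.
have CF := cut_flux_bound alpha 0 y e0 d0 mind ind1.
rewrite (_ : \int[leb]_x _ = moll e 0 * J (u0 k)); last first.
  rewrite -RintegralZl//; last exact: iu0.
  by apply: eq_Rintegral => x _; rewrite /moll2/= subr0; ring.
pose w' t x := near_diag e (t, 0) * (u t x - u 0 x).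
have iw' t : L1 (w' t) by apply: (@integrable_scale _ _ _ leb); exact: (L1B (iu t) (iu 0)).
have w'E t : l1 (w' t) = near_diag e (t, 0) * l1 (u t \- u 0).
  rewrite /l1 -RintegralZl//; last exact: (L1_abs (L1B (iu t) (iu 0))).
  by apply: eq_Rintegral => x _; rewrite /w' normrM (ger0_norm (near_diag_ge0 _ _)).
have w'W t : l1 (w' t) <= eta.
  rewrite w'E /near_diag/= subr0; case: (leP `|t| e) => te; first by rewrite mul1r ue.
  by rewrite mul0r ltW.
have mn0 : measurable_fun setT (fun p : R * R => near_diag e (p.1, 0)).
  apply: (measurableT_comp (measurable_near_diag e)).
  by apply: measurable_fun_pair.
have mu0 : measurable_fun setT (fun p : R * R => u 0 p.2).
  by apply: (measurableT_comp (integrable_real_measurable (iu 0))).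
have mw' : plane_measurable w'.
  by apply: measurable_funM => //; apply: measurable_funB.
pose g (p : R * R) := near_diag e (p.1, 0) *
  (`|u p.1 p.2 - alpha / sigma k p.2| - `|u 0 p.2 - alpha / sigma k p.2|).
have mg : measurable_fun setT g.
  apply: measurable_funM => //; apply: measurable_funB; apply: measurableT_comp => //;
    by apply: measurable_funB.
have gw p : `|g p| <= 1 * `|w' p.1 p.2| + 0.
  rewrite addr0 mul1r !normrM; apply: ler_wpM2l => //.
  by apply: le_trans (ler_dist_dist _ _) _; rewrite opprB addrA subrK.
pose kk (p : R * R) := (moll' e (p.1 - 0) * moll d (p.2 - y)) * ind p.1.
have mkk : measurable_fun setT kk.
  apply: measurable_funM; last by apply: (measurableT_comp mind).
  exact: (measurable_kernel_product _ _ (measurable_moll' e) (measurable_moll d)).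
have be' : 0 <= bb / e ^+ 2 * width_bound d.
  by rewrite mulr_ge0 ?width_bound_ge0// divr_ge0 ?exprn_ge0 ?ltW ?bump_bound_gt0.
have kkc p : `|kk p| <= bb / e ^+ 2 * width_bound d * box_window e 0 d y p.
  have [_ + _] := kernel_products_box e0 d0 0 y p; apply: le_trans.
  by rewrite /kk normrM ler_piMr.
have [ig Eg] := box_integrable mw' iw' w'W e0 d0 ler01 (lexx 0) be' mg mkk gw kkc.
have near_moll' t : near_diag e (t, 0) * moll' e (t - 0) = moll' e (t - 0).
  rewrite /near_diag/=; case: (leP `|t - 0| e) => [_|h]; first by rewrite mul1r.
  by rewrite mul0r (moll'_out e0 (ltW h)).
have E1 : \int[plane]_p ((sigma k p.2)^-1 * `|w p.1 p.2 - alpha| *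
    (moll' e (p.1 - 0) * moll d (p.2 - y)) * ind p.1) =
    \int[plane]_p (g p * kk p) - moll e 0 * J (u 0).
  have Lm : L1 (fun t => moll' e t * ind t).
    under eq_fun do rewrite mulrC; apply: (@integrable_bounded_mul _ _ _ leb 1) => //.
    have := integrable_scale (-1) (L1_moll' e0 0).
    by under eq_fun do rewrite sub0r moll'N mulN1r opprK.
  have it := plane_integrable_tensor Lm ij.
  have Et : \int[plane]_p (moll' e p.1 * ind p.1 *
      (`|u 0 p.2 - alpha / sigma k p.2| * moll d (p.2 - y))) = - moll e 0 * J (u 0).
    rewrite plane_fubini// -(integral_moll'_strip e0 eT) mulrC -RintegralZl//.
    apply: eq_Rintegral => t _ /=; rewrite RintegralZl//; exact: mulrC.
  rewrite -mulNr -Et -RintegralD//; apply: eq_Rintegral => p _.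
  have nm := near_moll' p.1; rewrite subr0 in nm.
  rewrite recip_gap /g /kk subr0; ring: nm.
rewrite E1; move: CF Eg.
set I2 := \int[plane]_p (_ * (moll e _ * moll' d _) * _); set I3 := \int[plane]_p (_ * (moll e _ * moll d _) * _).
set I1 := \int[plane]_p (g p * kk p) => CF Eg h.
have h1 := ler_norm I1; have h2 := ler_norm I2; have h3 := ler_norm (- I3); rewrite normrN in h3.
have m0 : e * moll e 0 = bump 0 by rewrite /moll mul0r mulrC divfK// gt_eqF.
have h4 : moll e 0 * (J (u 0) - J (u0 k)) <= bb / e ^+ 2 * width_bound d *
    (1 * (eta * (2 * e)) + 0 * (2 * e * (2 * d))) + flux_constant.
  by rewrite /flux_constant mulrBr; lra.
have := ler_wpM2l (ltW e0) h4; rewrite [e * (moll e 0 * _)]mulrA m0 => /le_trans; apply.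
by rewrite le_eqVlt; apply/orP; left; apply/eqP; field; exact: lt0r_neq0.
Qed.

Lemma initial_trace_average : J (u 0) <= J (u0 k).
Proof.
rewrite -subr_le0 -(@pmulr_rle0 _ (bump 0)) ?bump0_gt0//; apply/ler_addgt0Pl => eps eps0.
rewrite addr0; have C0 : 0 <= 2 * bb * width_bound d.
  by rewrite mulr_ge0 ?width_bound_ge0// mulr_ge0// ltW// bump_bound_gt0.
pose C1 := 2 * bb * width_bound d + `|flux_constant| + 1.
have C10 : 0 < C1 by rewrite /C1 ltr_wpDl// addr_ge0.
pose q := eps / (2 * C1).
have q0 : 0 < q by rewrite divr_gt0 ?mulr_gt0.
have [del del0 hdel] := ucont q0.
have [e [e0 edel eT eq]] : exists e, [/\ 0 < e, e <= del, e < T & e <= q].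
  exists (Num.min (Num.min del (T / 2)) q).
  have T20 : 0 < T / 2 by rewrite divr_gt0.
  have T2T : T / 2 < T by rewrite ltr_pdivrMr// mulr_natr mulr2n ltrDl.
  by rewrite !lt_min !ge_min del0 T20 q0 !lexx !orbT !gt_min T2T !orbT.
have := initial_layer e0 eT q0 (fun t te => hdel t (le_trans te edel)).
move/le_trans; apply.
have h1 : 2 * bb * width_bound d * q <= C1 * q.
  by rewrite ler_wpM2r ?(ltW q0)// /C1 -addrA lerDl addr_ge0.
have h2 : flux_constant * e <= C1 * q.
  apply: (@le_trans _ _ (`|flux_constant| * e)); first by rewrite ler_wpM2r ?ler_norm// ltW.
  apply: ler_pM => //; first exact: ltW.
  by rewrite /C1 -addrA addrCA lerDl addr_ge0.
apply: (le_trans (lerD h1 h2)); rewrite le_eqVlt; apply/orP; left; apply/eqP.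
by rewrite /q; field; rewrite gt_eqF.
Qed.

End initial_trace.

End one_component.

(** * Recovering the initial data from averages *)

Section averages.
Context {R : realType}.
Local Notation leb := (@lebesgue_measure R).
Local Notation bb := (@bump_bound R).
Implicit Types v h : R -> R.

Lemma locally_integrable_abs v : locally_integrable setT v ->
  locally_integrable setT (fun x => `|v x|).
Proof.
move=> [mv oT iv]; split => //; first exact: measurableT_comp.
by move=> K KT cK; under eq_integral do rewrite normr_id; exact: iv.
Qed.

Lemma locally_integrable_bounded (B : R) v : measurable_fun setT v ->
  (forall x, `|v x| <= B) -> locally_integrable setT v.
Proof.
move=> mv vB; split => //; first exact: openT.
move=> K KT cK; apply: (@le_lt_trans _ _ (\int[leb]_(x in K) cst B%:E x)%E).
  apply: ge0_le_integral => //; first exact: compact_measurable.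
  - by apply/measurable_EFinP; apply: measurableT_comp => //; exact: measurable_funS mv.
  - by move=> x _; rewrite lee_fin.
rewrite integral_cst; last exact: compact_measurable.
rewrite lte_mul_pinfty ?lee_fin ?(le_trans _ (vB 0))//.
exact: compact_finite_measure.
Qed.

Lemma locally_integrable_L1 v : L1 v -> locally_integrable setT v.
Proof. by move=> iv; apply: open_integrable_locally => //; exact: openT. Qed.

Lemma locally_integrable_moll v (d y : R) : 0 < d -> locally_integrable setT v ->
  L1 (fun x => v x * moll d (x - y)).
Proof.
move=> d0 [mv _ iv]; have bd : 0 <= bb / d by rewrite divr_ge0 ?ltW ?bump_bound_gt0.
have mI : measurable (`[y - d, y + d]%classic : set R) by exact: measurable_itv.
have iI : leb.-integrable `[y - d, y + d] (EFin \o v).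
  apply/integrableP; split; first by apply/measurable_EFinP; exact: measurable_funS mv.
  by apply: iv => //; exact: segment_compact.
have iR : leb.-integrable setT ((EFin \o v) \_ `[y - d, y + d]).
  by apply/(integrable_mkcond _ _).1 => //.
have mg : measurable_fun setT (fun x => v x * moll d (x - y)).
  by apply: measurable_funM => //; apply: (measurableT_comp (measurable_moll d)); exact: measurable_funB.
have iA : L1 (fun x => `|v x| * near_diag d (x, y)).
  have := integrable_abse iR; congr (leb.-integrable setT _); apply/funext => x /=.
  rewrite patchE mem_setE in_itv/= /near_diag/= ler_distl.
  by case: ifP => _; rewrite ?mulr1 ?mulr0//= normr0.
apply: (L1_dominated mg _ (integrable_scale (bb / d) iA)) => x /=.
rewrite normrM mulrC; apply: (le_trans (ler_wpM2r _ (moll_near d0 x y))) => //.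
by rewrite -[leLHS]mulrA ler_wpM2l// mulrC.
Qed.

(** At a Lebesgue point the averages converge to the value, since the kernel is at most
    a constant times the normalised indicator of a ball. *)
Lemma ae_nonpos_of_averages h : locally_integrable setT h ->
  (forall d y : R, 0 < d -> \int[leb]_x (h x * moll d (x - y)) <= 0) ->
  {ae leb, forall x, h x <= 0}.
Proof.
move=> lh hd; apply: ae_mono (lebesgue_differentiation lh) => x hx.
rewrite leNgt; apply/negP => c0; have [mh _ _] := lh.
have b0 := @bump_bound_gt0 R.
pose eta := h x / (4 * bb).
have eta0 : 0 < eta by rewrite divr_gt0// mulr_gt0.
have : \forall d \near (0 : R)^'+, (davg h x d < eta%:E)%E.
  have := hx; rewrite /lebesgue_pt => cv.
  have o : nbhs (0%E : \bar R) [set y | (y < eta%:E)%E].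
    by apply: open_nbhs_nbhs; split; [exact: open_ereal_lt_ereal|rewrite /= lte_fin].
  exact: (cv _ o).
move=> /(filterI (nbhs_right_gt (0 : R)))/filter_ex[d [d0 dd]].
have mb : measurable (ball x d : set R) by exact: measurable_ball.
pose I := (\int[leb]_(y in ball x d) `|(h y - h x)%:E|)%E.
have I0 : (0 <= I)%E by apply: integral_ge0.
have Id : (I < (2 * d * eta)%:E)%E.
  move: dd; rewrite /davg /iavg lebesgue_measure_ball ?(ltW d0)// inver.
  have d2 : 0 < d *+ 2 by rewrite mulrn_wgt0.
  rewrite (gt_eqF d2) lte_pdivrMl// -EFinM.
  by have -> : d *+ 2 * eta = 2 * d * eta by rewrite mulr_natl.
pose k z := moll d (z - x).
have ik : L1 k by exact: L1_moll_shift.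
have k1 : \int[leb]_z k z = 1 by exact: integral_moll_shift.
have ihk : L1 (fun z => h z * k z) by exact: locally_integrable_moll.
have ick := integrable_scale (h x) ik; have idk := integrable_sub ihk ick.
have bd : 0 <= bb / d by rewrite divr_ge0 ?ltW.
have mI : measurable_fun (ball x d) (fun y => `|(h y - h x)%:E|%E).
  by apply/measurable_EFinP; apply: measurableT_comp => //; apply: measurable_funB => //;
    exact: measurable_funS mh.
have E : (\int[leb]_z `|h z * k z - h x * k z|%:E <= (h x / 2)%:E)%E.
  apply: (@le_trans _ _ (\int[leb]_z ((bb / d)%:E * ((fun y => `|(h y - h x)%:E|) \_ (ball x d)) z))%E).
    apply: ge0_le_integral => //.
    - by have /measurable_int := integrable_abs idk.
    - apply: emeasurable_funM => //; exact/(measurable_restrictT _ _).1.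
    - move=> z _; rewrite -mulrBl normrM mulrC EFinM patchE; case: ifPn => [_|/negP zb].
        rewrite -!EFinM lee_fin; apply: ler_wpM2r => //.
        exact: le_moll.
      rewrite mule0 /k moll_out ?normr0 ?mul0e// leNgt; apply/negP => zx; apply: zb.
      by rewrite inE /ball/= distrC.
  rewrite ge0_integralZl//; last 2 first.
  - exact/(measurable_restrictT _ _).1.
  - by move=> z _; rewrite patchE; case: ifP.
  rewrite -integral_mkcond -/I.
  apply: (@le_trans _ _ ((bb / d)%:E * (2 * d * eta)%:E)%E); first exact: lee_wpmul2l (ltW Id).
  rewrite -EFinM lee_fin /eta le_eqVlt; apply/orP; left; apply/eqP; field.
  by rewrite !gt_eqF.
have [_ E'] := @ge0_integrable _ _ _ leb _ _ (integrable_real_measurable (integrable_abs idk))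
  (fun z => normr_ge0 _) E.
have := hd d x d0; have := le_trans (le_normr_Rintegral measurableT idk) E'.
rewrite RintegralB// RintegralZl// k1 mulr1 ler_distl => /andP[h1 _] h2.
have := le_trans h1 h2; rewrite subr_le0 ler_pdivlMr// => h3.
by move: h3; rewrite ger_pMr// lern1.
Qed.

End averages.

(** * Stability *)

Section pair_of_curves.
Context {R : realType} {N : nat}.
Local Notation leb := (@lebesgue_measure R).
Local Notation bb := (@bump_bound R).
Variables (f : 'I_N -> R -> R) (nu : 'I_N -> 'rV[R]_N -> R) (mu : 'I_N -> 'I_N -> R -> R)
  (sigma : 'I_N -> R -> R).
Hypotheses (h1 : H1 f) (h2 : H2 nu mu) (h3 : H3 sigma).
Variables (T : R) (T0 : 0 < T).

Definition gap (U V : 'I_N -> R -> R -> R) k t s := l1 (frozen T U k t \- frozen T V k s).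
Definition total_gap (U V : 'I_N -> R -> R -> R) t s :=
  l1N (fun k => frozen T U k t \- frozen T V k s).

Lemma ess_bv_le (B B' : R) (z : R -> R) : B <= B' -> ess_bv B z -> ess_bv B' z.
Proof.
move=> BB [g [G [gz [ndG GB Gg]]]]; exists g, G; split => //; split => // x.
by have /andP[-> /= Gx] := GB x; exact: le_trans BB.
Qed.

Section one_curve.
Variable U : 'I_N -> R -> R -> R.
Hypothesis cU : forall k, in_C_L1 T (U k).

Lemma total_gap_self t : total_gap U U t t = 0.
Proof.
rewrite /total_gap /l1N big1// => k _; rewrite -[RHS]l1_0; congr l1.
by apply/funext => x /=; rewrite subrr.
Qed.

Lemma weighted_measurable k : measurable_fun setT (sigma k) ->
  plane_measurable (weighted sigma T U k).
Proof.
move=> ms; apply: measurable_funM; first by apply: (measurableT_comp ms).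
exact: (frozen_measurable T0 cU).
Qed.

Lemma weighted_L1 k (S : R) t : measurable_fun setT (sigma k) -> (forall x, `|sigma k x| <= S) ->
  L1 (weighted sigma T U k t) /\ l1 (weighted sigma T U k t) <= S * l1 (frozen T U k t).
Proof.
move=> ms sS; have iu := frozen_L1 T0 cU k t.
have iw : L1 (weighted sigma T U k t) by apply: (@integrable_bounded_mul _ _ _ leb S (sigma k)).
split => //; rewrite /l1 -RintegralZl//; last exact: L1_abs.
apply: le_Rintegral => //; first exact: L1_abs.
- by apply: (@integrable_scale _ _ _ leb); exact: L1_abs.
- by move=> x _; rewrite /weighted normrM ler_wpM2r.
Qed.

Section velocity_bounds.
Variables (M K : R).
Hypothesis uM : forall t, l1N (fun k => frozen T U k t) <= M.
Hypothesis estimates : velocity_control nu mu M K.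

Lemma frozen_velocity_measurable k : plane_measurable (frozen_velocity nu mu T U k).
Proof.
apply: continuous_measurable_plane.
apply: (@plane_continuous_of_modulus _ _ (total_gap U U) (fun x y => `|x - y|) K).
- move=> t s x y; have [_ E] := estimates k.
  by have [_ + _] := E _ _ (fun j => frozen_L1 T0 cU j t) (fun j => frozen_L1 T0 cU j s) (uM t) (uM s); exact.
- by move=> s; exact: (frozen_l1N_cvg T0 cU).
- exact: cvg_dist_self.
Qed.

Lemma frozen_velocity_derivative_measurable k :
  plane_measurable (frozen_velocity_derivative nu mu T U k).
Proof.
apply: continuous_measurable_plane.
apply: (@plane_continuous_of_modulus _ _ (total_gap U U) (fun x y => `|x - y|) K).
- move=> t s x y; have [_ E] := estimates k.
  by have [_ _ +] := E _ _ (fun j => frozen_L1 T0 cU j t) (fun j => frozen_L1 T0 cU j s) (uM t) (uM s); exact.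
- by move=> s; exact: (frozen_l1N_cvg T0 cU).
- exact: cvg_dist_self.
Qed.

Lemma frozen_velocity_le k t x : `|frozen_velocity nu mu T U k t x| <= K.
Proof. by have [+ _] := estimates k; exact. Qed.

Lemma frozen_velocity_derivative_le k t x :
  `|frozen_velocity_derivative nu mu T U k t x| <= K.
Proof.
have iU j : L1 (frozen T U j t) := frozen_L1 T0 cU j t.
by have [_ /(_ _ _ iU iU (uM t) (uM t))[+ _ _]] := estimates k; exact.
Qed.

Lemma weighted_mass k (S : R) t : measurable_fun setT (sigma k) ->
  (forall x, `|sigma k x| <= S) -> l1 (weighted sigma T U k t) <= S * M.
Proof.
move=> ms sS; have [_ h] := weighted_L1 t ms sS; apply: (le_trans h).
rewrite ler_wpM2l ?(le_trans _ (sS 0))//; apply: le_trans (uM t).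
by rewrite /l1N (bigD1 k)//= lerDl; apply: sumr_ge0 => j _; exact: l1_ge0.
Qed.

End velocity_bounds.
End one_curve.

Variables U V : 'I_N -> R -> R -> R.
Hypotheses (cU : forall k, in_C_L1 T (U k)) (cV : forall k, in_C_L1 T (V k)).
Hypotheses (bU : forall k, in_Linfty_BV T (U k)) (bV : forall k, in_Linfty_BV T (V k)).

Let iU k t : L1 (frozen T U k t) := frozen_L1 T0 cU k t.
Let iV k t : L1 (frozen T V k t) := frozen_L1 T0 cV k t.

Lemma gap_modulus k t s r q :
  `|gap U V k t s - gap U V k r q| <= gap U U k t r + gap V V k s q.
Proof. exact: l1_gap_modulus. Qed.

Lemma total_gap_modulus t s r q :
  `|total_gap U V t s - total_gap U V r q| <= total_gap U U t r + total_gap V V s q.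
Proof.
rewrite /total_gap /l1N -sumrB -big_split/=; apply: le_trans (ler_norm_sum _ _ _) _.
by apply: ler_sum => k _; exact: gap_modulus.
Qed.

(** The gap is continuous in the two times, by the L^1 continuity of the curves. *)
Lemma gap_measurable k : plane_measurable (gap U V k).
Proof.
apply: continuous_measurable_plane.
apply: (@plane_continuous_of_modulus _ _ (gap U U k) (gap V V k) 1).
- by move=> t s x y; rewrite mul1r; exact: gap_modulus.
- by move=> s; exact: (frozen_cvg T0 cU).
- by move=> s; exact: (frozen_cvg T0 cV).
Qed.

Lemma total_gap_measurable : plane_measurable (total_gap U V).
Proof.
apply: continuous_measurable_plane.
apply: (@plane_continuous_of_modulus _ _ (total_gap U U) (total_gap V V) 1).
- by move=> t s x y; rewrite mul1r; exact: total_gap_modulus.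
- by move=> s; exact: (frozen_l1N_cvg T0 cU).
- by move=> s; exact: (frozen_l1N_cvg T0 cV).
Qed.

Lemma gap_le_total k t s : gap U V k t s <= total_gap U V t s.
Proof.
rewrite /total_gap /l1N (bigD1 k)//= lerDl; apply: sumr_ge0 => j _; exact: l1_ge0.
Qed.

Lemma total_gap_bound : exists W, forall t s, 0 <= total_gap U V t s <= W.
Proof.
have [M1 m1] := frozen_l1N_bound T0 cU; have [M2 m2] := frozen_l1N_bound T0 cV.
exists (M1 + M2) => t s; rewrite l1N_ge0/=.
apply: le_trans (lerD (m1 t) (m2 s)); rewrite /total_gap /l1N -big_split/=.
apply: ler_sum => k _; have z0 : L1 (fun _ : R => (0 : R)) by exact: integrable0.
have E u : u \- (fun=> 0) = u :> (R -> R) by apply/funext => x /=; rewrite subr0.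
have := l1_triangle (iU k t) z0 (iV k s).
by rewrite E [l1 ((fun=> 0) \- _)]l1B_sym E.
Qed.

(** The constants that enter the doubled inequality for the component k. They are
    chosen from the two curves alone, before any initial data are given. *)
Record component_bounds k (Lf s0 S K M B : R) : Prop := {
  bounds_lipschitz : forall x y, `|f k x - f k y| <= Lf * `|x - y|;
  bounds_s0 : 0 < s0;
  bounds_sigma_ge : forall x, s0 <= sigma k x;
  bounds_sigma_measurable : measurable_fun setT (sigma k);
  bounds_sigma_le : forall x, `|sigma k x| <= S;
  bounds_B : 0 <= B;
  bounds_masses : forall t, l1N (fun j => frozen T U j t) <= M /\ l1N (fun j => frozen T V j t) <= M;
  bounds_velocity : velocity_control nu mu M K;
  bounds_bv : {ae leb, forall t, 0 <= t <= T ->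
    ess_bv B (weighted sigma T U k t) /\ ess_bv B (weighted sigma T V k t)} }.

Lemma component_bounds_ex k : exists Lf s0 S K M B, component_bounds k Lf s0 S K M B.
Proof.
have [Lf _ fL] := lipschitz_bound (h1 k).1.
have [bs s0] := h3 k; have [V0 [Sg vs]] := BV_line_majorant bs.
have [M1 m1] := frozen_l1N_bound T0 cU; have [M2 m2] := frozen_l1N_bound T0 cV.
pose M := Num.max M1 M2.
have [K K0 est] := velocity_estimates h2 M.
have [MU bu] := bU k; have [MV bv] := bV k.
pose S := `|sigma k 0| + V0.
have sS x : `|sigma k x| <= S.
  have := variation_majorant_osc x 0 vs; rewrite /S -lerBlDl.
  by apply: le_trans; exact: lerB_dist.
pose B := Num.max 0 (Num.max (S * MU + MU * V0) (S * MV + MV * V0)).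
exists Lf, (inf (range (sigma k))), S, K, M, B; split => //.
- exact: positive_inf_bound.
- exact: variation_majorant_measurable vs.
- by rewrite /B le_max lexx.
- move=> t; split.
    by apply: (le_trans (m1 t)); rewrite /M le_max lexx.
  by apply: (le_trans (m2 t)); rewrite /M le_max lexx orbT.
- apply: ae_mono (ae_and bu bv) => t [ut vt] tT; rewrite /weighted; split.
    have ev : ess_variation_le MU (frozen T U k t) by rewrite /frozen clamp_id//; exact: ut.
    apply: (@ess_bv_le (S * MU + MU * V0)); first by rewrite /B !le_max lexx !orbT.
    exact: (ess_bv_of_ess_variation (iU k t) ev vs sS).
  have ev : ess_variation_le MV (frozen T V k t) by rewrite /frozen clamp_id//; exact: vt.
  apply: (@ess_bv_le (S * MV + MV * V0)); first by rewrite /B !le_max lexx !orbT.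
  exact: (ess_bv_of_ess_variation (iV k t) ev vs sS).
Qed.

Section component.
Variables (k : 'I_N) (Lf s0 S K M B : R).
Hypothesis bounds : component_bounds k Lf s0 S K M B.
Variables U0 V0 : 'I_N -> R -> R.
Hypothesis entropyU : forall alpha phi, test_function T phi ->
  entropy_ineq f nu mu sigma T U0 U k alpha phi.
Hypothesis entropyV : forall alpha phi, test_function T phi ->
  entropy_ineq f nu mu sigma T V0 V k alpha phi.

Let fL := bounds_lipschitz bounds.
Let s0_gt0 := bounds_s0 bounds.
Let sigma_ge := bounds_sigma_ge bounds.
Let ms := bounds_sigma_measurable bounds.
Let sS := bounds_sigma_le bounds.
Let uM t := (bounds_masses bounds t).1.
Let vM t := (bounds_masses bounds t).2.
Let est := bounds_velocity bounds.
Let S0 : 0 <= S := le_trans (normr_ge0 _) (sS 0).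

Let wU t := weighted_L1 cU t ms sS.
Let wV t := weighted_L1 cV t ms sS.

Let massU t := weighted_mass cU uM t ms sS.
Let massV t := weighted_mass cV vM t ms sS.
Let PU t x := frozen_velocity_le U est k t x.
Let PV t x := frozen_velocity_le V est k t x.
Let P'U t x := frozen_velocity_derivative_le cU uM est k t x.
Let P'V t x := frozen_velocity_derivative_le cV vM est k t x.

(** With the weight 1 / sigma, the weighted distance of the weighted unknowns is the
    distance of U and V itself; the velocities, however, feel all the components. *)
Lemma component_doubling e r : 0 < e -> e < r -> r + e < T -> 0 <=
  \int[plane]_p ((moll' e (p.1 - r) * moll e (p.2 - r) + moll e (p.1 - r) * moll' e (p.2 - r))
     * gap U V k p.1 p.2) +
  bb * Lf * K * (4 + 8 * B + 2 * (S * M)) * (S + 1) *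
    \int[plane]_p (total_gap U V p.1 p.2 * (moll e (p.1 - r) * moll e (p.2 - r))).
Proof.
move=> e0 er rT; have [W HW] := total_gap_bound.
have K0 : 0 <= K := le_trans (normr_ge0 _) (PU 0 0).
have gapW t s : `|gap U V k t s| <= W.
  by rewrite ger0_norm ?l1_ge0//; apply: (le_trans (gap_le_total k t s)); have /andP[] := HW t s.
have bwU : {ae leb, forall t, 0 <= t <= T -> ess_bv B (weighted sigma T U k t)}.
  by apply: ae_mono (bounds_bv bounds) => t h tT; have [] := h tT.
have bwV : {ae leb, forall t, 0 <= t <= T -> ess_bv B (weighted sigma T V k t)}.
  by apply: ae_mono (bounds_bv bounds) => t h tT; have [] := h tT.
have MVL s x y : `|frozen_velocity nu mu T V k s x - frozen_velocity nu mu T V k s y| <= K * `|x - y|.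
  have [_ /(_ _ _ (iV^~ s) (iV^~ s) (vM s) (vM s))[_ /(_ x y) + _]] := est k.
  by rewrite -/(total_gap V V s s) total_gap_self add0r.
have NM t s x : `|frozen_velocity nu mu T U k t x - frozen_velocity nu mu T V k s x| <=
    K * total_gap U V t s.
  have [_ /(_ _ _ (iU^~ t) (iV^~ s) (uM t) (vM s))[_ /(_ x x) + _]] := est k.
  by rewrite subrr normr0 addr0.
have N'M' t s x y : `|frozen_velocity_derivative nu mu T U k t x -
    frozen_velocity_derivative nu mu T V k s y| <= K * (total_gap U V t s + `|x - y|).
  by have [_ /(_ _ _ (iU^~ t) (iV^~ s) (uM t) (vM s))[_ _ +]] := est k; exact.
have gapE t s : gap U V k t s = \int[leb]_x ((sigma k x)^-1 *
    `|weighted sigma T U k t x - weighted sigma T V k s x|).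
  apply: eq_Rintegral => x _; rewrite /weighted -mulrBr normrM.
  have sx : 0 < sigma k x := sigma_gt0 s0_gt0 sigma_ge x.
  by rewrite gtr0_norm// mulKf// gt_eqF.
have wz t s : l1 (weighted sigma T U k t \- weighted sigma T V k s) <= S * total_gap U V t s.
  apply: (@le_trans _ _ (S * gap U V k t s)); last by rewrite ler_wpM2l// gap_le_total.
  have iuv := L1B (iU k t) (iV k s).
  rewrite /gap /l1 -RintegralZl//; last exact: L1_abs.
  apply: le_Rintegral => //; first exact: (L1_abs (L1B (wU t).1 (wV s).1)).
    by apply: (@integrable_scale _ _ _ leb); exact: (L1_abs iuv).
  by move=> x _; rewrite /weighted /= -mulrBr normrM ler_wpM2r.
exact: (doubling_in_time K0 (bounds_B bounds) fL (h1 k).2 (recip_bound s0_gt0 sigma_ge)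
  (measurable_recip s0_gt0 sigma_ge ms) (weighted_measurable cU ms) (weighted_measurable cV ms)
  (frozen_velocity_measurable cU uM est k) (frozen_velocity_measurable cV vM est k)
  (frozen_velocity_derivative_measurable cU uM est k)
  (frozen_velocity_derivative_measurable cV vM est k)
  total_gap_measurable (gap_measurable k) (fun t => (wU t).1) (fun t => (wV t).1)
  massU massV bwU bwV PU PV P'U P'V MVL NM N'M' HW gapW gapE wz
  (entropy_moll_of_solution T0 fL s0_gt0 sigma_ge ms (weighted_measurable cU ms)
    (frozen_velocity_measurable cU uM est k) (frozen_velocity_derivative_measurable cU uM est k)
    (fun t => (wU t).1) massU PU P'U entropyU)
  (entropy_moll_of_solution T0 fL s0_gt0 sigma_ge ms (weighted_measurable cV ms)
    (frozen_velocity_measurable cV vM est k) (frozen_velocity_derivative_measurable cV vM est k)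
    (fun t => (wV t).1) massV PV P'V entropyV) e0 er rT).
Qed.

End component.

Lemma total_gap_continuous r eta : 0 < eta -> exists2 del, 0 < del &
  forall t s, `|t - r| <= del -> `|s - r| <= del ->
  `|total_gap U V t s - total_gap U V r r| <= eta.
Proof.
move=> eta0; have e2 : 0 < eta / 2 by rewrite divr_gt0.
have close (X : 'I_N -> R -> R -> R) : (forall k, in_C_L1 T (X k)) ->
    exists2 del, 0 < del & forall t, `|t - r| <= del -> total_gap X X t r <= eta / 2.
  move=> cX; have /cvgrPdist_le/(_ _ e2)/nbhs_ballP[q /= q0 qh] := frozen_l1N_cvg T0 cX r.
  exists (q / 2); first by rewrite divr_gt0.
  move=> t tr; have /qh : ball r q t.
    rewrite /ball/= distrC (le_lt_trans tr)// ltr_pdivrMr// mulr_natr mulr2n ltrDl//.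
  by rewrite sub0r normrN => h; exact: le_trans (ler_norm _) h.
have [d1 d10 h1'] := close _ cU; have [d2 d20 h2'] := close _ cV.
exists (Num.min d1 d2); first by rewrite lt_min d10.
move=> t s; rewrite !le_min => /andP[t1 _] /andP[_ s2].
apply: le_trans (total_gap_modulus t s r r) _.
by rewrite [leRHS](splitr eta); apply: lerD; [exact: h1'|exact: h2'].
Qed.

(** The inequality of one component involves the gap of all of them, so it is only
    their sum that satisfies a closed inequality. *)
Lemma stability : exists2 C, 0 <= C & forall U0 V0 : 'I_N -> R -> R,
  (forall k alpha phi, test_function T phi -> entropy_ineq f nu mu sigma T U0 U k alpha phi) ->
  (forall k alpha phi, test_function T phi -> entropy_ineq f nu mu sigma T V0 V k alpha phi) ->
  forall t, 0 <= t <= T -> total_gap U V t t <= expR (C * t) * total_gap U V 0 0.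
Proof.
have [W HW] := total_gap_bound.
have gapW k t s : `|gap U V k t s| <= W.
  by rewrite ger0_norm ?l1_ge0//; apply: (le_trans (gap_le_total k t s)); have /andP[] := HW t s.
have /choice[C HC] : forall k, exists C, 0 <= C /\ forall U0 V0 : 'I_N -> R -> R,
    (forall k alpha phi, test_function T phi -> entropy_ineq f nu mu sigma T U0 U k alpha phi) ->
    (forall k alpha phi, test_function T phi -> entropy_ineq f nu mu sigma T V0 V k alpha phi) ->
    forall e r, 0 < e -> e < r -> r + e < T -> 0 <=
    \int[plane]_p ((moll' e (p.1 - r) * moll e (p.2 - r) + moll e (p.1 - r) * moll' e (p.2 - r))
       * gap U V k p.1 p.2) +
    C * \int[plane]_p (total_gap U V p.1 p.2 * (moll e (p.1 - r) * moll e (p.2 - r))).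
  move=> k; have [Lf [s0 [S [K [M [B bounds]]]]]] := component_bounds_ex k.
  exists (bb * Lf * K * (4 + 8 * B + 2 * (S * M)) * (S + 1)); split; last first.
    by move=> U0 V0 eU eV e r; exact: (component_doubling bounds (eU k) (eV k)).
  have S0 : 0 <= S := le_trans (normr_ge0 _) (bounds_sigma_le bounds 0).
  have K0 : 0 <= K.
    by have [h _] := bounds_velocity bounds k; exact: le_trans (normr_ge0 _) (h (fun _ _ => 0) 0).
  have Lf0 : 0 <= Lf.
    by have := le_trans (normr_ge0 _) (bounds_lipschitz bounds 1 0); rewrite subr0 normr1 mulr1.
  have M0 : 0 <= M := le_trans (l1N_ge0 _) (bounds_masses bounds 0).1.
  have B0 := bounds_B bounds; have b0 := @bump_bound_gt0 R.
  by rewrite !mulr_ge0// ?addr_ge0// ?mulr_ge0// ltW.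
exists (\sum_k C k); first by apply: sumr_ge0 => k _; have [] := HC k.
move=> U0 V0 eU eV t tT.
apply: (@gronwall _ T (\sum_k C k) W (total_gap U V)) => //.
- by apply: sumr_ge0 => k _; have [] := HC k.
- exact: total_gap_measurable.
- by move=> a b; have /andP[l0 lW] := HW a b; rewrite ger0_norm.
- by move=> a b; have /andP[] := HW a b.
- exact: total_gap_continuous.
move=> e r e0 er rT.
pose c (p : R * R) := moll' e (p.1 - r) * moll e (p.2 - r) + moll e (p.1 - r) * moll' e (p.2 - r).
pose I := \int[plane]_p (total_gap U V p.1 p.2 * (moll e (p.1 - r) * moll e (p.2 - r))).
have ic : plane.-integrable setT (EFin \o c).
  apply: (@integrable_add _ _ _ plane).
    exact: (plane_integrable_tensor (L1_moll'_shift e0 r) (L1_moll_shift e0 r)).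
  exact: (plane_integrable_tensor (L1_moll_shift e0 r) (L1_moll'_shift e0 r)).
have icg k : plane.-integrable setT (EFin \o (fun p => c p * gap U V k p.1 p.2)).
  rewrite (_ : (fun p => _) = (fun p => gap U V k p.1 p.2 * c p)); last first.
    by apply/funext => p; exact: mulrC.
  apply: (@integrable_bounded_mul _ _ _ plane W (fun p => gap U V k p.1 p.2)) => //.
  exact: gap_measurable.
have part (s : seq 'I_N) : plane.-integrable setT
      (EFin \o (fun p => c p * \sum_(k <- s) gap U V k p.1 p.2)) /\
    0 <= \int[plane]_p (c p * \sum_(k <- s) gap U V k p.1 p.2) + (\sum_(k <- s) C k) * I.
  elim: s => [|k s [igs IH]].
    rewrite (_ : (fun p => _) = (fun=> 0)); last first.
      by apply/funext => p; rewrite big_nil mulr0.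
    split; first exact: integrable0.
    by rewrite big_nil mul0r addr0 /Rintegral integral0.
  rewrite (_ : (fun p => _) = (fun p => c p * gap U V k p.1 p.2 +
    c p * \sum_(k <- s) gap U V k p.1 p.2)); last first.
    by apply/funext => p; rewrite big_cons mulrDr.
  split; first exact: integrable_add.
  rewrite RintegralD// big_cons mulrDl addrACA addr_ge0//.
  by have [_ hk] := HC k; exact: (hk U0 V0 eU eV e r e0 er rT).
by have [_] := part (index_enum _).
Qed.

End pair_of_curves.

(** * Identification of the initial data *)

Section initial_data.
Context {R : realType} {N : nat}.
Local Notation leb := (@lebesgue_measure R).
Variables (f : 'I_N -> R -> R) (nu : 'I_N -> 'rV[R]_N -> R) (mu : 'I_N -> 'I_N -> R -> R)
  (sigma : 'I_N -> R -> R).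
Hypotheses (h1 : H1 f) (h2 : H2 nu mu) (h3 : H3 sigma).
Variables (T : R) (T0 : 0 < T) (U : 'I_N -> R -> R -> R) (U0 : 'I_N -> R -> R).
Hypothesis sol : entropy_solution f nu mu sigma T U0 U.
Hypothesis lU0 : forall k, locally_integrable setT (U0 k).

Let cU k : in_C_L1 T (U k). Proof. by have [+ _ _] := sol; exact. Qed.
Let bU k : in_Linfty_BV T (U k). Proof. by have [_ + _] := sol; exact. Qed.

(* Take for q / s a level close to v: then u is close to it as well. *)
Let gap_of_levels (u v s : R) : 0 < s ->
  (forall q : rat, `|u - ratr q / s| - `|v - ratr q / s| <= 0) -> u = v.
Proof.
move=> s0 h; apply/eqP; rewrite -subr_eq0 -normr_le0; apply/ler_addgt0Pl => eps eps0.
have e0 : 0 < s * (eps / 2) by rewrite mulr_gt0// divr_gt0.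
have [|q] := @rat_in_itvoo R (s * v) (s * v + s * (eps / 2)); first by rewrite ltrDl.
rewrite in_itv/= => /andP[q1 q2].
have vq : `|v - ratr q / s| <= eps / 2.
  have E : v - ratr q / s = (s * v - ratr q) / s by rewrite mulrBl [s * v]mulrC mulfK// gt_eqF.
  rewrite E normrM normfV (gtr0_norm s0) ler_pdivrMr// ler0_norm ?subr_le0 ?ltW//.
  by rewrite opprB ltrBlDl [eps / 2 * s]mulrC.
have := h q; rewrite subr_le0 => uq.
rewrite addr0 [leRHS](splitr eps).
apply: (@le_trans _ _ (`|u - ratr q / s| + `|v - ratr q / s|)).
  by rewrite [`|v - _|]distrC -[u - v](subrKA (ratr q / s)) ler_normD.
by apply: lerD => //; exact: le_trans vq.
Qed.

(** For every level alpha, U at time 0 is on average, hence almost everywhere, at most as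
    far from alpha / sigma as the initial data. The rational levels are countably many
    and come arbitrarily close to sigma times the data. *)
Lemma initial_data_recovered k : {ae leb, forall x, U k 0 x = U0 k x}.
Proof.
have [Lf [s0 [S [K [M [B bounds]]]]]] := component_bounds_ex h1 h2 h3 T0 cU cU bU bU k.
have s0_gt0 := bounds_s0 bounds; have sigma_ge := bounds_sigma_ge bounds.
have ms := bounds_sigma_measurable bounds; have sS := bounds_sigma_le bounds.
have uM t := (bounds_masses bounds t).1; have est := bounds_velocity bounds.
have iU k t : L1 (frozen T U k t) := frozen_L1 T0 cU k t.
have wU t := weighted_L1 T0 cU t ms sS.
have massU t := weighted_mass T0 cU uM t ms sS.
have PU t x := frozen_velocity_le T U est k t x.
have P'U t x := frozen_velocity_derivative_le T0 cU uM est k t x.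
have fr0 : frozen T U k 0 = U k 0 by rewrite /frozen clamp_id// lexx ltW.
have lr alpha : locally_integrable setT (fun x => alpha / sigma k x).
  apply: (@locally_integrable_bounded _ (`|alpha| * s0^-1)).
    by apply: measurable_funM => //; exact: (measurable_recip s0_gt0 sigma_ge ms).
  move=> x; rewrite normrM; apply: ler_wpM2l => //.
  by have /andP[r1 r2] := recip_bound s0_gt0 sigma_ge x; rewrite ger0_norm.
have labs (v : R -> R) alpha : locally_integrable setT v ->
    locally_integrable setT (fun x => `|v x - alpha / sigma k x|).
  by move=> lv; apply: locally_integrable_abs; exact: (locally_integrableB lv (lr alpha)).
have lu : locally_integrable setT (frozen T U k 0) := locally_integrable_L1 (iU k 0).
have ucont eta : 0 < eta -> exists2 del, 0 < del & forall t, `|t| <= del ->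
    l1 (frozen T U k t \- frozen T U k 0) <= eta.
  move=> eta0.
  have /cvgrPdist_le/(_ _ eta0)/nbhs_ballP[q /= q0 qh] := frozen_cvg T0 cU k 0.
  exists (q / 2); first by rewrite divr_gt0.
  move=> t tr; have /qh : ball (0 : R) q t.
    by rewrite /ball/= sub0r normrN (le_lt_trans tr)// ltr_pdivrMr// mulr_natr mulr2n ltrDl.
  by rewrite sub0r normrN => h; exact: le_trans (ler_norm _) h.
have lev alpha : {ae leb, forall x,
    `|frozen T U k 0 x - alpha / sigma k x| - `|U0 k x - alpha / sigma k x| <= 0}.
  have la := labs _ alpha lu; have lb := labs _ alpha (lU0 k).
  apply: ae_nonpos_of_averages; first exact: locally_integrableB.
  move=> d y d0.
  have ia := locally_integrable_moll y d0 la; have ib := locally_integrable_moll y d0 lb.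
  rewrite (_ : Rintegral _ _ _ =
    \int[leb]_x (`|frozen T U k 0 x - alpha / sigma k x| * moll d (x - y)) -
    \int[leb]_x (`|U0 k x - alpha / sigma k x| * moll d (x - y))).
    rewrite subr_le0.
    have [_ _ ent] := sol.
    apply: (initial_trace_average T0 (bounds_lipschitz bounds) s0_gt0 sigma_ge ms
      (weighted_measurable T0 cU ms)
      (frozen_velocity_measurable T0 cU uM est k) (frozen_velocity_derivative_measurable T0 cU uM est k)
      (fun t => (wU t).1) massU PU P'U (ent k) (frozen_measurable T0 cU k) (iU k) ucont) => //.
    by move=> al d' y' d'0; exact: (locally_integrable_moll y' d'0 (labs _ al (lU0 k))).
  by rewrite -RintegralB//; apply: eq_Rintegral => x _; rewrite mulrBl.
have all_lev : {ae leb, forall x, forall n : nat, if unpickle n is Some q then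
      `|frozen T U k 0 x - ratr q / sigma k x| - `|U0 k x - ratr q / sigma k x| <= 0
    else true}.
  apply/ae_foralln => n; case: (unpickle n) => [q|]; first exact: lev.
  exact: ae_all.
apply: ae_mono all_lev => x h.
rewrite -fr0; apply: (gap_of_levels (sigma_gt0 s0_gt0 sigma_ge x)) => q.
by have := h (pickle q); rewrite pickleK.
Qed.

End initial_data.

Lemma L1norm_ae {R : realType} (u v : R -> R) : measurable_fun setT u -> measurable_fun setT v ->
  {ae (@lebesgue_measure R), forall x, u x = v x} -> L1norm u = L1norm v.
Proof.
move=> mu_ mv uv; rewrite /L1norm !Lnorm1; apply: ge0_ae_eq_integral => //.
- by apply/measurable_EFinP; apply: measurableT_comp.
- by apply/measurable_EFinP; apply: measurableT_comp.
- by apply: ae_mono uv => x /= -> _.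
Qed.

Unset Implicit Arguments.

Theorem theorem4p2 (R : realType) (N : nat) (N_gt0 : (0 < N)%N)
    (f : 'I_N -> R -> R) (nu : 'I_N -> 'rV[R]_N -> R)
    (mu : 'I_N -> 'I_N -> R -> R) (sigma : 'I_N -> R -> R)
    (h1 : H1 f) (h2 : H2 nu mu) (h3 : H3 sigma)
    (T : R) (T_gt0 : 0 < T) (U V : 'I_N -> R -> R -> R) :
  (exists C : R, forall U0 V0 : 'I_N -> R -> R,
    (forall k, locally_integrable setT (U0 k)) ->
    (forall k, locally_integrable setT (V0 k)) ->
    entropy_solution f nu mu sigma T U0 U ->
    entropy_solution f nu mu sigma T V0 V ->
    (L1normN (fun k => U k T \- V k T)%R
       <= C%:E * L1normN (fun k => U0 k \- V0 k)%R)%E) /\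
  (forall U0 V0 : 'I_N -> R -> R,
    (forall k, locally_integrable setT (U0 k)) ->
    (forall k, locally_integrable setT (V0 k)) ->
    entropy_solution f nu mu sigma T U0 U ->
    entropy_solution f nu mu sigma T V0 V ->
    (forall k, {ae (@lebesgue_measure R), forall x, U0 k x = V0 k x}) ->
    forall k, {ae (@lebesgue_measure R \x @lebesgue_measure R)%E,
      forall p : R * R, 0 <= p.1 <= T -> U k p.1 p.2 = V k p.1 p.2}).
Proof.
(* The initial data are attained, so their distance is the gap at time 0. *)
have base U0 V0 : (forall k, locally_integrable setT (U0 k)) ->
    (forall k, locally_integrable setT (V0 k)) ->
    entropy_solution f nu mu sigma T U0 U -> entropy_solution f nu mu sigma T V0 V ->
    L1normN (fun k => U0 k \- V0 k) = (total_gap T U V 0 0)%:E.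
  move=> lU0 lV0 sU sV; rewrite /L1normN /total_gap /l1N -sumEFin; apply: eq_bigr => k _.
  have [cU _ _] := sU; have [cV _ _] := sV.
  have fU : frozen T U k 0 = U k 0 by rewrite /frozen clamp_id// lexx ltW.
  have fV : frozen T V k 0 = V k 0 by rewrite /frozen clamp_id// lexx ltW.
  have iuv : L1 (frozen T U k 0 \- frozen T V k 0).
    by apply: L1B; exact: frozen_L1.
  rewrite -(L1norm_l1 iuv); apply: L1norm_ae.
  - by apply: measurable_funB; [have [] := lU0 k|have [] := lV0 k].
  - exact: integrable_real_measurable iuv.
  have eU := initial_data_recovered h1 h2 h3 T_gt0 sU lU0 k.
  have eV := initial_data_recovered h1 h2 h3 T_gt0 sV lV0 k.
  by apply: ae_mono (ae_and eU eV) => x [xU xV] /=; rewrite fU fV xU xV.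
(* The constant must precede the data: data are used only to obtain the regularity of
   U and V, and if there are none any constant will do. *)
have stable : exists2 C, 0 <= C & forall U0 V0,
    entropy_solution f nu mu sigma T U0 U -> entropy_solution f nu mu sigma T V0 V ->
    forall t, 0 <= t <= T -> total_gap T U V t t <= expR (C * t) * total_gap T U V 0 0.
  have [[U0 [V0 [sU sV]]]|no] := pselect (exists U0 V0,
      entropy_solution f nu mu sigma T U0 U /\ entropy_solution f nu mu sigma T V0 V).
    have [cU bU _] := sU; have [cV bV _] := sV.
    have [C C0 HC] := stability h1 h2 h3 T_gt0 cU cV bU bV.
    by exists C => // A B [_ _ eA] [_ _ eB]; exact: HC eA eB.
  by exists 0 => // U0 V0 sU sV; exfalso; apply: no; exists U0, V0.
have [C C0 HC] := stable; split.
  exists (expR (C * T)) => U0 V0 lU0 lV0 sU sV.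
  have [cU _ _] := sU; have [cV _ _] := sV.
  rewrite (base U0 V0 lU0 lV0 sU sV) -EFinM.
  have TT : 0 <= T <= T by rewrite ltW//= lexx.
  have -> : L1normN (fun k => U k T \- V k T) = (total_gap T U V T T)%:E.
    rewrite /L1normN /total_gap /l1N -sumEFin; apply: eq_bigr => k _.
    rewrite -L1norm_l1; last by apply: L1B; exact: frozen_L1.
    by rewrite /frozen clamp_id.
  by rewrite lee_fin; exact: (HC U0 V0).
move=> U0 V0 lU0 lV0 sU sV UV k.
have [cU _ _] := sU; have [cV _ _] := sV.
have mU0 j : measurable_fun setT (U0 j) by have [] := lU0 j.
have mV0 j : measurable_fun setT (V0 j) by have [] := lV0 j.
have gap0 : total_gap T U V 0 0 = 0.
  apply/EFin_inj; rewrite -(base U0 V0 lU0 lV0 sU sV) /L1normN big1// => j _.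
  rewrite (L1norm_ae (v := fun=> 0)).
  - by rewrite L1norm_l1 ?l1_0//; exact: integrable0.
  - exact: measurable_funB.
  - exact: measurable_cst.
  - by apply: ae_mono (UV j) => x /= ->; rewrite subrr.
(* Equal data make the gap vanish at every time; Tonelli's theorem then integrates it
   in time. *)
have l0 t : l1 (frozen T U k t \- frozen T V k t) = 0.
  have cT := clamp_in T_gt0 t.
  have h : total_gap T U V (clamp T t) (clamp T t) <= 0.
    by have := HC U0 V0 sU sV _ cT; rewrite gap0 mulr0.
  apply/le_anti/andP; split; last exact: l1_ge0.
  apply: le_trans h; have E X : frozen T X k (clamp T t) = frozen T X k t.
    by rewrite /frozen (clamp_id cT).
  by have := gap_le_total T U V k (clamp T t) (clamp T t); rewrite /gap !E.
pose g (p : R * R) := frozen T U k p.1 p.2 - frozen T V k p.1 p.2.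
have mg : measurable_fun setT (fun p => (g p)%:E).
  by apply/measurable_EFinP; apply: measurable_funB; exact: (frozen_measurable T_gt0).
have g0 : (\int[(@lebesgue_measure R \x @lebesgue_measure R)%E]_p `|(g p)%:E| = 0)%E.
  have mga : measurable_fun setT (fun p => `|(g p)%:E|%E) by apply: measurableT_comp.
  rewrite -plane_integral (plane_tonelli mga)//.
  rewrite (_ : (fun t => _) = (fun=> 0%E)) ?integral0//; apply/funext => t.
  have it : L1 (frozen T U k t \- frozen T V k t).
    by apply: L1B; exact: frozen_L1.
  have := L1norm_l1 it; rewrite l0 /L1norm Lnorm1; exact.
have := (@ae_eq_integral_abs _ _ _ (@lebesgue_measure R \x @lebesgue_measure R)%E
  setT measurableT (fun p => (g p)%:E) mg).1 g0.
apply: ae_mono => p /(_ I) [/eqP]; rewrite subr_eq0 => /eqP + pT.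
by rewrite /frozen clamp_id.
Qed.
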